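(* Let $1 \leq p < \infty$. The operator space $\mathfrak{R}_{p,cb}$ (the predual of the operator space $\mathfrak{M}_{p,cb}$ of completely bounded Schur multipliers on $S_p$), equipped with the usual matrix product, is a completely contractive Banach algebra. Likewise, $\mathfrak{R}_{p,cb}$ equipped with the Schur product $*$ is a completely contractive Banach algebra.
   Context: For $1\le p<\infty$, $S_p$ is the Schatten class of compact operators $A$ on $\ell_2^{\mathbb{N}}$ with $\|A\|_{S_p}=(\mathrm{Tr}\,(A^*A)^{p/2})^{1/p}<\infty$; $S_\infty$ is the space of compact operators on $\ell_2^{\mathbb{N}}$ with the operator norm. Elements are regarded as $\mathbb{N}\times\mathbb{N}$ matrices. $p^*$ is the conjugate exponent ($1/p+1/p^*=1$). Duality pairing: $\langle A,B\rangle_{S_p,S_{p^*}}=\mathrm{Tr}(AB^T)$, with $B^T$ the matrix transpose. Operator space structures: $S_\infty$ has its $C^*$-algebra structure, $S_1$ is the dual of $S_\infty$ (via the pairing $\langle A,B\rangle_{S_1,S_\infty}=\mathrm{Tr}(AB^T)$), and $S_p=(S_\infty,S_1)_{1/p}$ by complex interpolation, with $M_n(E_\theta)=(M_n(E_0),M_n(E_1))_\theta$. $*$ is the Schur (entrywise) product $[a_{ij}]*[b_{ij}]=[a_{ij}b_{ij}]$. A matrix $A$ defines a Schur multiplier $M_A$ on $S_p$ if $M_A(B)=A*B\in S_p$ for all $B\in S_p$. $\mathfrak{M}_{p,cb}$ is the space of completely bounded Schur multipliers on $S_p$, with the operator space structure inherited from $CB(S_p)$. $\widehat{\otimes}$ is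 the operator space projective tensor product. Let $\psi_p: S_p\widehat{\otimes}S_{p^*}\to S_1$ be the completely contractive map with $\psi_p(A\otimes B)=A*B$. $\mathfrak{R}_{p,cb}$ is the space $\mathrm{Im}\,\psi_p\subset S_1$ equipped with the operator space structure of the quotient $(S_p\widehat{\otimes}S_{p^*})/\mathrm{Ker}\,\psi_p$. One has $(\mathfrak{R}_{p,cb})^*=\mathfrak{M}_{p,cb}$ completely isometrically. A Banach algebra $\mathcal{A}$ with an operator space structure is completely contractive if its product is a jointly completely contractive bilinear map $\mathcal{A}\times\mathcal{A}\to\mathcal{A}$, i.e. induces a complete contraction $\mathcal{A}\widehat{\otimes}\mathcal{A}\to\mathcal{A}$. *)

(* Defs.v *)
From HB Require Import structures.
From mathcomp Require Import all_boot all_order all_algebra.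
From mathcomp Require Import complex mxtens.
From mathcomp Require Import all_classical all_reals all_analysis.
Import Order.TTheory GRing.Theory Num.Theory.
Import numFieldNormedType.Exports.

Set Implicit Arguments.
Unset Strict Implicit.
Unset Printing Implicit Defensive.

Local Open Scope classical_set_scope.
Local Open Scope ring_scope.

(* The alias R[i]^o (convertible to R[i]) carries the topology of the complex
   numbers; `complex.Re`, `Complex a b` and `Normc.normc : R[i] -> R` are the
   real part, a + ib, and the real-valued modulus. *)

Definition l2norm (R : realType) (I : choiceType) (x : I -> R[i]) : \bar R :=
  poweR (\esum_(i in [set: I]) (ComplexField.Normc.normc (x i) ^+ 2)%:E) 2^-1.

(* Finitely supported vectors of norm at most 1.  They are dense in the unit
   ball of l^2(J), so a matrix `a` defines a bounded operator from l^2(J) to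
   l^2(I) exactly when `opnorm a` below is finite, which is then the norm of
   that operator. *)
Definition fin_ball (R : realType) (J : choiceType) : set (J -> R[i]) :=
  [set x | finite_set [set j | x j != 0] /\ (l2norm x <= 1)%E].

Definition mxact (R : realType) (I J : choiceType) (a : I -> J -> R[i])
    (x : J -> R[i]) : I -> R[i] :=
  fun i => \sum_(j \in [set: J]) a i j * x j.

Definition opnorm (R : realType) (I J : choiceType) (a : I -> J -> R[i]) :
    \bar R :=
  ereal_sup [set l2norm (mxact a x) | x in @fin_ball R J].

(* The matrices indexed by N x N, in which all the S_p live. *)
Definition infmx (R : realType) := nat -> nat -> R[i].

(* M_n(V), with the pointwise module structure. *)
Notation mat n V := ('I_n -> 'I_n -> V).

(* An operator space E contained in a vector space V is given by the norms of
   the spaces M_n(E), extended to M_n(V) by the value +oo outside M_n(E). *)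
Definition mxnorm (R : realType) (V : lmodType R[i]) :=
  forall n : nat, mat n V -> \bar R.

Definition mat1 (V : Type) (v : V) : mat 1 V := fun _ _ => v.

Definition carrier (R : realType) (V : lmodType R[i]) (N : mxnorm V) : set V :=
  [set v | (N 1%N (mat1 v) < +oo)%E].

Definition mxlr (R : realType) (V : lmodType R[i]) (n m : nat)
    (a : 'M[R[i]]_(n, m)) (x : mat m V) (b : 'M[R[i]]_(m, n)) : mat n V :=
  fun i j => \sum_k \sum_l (a i k * b l j) *: x k l.

Definition mxdsum (R : realType) (V : lmodType R[i]) (m n : nat)
    (x : mat m V) (y : mat n V) : mat (m + n) V :=
  fun i j => match fintype.split i, fintype.split j with
             | inl k, inl l => x k l
             | inr k, inr l => y k l
             | _, _ => 0
             end.

Definition mxamp (V W T : Type) (f : V -> W -> T) (m n : nat)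
    (x : mat m V) (y : mat n W) : mat (m * n) T :=
  fun i j => f (x (mxtens_unindex i).1 (mxtens_unindex j).1)
               (y (mxtens_unindex i).2 (mxtens_unindex j).2).

Definition norm_cvg (R : realType) (W : lmodType R[i]) (N : W -> \bar R)
    (T : Type) (F : set_system T) (f : T -> W) (l : W) :=
  forall e : R, 0 < e -> \forall t \near F, (N (f t - l)%R < e%:E)%E.

Definition norm_cauchy (R : realType) (W : lmodType R[i]) (N : W -> \bar R)
    (u : nat -> W) :=
  forall e : R, 0 < e -> exists k0 : nat, forall k l : nat,
    (k0 <= k)%N -> (k0 <= l)%N -> (N (u k - u l)%R < e%:E)%E.

Record complete_opspace (R : realType) (V : lmodType R[i]) (N : mxnorm V) :
    Prop := {
  opspace_ge0 : forall n (x : mat n V), (0 <= N n x)%E;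
  opspace_def : forall n (x : mat n V), N n x = 0%E -> x = 0;
  opspace_scale : forall n (c : R[i]) (x : mat n V),
    N n (c *: x) = ((ComplexField.Normc.normc c)%:E * N n x)%E;
  opspace_triangle : forall n (x y : mat n V),
    (N n (x + y)%R <= N n x + N n y)%E;
  opspace_dsum : forall m n (x : mat m V) (y : mat n V),
    N (m + n)%N (mxdsum x y) = maxe (N m x) (N n y);
  opspace_mxlr : forall n m (a : 'M[R[i]]_(n, m)) (x : mat m V)
      (b : 'M[R[i]]_(m, n)),
    (N n (mxlr a x b) <= opnorm a * N m x * opnorm b)%E;
  opspace_complete : forall u : nat -> V,
    (forall k, carrier N (u k)) ->
    norm_cauchy (fun v => N 1%N (mat1 v)) u ->
    exists2 l, carrier N l & norm_cvg (fun v => N 1%N (mat1 v)) \oo u l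
}.

Record completely_contractive_Banach_algebra (R : realType)
    (V : lmodType R[i]) (N : mxnorm V) (mul : V -> V -> V) : Prop := {
  ccba_opspace : complete_opspace N;
  ccba_closed : forall a b, carrier N a -> carrier N b -> carrier N (mul a b);
  ccba_linearl : forall (c : R[i]) a a' b,
    carrier N a -> carrier N a' -> carrier N b ->
    mul (c *: a + a') b = c *: mul a b + mul a' b;
  ccba_linearr : forall (c : R[i]) a b b',
    carrier N a -> carrier N b -> carrier N b' ->
    mul a (c *: b + b') = c *: mul a b + mul a b';
  ccba_assoc : forall a b c, carrier N a -> carrier N b -> carrier N c ->
    mul a (mul b c) = mul (mul a b) c;
  ccba_jcc : forall m n (x : mat m V) (y : mat n V),
    (N m x < +oo)%E -> (N n y < +oo)%E ->
    (N (m * n)%N (mxamp mul x y) <= N m x * N n y)%E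
}.

Definition schur (R : realType) (a b : infmx R) : infmx R :=
  fun i j => a i j * b i j.

Definition mxprod_cvg (R : realType) (a b : infmx R) :=
  forall i j, cvgn (series (fun k => a i k * b k j : R[i]^o)).

(* A limit of partial sums; the series converge absolutely when a and b are
   bounded on l^2, by Cauchy-Schwarz, hence in particular on S_1. *)
Definition mxprod (R : realType) (a b : infmx R) : infmx R :=
  fun i j => limn (series (fun k => a i k * b k j : R[i]^o)).

Definition trace_cvg (R : realType) (a : infmx R) :=
  cvgn (series (fun i => a i i : R[i]^o)).

Definition trace (R : realType) (a : infmx R) : R[i] :=
  limn (series (fun i => a i i : R[i]^o)).

Definition transpose (R : realType) (a : infmx R) : infmx R := fun i j => a j i.

Definition pairing_cvg (R : realType) (a b : infmx R) :=
  mxprod_cvg a (transpose b) /\ trace_cvg (mxprod a (transpose b)).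

Definition pairing (R : realType) (a b : infmx R) : R[i] :=
  trace (mxprod a (transpose b)).

(* The image of the unit ball is totally bounded in l^2. *)
Definition compact_op (R : realType) (a : infmx R) :=
  forall e : R, 0 < e -> exists F : set (nat -> R[i]),
    [/\ finite_set F, (forall y, F y -> (l2norm y < +oo)%E) &
        forall x : nat -> R[i], fin_ball x ->
          exists2 y, F y & (l2norm (mxact a x - y)%R < e%:E)%E].

(* M_n(S_oo) acts on l^2('I_n * nat), the direct sum of n copies of l^2. *)
Definition Sinfty (R : realType) : mxnorm (infmx R) := fun n x =>
  if `[< forall k l, compact_op (x k l) >]
  then opnorm (fun i j : 'I_n * nat => x i.1 j.1 i.2 j.2)
  else +oo%E.

(* The operator space dual of S_oo: M_n(S_1) = CB(S_oo, M_n), where a matrix a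
   is the functional b |-> Tr(a b^T). *)
Definition Sone (R : realType) : mxnorm (infmx R) := fun n x =>
  if `[< forall k l b, compact_op b -> pairing_cvg (x k l) b >]
  then ereal_sup [set r | exists m (y : mat m (infmx R)),
         (Sinfty y <= 1)%E /\
         r = opnorm (fun i j : 'I_n * 'I_m => pairing (x i.1 j.1) (y i.2 j.2))]
  else +oo%E.

(* Complex interpolation of a couple of Banach spaces E_0, E_1 inside a vector
   space W, given by their norms N0, N1 extended by +oo. *)

Definition sum_norm (R : realType) (W : lmodType R[i]) (N0 N1 : W -> \bar R)
    (x : W) : \bar R :=
  ereal_inf [set (N0 y.1 + N1 y.2)%E | y in [set y : W * W | x = y.1 + y.2]].

Definition strip (R : realType) : set (R[i]^o) :=
  [set z | 0 <= complex.Re z <= 1].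

Definition open_strip (R : realType) : set (R[i]^o) :=
  [set z | 0 < complex.Re z < 1].

(* f belongs to the space F(E_0, E_1), with norm at most M. *)
Record calderon (R : realType) (W : lmodType R[i]) (N0 N1 : W -> \bar R)
    (f : R[i]^o -> W) (M : R) : Prop := {
  calderon_bounded : exists K : R, forall z, strip z ->
    (sum_norm N0 N1 (f z) <= K%:E)%E;
  calderon_continuous : forall z, strip z ->
    norm_cvg (sum_norm N0 N1) (within (@strip R) (nbhs z)) f (f z);
  calderon_analytic : forall z, open_strip z -> exists l : W,
    norm_cvg (sum_norm N0 N1) (dnbhs (0 : R[i]^o))
      (fun h : R[i]^o => (h : R[i])^-1 *: (f (z + h) - f z)) l;
  calderon_left : forall t : R, (N0 (f (Complex 0 t)%R) <= M%:E)%E;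
  calderon_right : forall t : R, (N1 (f (Complex 1 t)%R) <= M%:E)%E;
  calderon_left_continuous : forall t : R,
    norm_cvg N0 (nbhs t) (fun s : R => f (Complex 0 s)) (f (Complex 0 t));
  calderon_right_continuous : forall t : R,
    norm_cvg N1 (nbhs t) (fun s : R => f (Complex 1 s)) (f (Complex 1 t))
}.

Definition interp (R : realType) (W : lmodType R[i]) (N0 N1 : W -> \bar R)
    (theta : R) (x : W) : \bar R :=
  ereal_inf [set M%:E | M in [set M : R |
    exists2 f, calderon N0 N1 f M & f (Complex theta 0) = x]].

Definition interp_opspace (R : realType) (V : lmodType R[i]) (E0 E1 : mxnorm V)
    (theta : R) : mxnorm V :=
  fun n => interp (E0 n) (E1 n) theta.

(* Meant for 1 <= p <= +oo; the endpoints theta = 0, 1 are the spaces themselves. *)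
Definition schatten (R : realType) (p : \bar R) : mxnorm (infmx R) :=
  if p == +oo%E then @Sinfty R
  else if p == 1%E then @Sone R
  else interp_opspace (@Sinfty R) (@Sone R) (fine p)^-1.

(* The algebraic tensor product of V and W is embedded in the dual of the space
   of bilinear forms on V x W. *)
Definition tens (R : realType) (V W : lmodType R[i]) (v : V) (w : W) :
    {bilinear V -> W -> R[i]^o} -> R[i]^o := fun b => b v w.

(* ||u|| is the infimum of ||alpha|| ||x|| ||y|| ||beta|| over the
   decompositions u = alpha (x (x) y) beta; it is +oo outside M_n(E (x) F). *)
Definition proj_norm (R : realType) (V W : lmodType R[i])
    (E : mxnorm V) (F : mxnorm W) :
    mxnorm ({bilinear V -> W -> R[i]^o} -> R[i]^o) := fun n u =>
  ereal_inf [set r | exists p q (a : 'M[R[i]]_(n, p * q)) (x : mat p V)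
      (y : mat q W) (b : 'M[R[i]]_(p * q, n)),
    [/\ (E p x < +oo)%E, (F q y < +oo)%E,
        u = mxlr a (mxamp (@tens R V W) x y) b &
        r = (opnorm a * E p x * F q y * opnorm b)%E]].

Definition schur_entry (R : realType) (i j : nat) (a b : infmx R) : R[i]^o :=
  schur a b i j.

Lemma schur_entry_is_bilinear (R : realType) (i j : nat) :
  bilinear_for *:%R *:%R (@schur_entry R i j).
Proof.
split=> [b|a] c x y; rewrite /schur_entry /schur /=.
- by rewrite !fctE mulrDl /GRing.scale /= mulrA.
- by rewrite !fctE mulrDr /GRing.scale /= mulrCA.
Qed.

HB.instance Definition _ (R : realType) (i j : nat) :=
  bilinear_isBilinear.Build R[i] (infmx R) (infmx R) R[i]^o _ _
    (@schur_entry R i j) (schur_entry_is_bilinear R i j).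

(* The linear map with psi (a (x) b) = a * b. *)
Definition psi (R : realType)
    (u : {bilinear (infmx R) -> (infmx R) -> R[i]^o} -> R[i]^o) : infmx R :=
  fun i j => u (@schur_entry R i j).

(* The quotient norm on M_n of the image of psi.  An element of M_n of the
   completion S_p ^(x) S_p* is represented by a Cauchy sequence (u_k) in
   M_n(S_p (x) S_p* ); its norm is lim ||u_k||, and its image under psi is the
   limit of the psi(u_k) in M_n(S_1). *)
Definition Rpcb (R : realType) (p : \bar R) : mxnorm (infmx R) := fun n x =>
  let P := proj_norm (schatten p) (schatten (hoelder_conjugate p)) in
  ereal_inf [set limn (fun k => P n (u k)) | u in
    [set u | [/\ forall k, (P n (u k) < +oo)%E,
                 norm_cauchy (P n) u &
                 norm_cvg (@Sone R n) \oo (fun k i j => psi (u k i j)) x]]].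

(* Main.v *)
(* The relation (x * x') * (y * y') = (x * y) * (x' * y') between Schur products
   reduces the Schur product on R_{p,cb} to the complete contractivity of the
   Schur product on S_p and on S_{p*}, which follows by interpolation from the
   cases of S_oo and S_1.  For the matrix product,
     (a * b)(c * d) = sum_k (a e_kk c) * (b e_kk d)
   is the average over the diagonal sign matrices D of (a D c) * (b D d), so that
   it is enough to know that (a, c) |-> a D c is jointly completely contractive on
   S_p and on S_{p*}, again by interpolation; the truncations of the sum over k
   converge because the tails x (1 - P_K) tend to 0 for x in S_p when p > 1, and
   for x in S_oo when p = 1.  That the Schur product maps S_p (x) S_{p*} into S_1
   contractively is the three lines theorem applied to the Schur product of two
   functions of the Calderon space, and gives the entrywise control of the
   completion of the projective norm. *)

Require Import Defs.
From HB Require Import structures.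
From mathcomp Require Import all_boot all_order all_algebra.
From mathcomp Require Import complex mxtens.
From mathcomp Require Import ring lra.
From mathcomp Require Import finmap all_classical all_reals all_analysis.
Import Order.TTheory GRing.Theory Num.Theory.
Import numFieldNormedType.Exports.

Set Implicit Arguments.
Unset Strict Implicit.
Unset Printing Implicit Defensive.

Local Open Scope ring_scope.

(** * Matrices over finite index sets *)

(** Each norm is handled as the predicate of being at most c, on matrices indexed by arbitrary
    finite types: tensor products and direct sums are then literally indexed by [I * J] and [I + J],
    and ordinals return only when the predicates are compared with the norms of the statement.
    Contractivity must hold with constant exactly 1, so crude constants are admissible only where
    finiteness or convergence is at stake. Two devices respect this: averaging over signs, which is
    convex, and passing to powers f ^ m, which removes the constant from a rough Cauchy estimate and
    gives the maximum principle on the strip without contour integrals. On S_oo the Schur product is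
    a compression of the tensor product; on S_1 one transposes the pairing. A further obstacle is
    that the quotient is taken after completion: an infinite matrix product has to converge for the
    projective norm itself and not merely in S_1. Columns of a Schur product can be scaled in either
    factor, so that small tails in one member of the pair suffice; this is how p = 1 can lean on
    S_oo. *)

Section ComplexModulus.
Variable R : rcfType.
Implicit Types z w : R[i].
Local Notation nc := (@ComplexField.Normc.normc R).

Lemma nc_ge0 z : 0 <= nc z.
Proof. by case: z => a b /=; rewrite sqrtr_ge0. Qed.

Lemma nc0 : nc 0 = 0. Proof. exact: ComplexField.Normc.normc0. Qed.

Lemma nc1 : nc 1 = 1. Proof. exact: ComplexField.Normc.normc1. Qed.

Lemma ncM z w : nc (z * w) = nc z * nc w.
Proof. exact: ComplexField.Normc.normcM. Qed.

Lemma ncV z : nc z^-1 = (nc z)^-1.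
Proof. exact: ComplexField.Normc.normcV. Qed.

Lemma ncX z n : nc (z ^+ n) = nc z ^+ n.
Proof. by elim: n => [|n IH]; rewrite ?expr0 ?nc1// !exprS ncM IH. Qed.

Lemma ncD z w : nc (z + w) <= nc z + nc w.
Proof. exact: le_normcD. Qed.

Lemma ncN z : nc (- z) = nc z. Proof. exact: normcN. Qed.

Lemma ncB z w : nc (z - w) <= nc z + nc w.
Proof. by rewrite -(ncN w) ncD. Qed.

Lemma nc_distC z w : nc (z - w) = nc (w - z).
Proof. by rewrite -ncN opprB. Qed.

Lemma nc_sum (I : Type) (r : seq I) (P : pred I) (F : I -> R[i]) :
  nc (\sum_(i <- r | P i) F i) <= \sum_(i <- r | P i) nc (F i).
Proof.
elim/big_rec2: _ => [|i y1 y2 _ le12]; first by rewrite nc0.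
by apply: le_trans (ncD _ _) _; rewrite lerD2l.
Qed.

Lemma nc_sqr z : nc z ^+ 2 = complex.Re z ^+ 2 + complex.Im z ^+ 2.
Proof. by case: z => a b /=; rewrite sqr_sqrtr// addr_ge0// sqr_ge0. Qed.

Lemma nc_eq0 z : (nc z == 0) = (z == 0).
Proof.
apply/eqP/eqP => [/ComplexField.Normc.eq0_normc//|->]; exact: nc0.
Qed.

Lemma nc_gt0 z : (0 < nc z) = (z != 0).
Proof. by rewrite lt_def nc_ge0 andbT nc_eq0. Qed.

Lemma nc_real (x : R) : nc (x%:C)%C = `|x|.
Proof. by rewrite /= expr0n/= addr0 sqrtr_sqr. Qed.

Lemma nc_nat n : nc n%:R = n%:R.
Proof.
have -> : n%:R = ((n%:R : R)%:C)%C by rewrite rmorph_nat.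
by rewrite nc_real normr_nat.
Qed.

Lemma sum_RtoC (I : Type) (r : seq I) (P : pred I) (F : I -> R) :
  \sum_(i <- r | P i) (F i)%:C%C = ((\sum_(i <- r | P i) F i)%:C)%C.
Proof. by rewrite rmorph_sum. Qed.

Lemma nc_conj z : nc (z^*)%C = nc z.
Proof. by case: z => a b /=; rewrite sqrrN. Qed.

Lemma mul_conj z : z * (z^*)%C = ((nc z ^+ 2)%:C)%C.
Proof.
rewrite nc_sqr; case: z => a b; apply/eqP; rewrite eq_complex /=.
by apply/andP; split; apply/eqP; ring.
Qed.

Lemma Re_nc z : `|complex.Re z| <= nc z.
Proof.
rewrite -(ler_pXn2r (_ : 0 < 2)%N) ?nnegrE ?nc_ge0// nc_sqr real_normK ?num_real//.
by rewrite lerDl sqr_ge0.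
Qed.

Lemma Im_nc z : `|complex.Im z| <= nc z.
Proof.
rewrite -(ler_pXn2r (_ : 0 < 2)%N) ?nnegrE ?nc_ge0// nc_sqr real_normK ?num_real//.
by rewrite lerDr sqr_ge0.
Qed.

Lemma nc_ReIm z : nc z <= `|complex.Re z| + `|complex.Im z|.
Proof.
rewrite -(ler_pXn2r (_ : 0 < 2)%N) ?nnegrE ?nc_ge0 ?addr_ge0// nc_sqr.
rewrite sqrrD !real_normK ?num_real// lerD2r lerDl.
by rewrite mulrn_wge0// mulr_ge0.
Qed.

End ComplexModulus.

Section FiniteMatrices.
Variable R : rcfType.
Local Notation nc := (@ComplexField.Normc.normc R).

Definition nrm2 (I : finType) (x : I -> R[i]) : R := \sum_i nc (x i) ^+ 2.
Definition nrm (I : finType) (x : I -> R[i]) : R := Num.sqrt (nrm2 x).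
Definition mxv (I J : finType) (a : I -> J -> R[i]) (x : J -> R[i]) : I -> R[i] :=
  fun i => \sum_j a i j * x j.
(* As everywhere below, a norm is represented by the relation of being at most a
   given real number. *)
Definition opb (I J : finType) (a : I -> J -> R[i]) (c : R) : Prop :=
  0 <= c /\ forall x, nrm (mxv a x) <= c * nrm x.

Lemma nrm2_ge0 (I : finType) (x : I -> R[i]) : 0 <= nrm2 x.
Proof. by apply: sumr_ge0 => i _; apply: sqr_ge0. Qed.

Lemma nrm_ge0 (I : finType) (x : I -> R[i]) : 0 <= nrm x.
Proof. exact: sqrtr_ge0. Qed.

Lemma nrm_sqr (I : finType) (x : I -> R[i]) : nrm x ^+ 2 = nrm2 x.
Proof. by rewrite sqr_sqrtr// nrm2_ge0. Qed.

Lemma eq_nrm2 (I : finType) (x y : I -> R[i]) : x =1 y -> nrm2 x = nrm2 y.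
Proof. by move=> e; apply: eq_bigr => i _; rewrite e. Qed.

Lemma eq_nrm (I : finType) (x y : I -> R[i]) : x =1 y -> nrm x = nrm y.
Proof. by move=> e; rewrite /nrm (eq_nrm2 e). Qed.

Lemma le_nrm (I J : finType) (x : I -> R[i]) (y : J -> R[i]) c : 0 <= c ->
  (nrm x <= c * nrm y) = (nrm2 x <= c ^+ 2 * nrm2 y).
Proof.
by move=> c0; rewrite -!nrm_sqr -exprMn ler_pXn2r// nnegrE ?mulr_ge0 ?nrm_ge0.
Qed.

Lemma nc_le_nrm (I : finType) (x : I -> R[i]) i : nc (x i) <= nrm x.
Proof.
rewrite -(ler_pXn2r (_ : 0 < 2)%N) ?nnegrE ?nrm_ge0 ?nc_ge0// nrm_sqr.
rewrite /nrm2 (bigD1 i)//= lerDl; apply: sumr_ge0 => *; exact: sqr_ge0.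
Qed.

Lemma sum_codom (V : nmodType) (I J : finType) (f : I -> J) (F : J -> V) :
  injective f -> \sum_(j | j \in codom f) F j = \sum_i F (f i).
Proof.
by move=> fI; rewrite -big_uniq ?big_image//= map_inj_uniq ?enum_uniq.
Qed.

Lemma sum_pair (V : nmodType) (I J : finType) (F : I * J -> V) :
  \sum_p F p = \sum_i \sum_j F (i, j).
Proof. by rewrite pair_bigA; apply: eq_bigr => -[]. Qed.

Lemma sum_supp (V : nmodType) (I J : finType) (f : I -> J) (F : J -> V) :
  injective f -> (forall j, j \notin codom f -> F j = 0) ->
  \sum_j F j = \sum_i F (f i).
Proof.
move=> fI F0; rewrite (bigID (mem (codom f)))/= sum_codom//.
by rewrite [X in _ + X]big1 ?addr0.
Qed.

Lemma nrm_inj (I J : finType) (f : I -> J) (x : J -> R[i]) : injective f ->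
  nrm2 (x \o f) <= nrm2 x.
Proof.
move=> fI; rewrite /nrm2 (bigID (mem (codom f)))/= [X in _ <= X + _](_ : _ =
   \sum_i nc (x (f i)) ^+ 2).
  by rewrite lerDl; apply: sumr_ge0 => *; exact: sqr_ge0.
by rewrite sum_codom.
Qed.

(** Lagrange's identity: twice the difference of the two sides is the sum of the squares
    [(a i * b j - a j * b i) ^+ 2]. *)
Lemma real_CS (I : finType) (a b : I -> R) :
  (\sum_i a i * b i) ^+ 2 <= (\sum_i a i ^+ 2) * (\sum_i b i ^+ 2).
Proof.
have h : 0 <= \sum_i \sum_j (a i * b j - a j * b i) ^+ 2.
  by apply: sumr_ge0 => i _; apply: sumr_ge0 => j _; apply: sqr_ge0.
have e1 : \sum_i \sum_j (a i * b j - a j * b i) ^+ 2 =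
   (\sum_i a i ^+ 2) * (\sum_i b i ^+ 2) * 2 - (\sum_i a i * b i) ^+ 2 * 2.
  have e2 : (\sum_i a i ^+ 2) * (\sum_i b i ^+ 2) =
      \sum_i \sum_j a i ^+ 2 * b j ^+ 2 by rewrite big_distrlr.
  have e3 : (\sum_i a i ^+ 2) * (\sum_i b i ^+ 2) =
      \sum_i \sum_j a j ^+ 2 * b i ^+ 2 by rewrite e2 exchange_big.
  rewrite mulr_natr mulr2n {1}e2 e3 expr2 big_distrlr/= mulr_natr mulr2n.
  rewrite -!big_split/= -sumrB; apply: eq_bigr => i _.
  by rewrite -!big_split/= -sumrB; apply: eq_bigr => j _; ring.
by rewrite e1 in h; lra.
Qed.

Lemma nc_CS (I : finType) (x y : I -> R[i]) :
  nc (\sum_i x i * y i) <= nrm x * nrm y.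
Proof.
apply: le_trans (nc_sum _ _ _) _.
rewrite -(ler_pXn2r (_ : 0 < 2)%N) ?nnegrE ?sumr_ge0//; last first.
- by rewrite mulr_ge0// nrm_ge0.
- by move=> *; apply: nc_ge0.
rewrite exprMn !nrm_sqr; under eq_bigr do rewrite ncM.
exact: real_CS.
Qed.

Lemma nrm_sharp (I : finType) (x : I -> R[i]) (c : R) : 0 <= c ->
  (forall y, nc (\sum_i y i * x i) <= c * nrm y) -> nrm x <= c.
Proof.
move=> c0 /(_ (fun i => (x i)^*)%C).
have -> : nrm (fun i => (x i)^*%C) = nrm x.
  by rewrite /nrm /nrm2; under eq_bigr do rewrite nc_conj.
have -> : nc (\sum_i (x i)^*%C * x i) = nrm x * nrm x.
  under eq_bigr do rewrite mulrC mul_conj.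
  by rewrite sum_RtoC nc_real -expr2 nrm_sqr ger0_norm// nrm2_ge0.
have := nrm_ge0 x; rewrite le_eqVlt => /predU1P[<-//|x0].
by rewrite ler_pM2r.
Qed.

Lemma nrmD (I : finType) (x y : I -> R[i]) :
  nrm (fun i => x i + y i) <= nrm x + nrm y.
Proof.
apply: nrm_sharp => [|z]; first by rewrite addr_ge0 ?nrm_ge0.
under eq_bigr do rewrite mulrDr; rewrite big_split/= (le_trans (ncD _ _))//.
by rewrite mulrDl lerD// mulrC nc_CS.
Qed.

Lemma nrmZ (I : finType) (c : R[i]) (x : I -> R[i]) :
  nrm (fun i => c * x i) = nc c * nrm x.
Proof.
rewrite /nrm /nrm2; under eq_bigr do rewrite ncM exprMn.
by rewrite -mulr_sumr sqrtrM ?sqr_ge0// sqrtr_sqr ger0_norm ?nc_ge0.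
Qed.

Section Opb.
Implicit Types (I J K G H : finType) (c d : R).

Lemma opb_ge0 I J (a : I -> J -> R[i]) c : opb a c -> 0 <= c.
Proof. by case. Qed.

Lemma opb_ext I J (a b : I -> J -> R[i]) c :
  (forall i j, a i j = b i j) -> opb a c -> opb b c.
Proof.
move=> e [c0 h]; split=> // x; rewrite -(@eq_nrm _ (mxv a x)) ?h// => i.
by apply: eq_bigr => j _; rewrite e.
Qed.

Lemma opb_le I J (a : I -> J -> R[i]) c d : c <= d -> opb a c -> opb a d.
Proof.
move=> cd [c0 h]; split=> [|x]; first exact: le_trans cd.
by apply: le_trans (h x) _; rewrite ler_wpM2r// nrm_ge0.
Qed.

Lemma opb_dual I J (a : I -> J -> R[i]) c : 0 <= c ->
  opb a c <-> forall x y,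
    nc (\sum_i \sum_j y i * a i j * x j) <= c * nrm y * nrm x.
Proof.
move=> c0.
have e x y : \sum_i \sum_j y i * a i j * x j = \sum_i y i * mxv a x i.
  apply: eq_bigr => i _; rewrite /mxv mulr_sumr.
  by apply: eq_bigr => j _; rewrite mulrA.
split=> [[_ h] x y|h].
  rewrite e; apply: le_trans (nc_CS _ _) _.
  by rewrite mulrAC [c * _ * _]mulrC ler_wpM2l// nrm_ge0.
split=> // x; apply: nrm_sharp => [|y]; first by rewrite mulr_ge0// nrm_ge0.
by rewrite -e mulrAC.
Qed.

Lemma opb_tr I J (a : I -> J -> R[i]) c : opb a c -> opb (fun j i => a i j) c.
Proof.
move=> ha; have c0 := opb_ge0 ha; apply/opb_dual => // x y.
rewrite exchange_big/= mulrAC; move/opb_dual: ha => /(_ c0 y x).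
apply: le_trans; rewrite le_eqVlt; apply/orP; left; apply/eqP.
congr nc; apply: eq_bigr => i _; apply: eq_bigr => j _; ring.
Qed.

Lemma opb_comp I K J (a : I -> K -> R[i]) (b : K -> J -> R[i]) c d :
  opb a c -> opb b d -> opb (fun i j => \sum_k a i k * b k j) (c * d).
Proof.
move=> [c0 ha] [d0 hb]; split=> [|x]; first exact: mulr_ge0.
rewrite (@eq_nrm _ _ (mxv a (mxv b x))); last first.
  move=> i; rewrite /mxv; under eq_bigr do rewrite mulr_suml.
  rewrite exchange_big/=; apply: eq_bigr => k _; rewrite mulr_sumr.
  by apply: eq_bigr => j _; rewrite mulrA.
by apply: le_trans (ha _) _; rewrite -mulrA ler_wpM2l.
Qed.

Lemma opbD I J (a b : I -> J -> R[i]) c d :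
  opb a c -> opb b d -> opb (fun i j => a i j + b i j) (c + d).
Proof.
move=> [c0 ha] [d0 hb]; split=> [|x]; first exact: addr_ge0.
rewrite (@eq_nrm _ _ (fun i => mxv a x i + mxv b x i)); last first.
  move=> i; rewrite /mxv -big_split/=.
  by apply: eq_bigr => j _; rewrite mulrDl.
by apply: le_trans (nrmD _ _) _; rewrite mulrDl lerD.
Qed.

Lemma opbZ I J (a : I -> J -> R[i]) c z :
  opb a c -> opb (fun i j => z * a i j) (nc z * c).
Proof.
move=> [c0 ha]; split=> [|x]; first by rewrite mulr_ge0// nc_ge0.
rewrite (@eq_nrm _ _ (fun i => z * mxv a x i)); last first.
  by move=> i; rewrite /mxv mulr_sumr; apply: eq_bigr => j _; rewrite mulrA.
by rewrite nrmZ -mulrA ler_wpM2l// nc_ge0.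
Qed.

Lemma opb0 I J c : 0 <= c -> opb (fun (i : I) (j : J) => 0 : R[i]) c.
Proof.
move=> c0; split=> // x; rewrite (@eq_nrm _ _ (fun=> 0)); last first.
  by move=> i; rewrite /mxv big1// => j _; rewrite mul0r.
rewrite {1}/nrm /nrm2 big1 ?sqrtr0 ?mulr_ge0 ?nrm_ge0// => i _.
by rewrite nc0 expr0n.
Qed.

Lemma opb_extend I J I' J' (f : I -> I') (g : J -> J') (a : I -> J -> R[i])
    (a' : I' -> J' -> R[i]) c : injective f -> injective g ->
  (forall i j, a' (f i) (g j) = a i j) ->
  (forall i' j', i' \notin codom f -> a' i' j' = 0) ->
  (forall i' j', j' \notin codom g -> a' i' j' = 0) ->
  opb a c -> opb a' c.
Proof.
move=> fI gI e ef eg ha; have c0 := opb_ge0 ha; apply/opb_dual => // x y.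
rewrite (sum_supp (f := f))//; last first.
  by move=> i hi; rewrite big1// => j _; rewrite ef// mulr0 mul0r.
under eq_bigr => i _.
  rewrite (sum_supp (f := g))//; last first.
    by move=> j hj; rewrite eg// mulr0 mul0r.
  under eq_bigr do rewrite e.
  over.
move/opb_dual: ha => /(_ c0 (x \o g) (y \o f))/= h; apply: le_trans h _.
have n1 : nrm (y \o f) <= nrm y by rewrite ler_wsqrtr// nrm_inj.
have n2 : nrm (x \o g) <= nrm x by rewrite ler_wsqrtr// nrm_inj.
by rewrite ler_pM ?mulr_ge0 ?nrm_ge0// ler_wpM2l.
Qed.

Lemma opb_sub I J I' J' (f : I -> I') (g : J -> J') (a : I' -> J' -> R[i]) c :
  injective f -> injective g -> opb a c -> opb (fun i j => a (f i) (g j)) c.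
Proof.
move=> fI gI ha; have c0 := opb_ge0 ha; apply/opb_dual => // x y.
(* Extension by zero along [h], written as a sum over fibres, which have at most one element when
   [h] is injective. *)
pose ext (I1 I2 : finType) (h : I1 -> I2) (u : I1 -> R[i]) (k : I2) : R[i] :=
  \sum_(i | h i == k) u i.
have exth (I1 I2 : finType) (h : I1 -> I2) u i : injective h ->
    ext _ _ h u (h i) = u i.
  by move=> hI; rewrite /ext (big_pred1 i)// => k; rewrite /= (inj_eq hI).
have ext0 (I1 I2 : finType) (h : I1 -> I2) u k : k \notin codom h ->
    ext _ _ h u k = 0.
  move=> hk; rewrite /ext big_pred0// => i; apply: contraNF hk => /eqP <-.
  exact: codom_f.
have nrme (I1 I2 : finType) (h : I1 -> I2) u : injective h ->
    nrm (ext _ _ h u) = nrm u.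
  move=> hI; rewrite /nrm /nrm2 (sum_supp (f := h))//; last first.
    by move=> i hi; rewrite ext0// nc0 expr0n.
  by under eq_bigr do rewrite exth//.
move/opb_dual: ha => /(_ c0 (ext _ _ g x) (ext _ _ f y)).
rewrite !nrme// (sum_supp (f := f))//; last first.
  by move=> i hi; rewrite big1// => j _; rewrite ext0// !mul0r.
under eq_bigr => i _.
  rewrite (sum_supp (f := g))//; last by move=> j hj; rewrite (ext0 _ _ g)// mulr0.
  under eq_bigr do rewrite !exth//.
  over.
by [].
Qed.

Lemma opb_amp I J G (a : I -> J -> R[i]) c : opb a c ->
  opb (fun (r : I * G) (s : J * G) => a r.1 s.1 *+ (r.2 == s.2)) c.
Proof.
move=> [c0 ha]; split=> // x; rewrite le_nrm// /nrm2.
rewrite !sum_pair exchange_big [in X in _ <= _ * X]exchange_big/= mulr_sumr.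
apply: ler_sum => g _; have := ha (fun j => x (j, g)); rewrite le_nrm//.
rewrite /nrm2 => h; apply: le_trans h; rewrite le_eqVlt; apply/orP; left.
apply/eqP; apply: eq_bigr => i _; congr (nc _ ^+ 2); rewrite /mxv.
rewrite sum_pair exchange_big/=.
rewrite (bigD1 g)//= [X in _ + X]big1 ?addr0.
  by apply: eq_bigr => j _; rewrite eqxx mulr1n.
move=> h hg; rewrite big1// => j _.
by rewrite eq_sym (negPf hg) mulr0n mul0r.
Qed.

(** The tensor product factors as (a (x) 1)(1 (x) b); the second amplification is [opb_amp] with the
    coordinates swapped. *)
Lemma opb_tens I J I' J' (a : I -> J -> R[i]) (b : I' -> J' -> R[i]) c d :
  opb a c -> opb b d ->
  opb (fun (r : I * I') (s : J * J') => a r.1 s.1 * b r.2 s.2) (c * d).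
Proof.
move=> ha hb; have h1 := opb_amp I' ha.
have h2 : opb (fun (r : J * I') (s : J * J') => b r.2 s.2 *+ (r.1 == s.1)) d.
  have sw (A B : finType) : injective (fun p : A * B => (p.2, p.1)).
    by move=> [? ?] [? ?] [-> ->].
  exact: (opb_sub (sw _ _) (sw _ _) (opb_amp J hb)).
apply: opb_ext (opb_comp h1 h2) => -[i i'] [j j'] /=.
rewrite (bigD1 (j, i'))//= !eqxx !mulr1n [X in _ + X]big1 ?addr0// => -[k k'] /=.
rewrite xpair_eqE negb_and => /orP[] /negPf e; first by rewrite e mulr0n mulr0.
by rewrite eq_sym e mulr0n mul0r.
Qed.

Definition dsum (Z : zmodType) I J I' J' (a : I -> J -> Z) (b : I' -> J' -> Z)
    (r : I + I') (s : J + J') : Z :=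
  match r, s with
  | inl i, inl j => a i j
  | inr i, inr j => b i j
  | _, _ => 0
  end.

Lemma big_sumT (V : nmodType) I J (F : I + J -> V) :
  \sum_r F r = \sum_i F (inl i) + \sum_j F (inr j).
Proof. exact: big_sumType. Qed.

Lemma opb_dsum I J I' J' (a : I -> J -> R[i]) (b : I' -> J' -> R[i]) c :
  opb a c -> opb b c -> opb (dsum a b) c.
Proof.
move=> [c0 ha] [_ hb]; split=> // x; rewrite le_nrm// /nrm2 !big_sumT mulrDr.
have := ha (x \o inl); have := hb (x \o inr); rewrite !le_nrm// /nrm2 /=.
move=> h1 h2; apply: lerD.
  apply: le_trans h2; rewrite le_eqVlt; apply/orP; left; apply/eqP.
  apply: eq_bigr => i _; congr (nc _ ^+ 2); rewrite /mxv big_sumT/=.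
  by rewrite [X in _ + X]big1 ?addr0// => j _; rewrite mul0r.
apply: le_trans h1; rewrite le_eqVlt; apply/orP; left; apply/eqP.
apply: eq_bigr => i _; congr (nc _ ^+ 2); rewrite /mxv big_sumT/=.
by rewrite [X in X + _]big1 ?add0r// => j _; rewrite mul0r.
Qed.

(** The image splits orthogonally, so the squares of the bounds add. With bounds sqrt r and sqrt s
    the column is bounded by sqrt (r + s), which is how the projective norm becomes subadditive in
    [QbD]. *)
Lemma opb_col I I' J (a : I -> J -> R[i]) (b : I' -> J -> R[i]) c d e :
  0 <= e -> c ^+ 2 + d ^+ 2 <= e ^+ 2 -> opb a c -> opb b d ->
  opb (fun (r : I + I') j => match r with inl i => a i j | inr i => b i j end) e.
Proof.
move=> e0 cde [c0 ha] [d0 hb]; split=> // x; rewrite le_nrm// {1}/nrm2 big_sumT.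
have := ha x; have := hb x; rewrite !le_nrm// => h1 h2.
by apply: le_trans (lerD h2 h1) _; rewrite -mulrDl ler_wpM2r// nrm2_ge0.
Qed.

Lemma opb_row I J J' (a : I -> J -> R[i]) (b : I -> J' -> R[i]) c d e :
  0 <= e -> c ^+ 2 + d ^+ 2 <= e ^+ 2 -> opb a c -> opb b d ->
  opb (fun i (s : J + J') => match s with inl j => a i j | inr j => b i j end) e.
Proof.
move=> e0 cde ha hb.
apply: opb_ext (opb_tr (opb_col e0 cde (opb_tr ha) (opb_tr hb))) => i.
by case.
Qed.

Lemma opb_rownorm I J (a : I -> J -> R[i]) c i : opb a c -> nrm (a i) <= c.
Proof.
move=> ha; have c0 := opb_ge0 ha; apply: nrm_sharp => // y.
move/opb_dual: ha => /(_ c0 y (fun k => (k == i)%:R)).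
have -> : nrm (fun k : I => (k == i)%:R : R[i]) = 1.
  rewrite /nrm /nrm2 (bigD1 i)//= eqxx nc1 expr1n big1 ?addr0 ?sqrtr1// => k ki.
  by rewrite (negPf ki) nc0 expr0n.
rewrite mulr1 (bigD1 i)//= [X in _ + X]big1 ?addr0 => [|k ki]; last first.
  by rewrite big1// => j _; rewrite (negPf ki) !mul0r.
by under eq_bigr do rewrite eqxx mul1r mulrC.
Qed.

Lemma opb_entry I J (a : I -> J -> R[i]) c i j : opb a c -> nc (a i j) <= c.
Proof. by move=> /(opb_rownorm i); apply: le_trans; exact: nc_le_nrm. Qed.

Lemma opb_hs I J (a : I -> J -> R[i]) c : 0 <= c ->
  \sum_i \sum_j nc (a i j) ^+ 2 <= c ^+ 2 -> opb a c.
Proof.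
move=> c0 h; split=> // x; rewrite le_nrm//.
apply: (@le_trans _ _ ((\sum_i nrm2 (a i)) * nrm2 x)).
  rewrite mulr_suml; apply: ler_sum => i _.
  rewrite -!nrm_sqr -exprMn ler_pXn2r ?nnegrE ?nc_ge0 ?mulr_ge0 ?nrm_ge0//.
  exact: nc_CS.
by rewrite ler_wpM2r// nrm2_ge0.
Qed.

Lemma opb_ex I J (a : I -> J -> R[i]) : exists2 c, 0 < c & opb a c.
Proof.
pose c2 := \sum_i \sum_j nc (a i j) ^+ 2.
have c20 : 0 <= c2.
  by apply: sumr_ge0 => i _; apply: sumr_ge0 => j _; apply: sqr_ge0.
exists (c2 + 1); first by rewrite ltr_wpDl.
apply: opb_hs; first by rewrite addr_ge0.
rewrite -/c2 (_ : (c2 + 1) ^+ 2 = c2 + (c2 ^+ 2 + c2 + 1)); last by ring.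
by rewrite lerDl !addr_ge0// sqr_ge0.
Qed.

Lemma opb_colscale I J (a : I -> J -> R[i]) (e : J -> R[i]) c :
  (forall j, nc (e j) <= 1) -> opb a c -> opb (fun i j => a i j * e j) c.
Proof.
move=> e1 [c0 ha]; split=> // x; rewrite (@eq_nrm _ _ (mxv a (fun j => e j * x j))).
  apply: le_trans (ha _) _; rewrite ler_wpM2l// ler_wsqrtr// ler_sum// => j _.
  by rewrite ncM lerXn2r ?nnegrE ?mulr_ge0 ?nc_ge0// ler_piMl ?nc_ge0.
by move=> i; rewrite /mxv; apply: eq_bigr => j _; rewrite mulrA.
Qed.

Lemma opb_rowscale I J (a : I -> J -> R[i]) (e : I -> R[i]) c :
  (forall j, nc (e j) <= 1) -> opb a c -> opb (fun i j => e i * a i j) c.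
Proof.
move=> e1 /opb_tr ha; apply: opb_ext (opb_tr (opb_colscale e1 ha)) => i j /=.
exact: mulrC.
Qed.

(** Triangle inequality over the blocks. The lost factor is harmless: the bound serves to show that
    a finite array of small operators is small. *)
Lemma opb_blocks I J G H (a : I * G -> J * H -> R[i]) c :
  (forall i j, opb (fun g h => a (i, g) (j, h)) c) -> 0 <= c ->
  opb a (#|I|%:R * #|J|%:R * c).
Proof.
move=> ha c0; apply/opb_dual => [|x y]; first by rewrite !mulr_ge0.
rewrite sum_pair.
rewrite [X in nc X](_ : _ = \sum_i \sum_j \sum_g \sum_h
    y (i, g) * a (i, g) (j, h) * x (j, h)); last first.
  apply: eq_bigr => i _; rewrite [RHS]exchange_big/=.
  by apply: eq_bigr => g _; rewrite sum_pair.
apply: le_trans (nc_sum _ _ _) _.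
rewrite (_ : #|I|%:R * #|J|%:R * c * nrm y * nrm x =
  \sum_(i : I) \sum_(j : J) c * nrm y * nrm x); last first.
  by rewrite !sumr_const -[RHS]mulr_natl -[X in _ = _ * X]mulr_natl -!mulrA.
apply: ler_sum => i _; apply: le_trans (nc_sum _ _ _) _.
apply: ler_sum => j _.
move/opb_dual : (ha i j) => /(_ c0 (fun h => x (j, h)) (fun g => y (i, g))) h.
have n1 : nrm (fun g => y (i, g)) <= nrm y.
  by rewrite ler_wsqrtr// (@nrm_inj _ _ (pair i))// => ? ? [].
have n2 : nrm (fun g => x (j, g)) <= nrm x.
  by rewrite ler_wsqrtr// (@nrm_inj _ _ (pair j))// => ? ? [].
apply: le_trans h _.
by rewrite ler_pM ?mulr_ge0 ?nrm_ge0// ler_wpM2l.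
Qed.

Lemma opb_small I J (a : I -> J -> R[i]) e : 0 <= e ->
  (forall i j, nc (a i j) <= e) -> opb a (#|I|%:R * #|J|%:R * e).
Proof.
move=> e0 h; apply: opb_hs; first by rewrite !mulr_ge0.
apply: (@le_trans _ _ (#|I|%:R * #|J|%:R * e ^+ 2)).
  rewrite (_ : _ * _ * _ = \sum_(i : I) \sum_(j : J) e ^+ 2); last first.
    by rewrite !sumr_const -[RHS]mulr_natl -[X in _ = _ * X]mulr_natl -!mulrA.
  apply: ler_sum => i _; apply: ler_sum => j _.
  by rewrite lerXn2r ?nnegrE ?nc_ge0.
rewrite -natrM exprMn ler_wpM2r ?sqr_ge0// -natrX ler_nat.
by case: (#|I| * #|J|)%N => // n; rewrite -mulnn leq_pmulr.
Qed.

Lemma opb_inf I J (a : I -> J -> R[i]) c : 0 <= c ->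
  (forall e, 0 < e -> opb a (c + e)) -> opb a c.
Proof.
move=> c0 h; split=> // x; apply/ler_addgt0Pr => e e0.
have n0 : 0 < nrm x + 1 by rewrite ltr_wpDl ?nrm_ge0.
have [_ /(_ x)] := h (e / (nrm x + 1)) (divr_gt0 e0 n0).
move/le_trans; apply; rewrite mulrDl lerD2l mulrAC ler_pdivrMr// ler_pM2l//.
by rewrite lerDl.
Qed.

Lemma opb_lim I J (a : I -> J -> R[i]) c : 0 <= c ->
  (forall e, 0 < e -> exists2 b, opb b c & forall i j, nc (a i j - b i j) <= e) ->
  opb a c.
Proof.
move=> c0 h; apply: opb_inf => // e e0.
pose k : R := #|I|%:R * #|J|%:R.
have k0 : 0 < k + 1 by rewrite ltr_wpDl// mulr_ge0.
have [b hb ab] := h _ (divr_gt0 e0 k0).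
have e'0 : 0 <= e / (k + 1) by rewrite divr_ge0// ltW.
have := opbD hb (opb_small e'0 ab) => /(opb_ext (b := a)) h1.
apply: opb_le (h1 _) => [|i j]; last by rewrite addrC subrK.
by rewrite lerD2l -/k mulrCA ler_piMr ?ltW// ltr_pdivrMr// mul1r ltrDl.
Qed.

(** The matrix is (a (x) 1) x (b (x) 1), the identities acting on the second coordinate. *)
Lemma opb_mlr I I' J J' G H (x : J * G -> J' * H -> R[i]) (a : I -> J -> R[i])
    (b : J' -> I' -> R[i]) c d e : opb a d -> opb x c -> opb b e ->
  opb (fun (r : I * G) (s : I' * H) =>
    \sum_j \sum_k a r.1 j * b k s.1 * x (j, r.2) (k, s.2)) (d * c * e).
Proof.
move=> ha hx hb.
apply: opb_ext (opb_comp (opb_comp (opb_amp G ha) hx) (opb_amp H hb)).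
move=> [i g] [j h]; rewrite sum_pair exchange_big/= (bigD1 h)//= eqxx.
rewrite [X in _ + X]big1 ?addr0 => [|h' hh'].
  rewrite [RHS]exchange_big/=; apply: eq_bigr => k _; rewrite mulr1n mulr_suml.
  rewrite sum_pair; apply: eq_bigr => l _.
  rewrite (bigD1 g)//= eqxx mulr1n [X in _ + X]big1 ?addr0 => [|g' gg'].
    by rewrite mulrAC.
  by rewrite eq_sym (negPf gg') mulr0n !mul0r.
by rewrite big1// => k _; rewrite (negPf hh') mulr0n mulr0.
Qed.

Lemma opb_dsumG I J I' J' G H (x : I * G -> J * H -> R[i])
    (y : I' * G -> J' * H -> R[i]) c : opb x c -> opb y c ->
  opb (fun (r : (I + I') * G) (s : (J + J') * H) =>
    match r.1, s.1 with
    | inl i, inl j => x (i, r.2) (j, s.2)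
    | inr i, inr j => y (i, r.2) (j, s.2)
    | _, _ => 0
    end) c.
Proof.
move=> hx hy.
pose f (A B D : finType) (r : (A + B) * D) : A * D + B * D :=
  match r.1 with inl i => inl (i, r.2) | inr i => inr (i, r.2) end.
have fI A B D : injective (@f A B D) by move=> [[?|?] ?] [[?|?] ?] //= [-> ->].
apply: opb_ext (opb_sub (fI _ _ _) (fI _ _ _) (opb_dsum hx hy)).
by move=> [[i|i] g] [[j|j] h].
Qed.

End Opb.
End FiniteMatrices.

(** * Matrix levels over the compact and trace class operators *)

Section InfiniteMatrices.
Variable R : realType.
Local Notation nc := (@ComplexField.Normc.normc R).
Local Notation imx := (nat -> nat -> R[i]).
Implicit Types (I J G H : finType) (c d e : R) (a b : imx) (K L N : nat).

Definition trm I J K L (x : I -> J -> imx) (r : I * 'I_K) (s : J * 'I_L) : R[i] :=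
  x r.1 s.1 r.2 s.2.

Definition bnd I J (x : I -> J -> imx) c := forall K, opb (trm (K := K) (L := K) x) c.

Definition bop a c := bnd (fun _ _ : unit => a) c.

Definition tl K a : imx := fun i j => a i j *+ ~~ ((i < K) && (j < K))%N.

(** Compactness as approximability in norm by the finite corners, a form that is stable under the
    operations below and avoids totally bounded sets. For bounded matrices it is equivalent to
    [compact_op], by [compact_cpt] and [cpt_compact]. *)
Definition cpt a := forall e, 0 < e -> exists K, bop (tl K a) e.

(* The norms of M_I(S_oo) and, below, of M_I(S_1) = CB(S_oo, M_I), the latter
   tested on finite matrices only. *)
Definition SI I (x : I -> I -> imx) c := (forall i j, cpt (x i j)) /\ bnd x c.

Definition pairm I J G H K L (x : I -> J -> imx) (y : G -> H -> imx)
    (r : I * G) (s : J * H) : R[i] :=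
  \sum_(k < K) \sum_(l < L) x r.1 s.1 k l * y r.2 s.2 k l.

Definition SO I (x : I -> I -> imx) c := 0 <= c /\
  forall G H K L (y : G -> H -> imx), opb (trm (K := K) (L := L) y) 1 ->
    opb (pairm K L x y) c.

Definition mlr (Z : lmodType R[i]) I J (u : I -> J -> R[i]) (x : J -> J -> Z)
    (v : J -> I -> R[i]) : I -> I -> Z :=
  fun i j => \sum_k \sum_l (u i k * v l j) *: x k l.

Definition amp (V W T : Type) (f : V -> W -> T) I J (x : I -> I -> V) (y : J -> J -> W)
    (r s : I * J) : T := f (x r.1 s.1) (y r.2 s.2).

Definition sch a b : imx := fun i j => a i j * b i j.

(** The product a D b, with D the diagonal matrix of [f] truncated to the first N indices; [f] will
    be a sequence of signs or the constant 1. *)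
Definition prodK N (f : nat -> R[i]) a b : imx :=
  fun i j => \sum_(k < N) a i k * f k * b k j.

Definition csc (f : nat -> R[i]) a : imx := fun i j => a i j * f j.

Lemma mlrE I J u (x : J -> J -> imx) v (i j : I) k l :
  mlr u x v i j k l = \sum_p \sum_q u i p * v q j * x p q k l.
Proof.
rewrite /mlr; do 2!rewrite fct_sumE; apply: eq_bigr => p _.
by do 2!rewrite fct_sumE.
Qed.

Lemma bnd_rect I J (x : I -> J -> imx) c K L : bnd x c ->
  opb (trm (K := K) (L := L) x) c.
Proof.
move=> h; pose f (A : finType) M (le : (M <= maxn K L)%N) (r : A * 'I_M) :=
  (r.1, widen_ord le r.2).
have fI A M le : injective (@f A M le).
  by move=> [a i] [b j] [-> /= ij]; congr pair; apply/val_inj.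
exact: opb_ext (opb_sub (fI _ _ (leq_maxl K L)) (fI _ _ (leq_maxr K L)) (h (maxn K L))).
Qed.

Lemma bnd_ge0 I J (x : I -> J -> imx) c : bnd x c -> 0 <= c.
Proof. by move=> /(_ 0%N)/opb_ge0. Qed.

Lemma bnd_ext I J (x y : I -> J -> imx) c :
  (forall i j k l, x i j k l = y i j k l) -> bnd x c -> bnd y c.
Proof. by move=> e h K; apply: opb_ext (h K) => r s; apply: e. Qed.

Lemma bnd_le I J (x : I -> J -> imx) c d : c <= d -> bnd x c -> bnd x d.
Proof. by move=> cd h K; apply: opb_le (h K). Qed.

Lemma bndD I J (x y : I -> J -> imx) c d : bnd x c -> bnd y d ->
  bnd (fun i j => x i j + y i j) (c + d).
Proof. by move=> hx hy K; apply: opb_ext (opbD (hx K) (hy K)). Qed.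

Lemma bndZ I J (x : I -> J -> imx) c z : bnd x c ->
  bnd (fun i j => z *: x i j) (nc z * c).
Proof. by move=> hx K; apply: opb_ext (opbZ z (hx K)). Qed.

Lemma bnd0 I J c : 0 <= c -> bnd (fun (i : I) (j : J) => 0) c.
Proof. by move=> c0 K; apply: opb_ext (opb0 _ _ c0). Qed.

Lemma bnd_sub I J I' J' (f : I' -> I) (g : J' -> J) (x : I -> J -> imx) c :
  injective f -> injective g -> bnd x c -> bnd (fun i j => x (f i) (g j)) c.
Proof.
move=> fI gI hx K; apply: opb_ext (opb_sub (f := fun r => (f r.1, r.2))
  (g := fun r => (g r.1, r.2)) _ _ (hx K)) => //.
- by move=> [? ?] [? ?] [/fI -> ->].
- by move=> [? ?] [? ?] [/gI -> ->].
Qed.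

Lemma unit_inj T (t : T) : injective (fun _ : unit => t).
Proof. by move=> [] []. Qed.

Lemma bnd_bop I J (x : I -> J -> imx) c i j : bnd x c -> bop (x i j) c.
Proof. by move=> h; have := bnd_sub (@unit_inj _ i) (@unit_inj _ j) h. Qed.

Lemma bop_bnd I J (x : I -> J -> imx) c : 0 <= c ->
  (forall i j, bop (x i j) c) -> bnd x (#|I|%:R * #|J|%:R * c).
Proof.
move=> c0 h K; apply: opb_blocks => // i j.
apply: opb_ext (opb_sub (f := pair tt) (g := pair tt) _ _ (h i j K)) => //.
- by move=> ? ? [].
- by move=> ? ? [].
Qed.

Lemma bopP a c K L : bop a c -> opb (fun (i : 'I_K) (j : 'I_L) => a i j) c.
Proof.
move=> /(bnd_rect K L) h.
by apply: opb_ext (opb_sub (f := pair tt) (g := pair tt) _ _ h) => // ? ? [].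
Qed.

Lemma bopI a c : (forall K, opb (fun (i j : 'I_K) => a i j) c) -> bop a c.
Proof.
move=> h K; have i2 : injective (fun r : unit * 'I_K => r.2).
  by move=> [[] ?] [[] ?] /= ->.
exact: opb_ext (opb_sub i2 i2 (h K)).
Qed.

Lemma bnd_dsum I J (x : I -> I -> imx) (y : J -> J -> imx) c :
  bnd x c -> bnd y c -> bnd (dsum x y) c.
Proof.
move=> hx hy K; apply: opb_ext (opb_dsumG (hx K) (hy K)).
by move=> [[i|i] k] [[j|j] l].
Qed.

(** The Schur product is the compression of the tensor product to the indices whose two integer
    coordinates agree, and selecting rows and columns does not increase the norm. *)
Lemma bnd_sch I J I' J' (x : I -> J -> imx) (y : I' -> J' -> imx) c d :
  bnd x c -> bnd y d ->
  bnd (fun (r : I * I') (s : J * J') => sch (x r.1 s.1) (y r.2 s.2)) (c * d).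
Proof.
move=> hx hy K.
pose f (A B D : finType) (r : A * B * D) := ((r.1.1, r.2), (r.1.2, r.2)).
have fI A B D : injective (@f A B D) by move=> [[? ?] ?] [[? ?] ?] [-> -> ->].
exact: opb_ext (opb_sub (fI _ _ _) (fI _ _ _) (opb_tens (hx K) (hy K))).
Qed.

Lemma bnd_csc I J (x : I -> J -> imx) f c : (forall k, nc (f k) <= 1) ->
  bnd x c -> bnd (fun i j => csc f (x i j)) c.
Proof.
move=> f1 hx K.
exact: opb_ext (opb_colscale (e := fun s : J * 'I_K => f s.2) (fun s => f1 s.2) (hx K)).
Qed.

(** The matrix is a product of two amplifications: the first carries x and the weights [f] and is
    the identity on I', the second carries y and is the identity on J; they meet in the inner index
    n < N. *)
Lemma bnd_prod I J I' J' (x : I -> J -> imx) (y : I' -> J' -> imx) f N c d :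
  (forall k, nc (f k) <= 1) -> bnd x c -> bnd y d ->
  bnd (fun (r : I * I') (s : J * J') => prodK N f (x r.1 s.1) (y r.2 s.2)) (c * d).
Proof.
move=> f1 hx hy K.
pose f12 (A B D : finType) (r : A * B * D) := ((r.1.1, r.2), r.1.2).
have i12 A B D : injective (@f12 A B D) by move=> [[? ?] ?] [[? ?] ?] [-> -> ->].
pose f21 (A B D : finType) (r : A * B * D) := ((r.1.2, r.2), r.1.1).
have i21 A B D : injective (@f21 A B D) by move=> [[? ?] ?] [[? ?] ?] [-> -> ->].
have h1 := opb_sub (i12 _ _ _) (i12 _ _ _)
  (opb_amp I' (bnd_rect K N (bnd_csc f1 hx))).
have h2 := opb_sub (i21 _ _ _) (i21 _ _ _)
  (opb_amp J (bnd_rect N K hy)).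
apply: opb_ext (opb_comp h1 h2) => -[[i i'] k] [[j j'] l].
rewrite /trm /prodK /csc /f12 /f21 /= sum_pair (bigD1 (j, i'))//=.
rewrite [X in _ + X]big1 ?addr0 => [|[j2 i2] /=].
  by apply: eq_bigr => n _; rewrite !eqxx !mulr1n.
rewrite xpair_eqE negb_and => /orP[] /negPf ne; rewrite big1// => n _.
  by rewrite ne !mulr0n mulr0.
by rewrite eq_sym ne mulr0n mul0r.
Qed.

Lemma bnd_lim I J (x : I -> J -> imx) c : 0 <= c ->
  (forall K e, 0 < e -> exists2 y, bnd y c &
    forall i j k l, (k < K)%N -> (l < K)%N -> nc (x i j k l - y i j k l) <= e) ->
  bnd x c.
Proof.
move=> c0 h K; apply: opb_lim => // e e0; have [y hy xy] := h K e e0.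
by exists (trm (K := K) (L := K) y) => // r s; apply: xy.
Qed.

Lemma bop_ext a b c : (forall i j, a i j = b i j) -> bop a c -> bop b c.
Proof. by move=> e; apply: bnd_ext. Qed.

Lemma bop_sch a b c d : bop a c -> bop b d -> bop (sch a b) (c * d).
Proof.
move=> ha hb; apply: (bnd_bop (x := fun r s : unit * unit => sch a b) (tt, tt) (tt, tt)).
exact: bnd_sch ha hb.
Qed.

Lemma bop_prod a b f N c d : (forall k, nc (f k) <= 1) ->
  bop a c -> bop b d -> bop (prodK N f a b) (c * d).
Proof.
move=> f1 ha hb.
apply: (bnd_bop (x := fun r s : unit * unit => prodK N f a b) (tt, tt) (tt, tt)).
exact: bnd_prod ha hb.
Qed.

Lemma bop_mask a (p q : nat -> bool) c : bop a c ->
  bop (fun i j => a i j *+ (p i && q j)) c.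
Proof.
move=> ha; apply: bopI => K.
have b1 (b : bool) : nc b%:R <= 1 by case: b; rewrite ?nc1 ?nc0.
apply: opb_ext (opb_rowscale (e := fun i : 'I_K => (p i)%:R) _
  (opb_colscale (e := fun i : 'I_K => (q i)%:R) _ (bopP K K ha))) => //.
move=> i j; case: (p i); case: (q j) => /=;
  by rewrite ?mulr0 ?mul0r ?mulr1 ?mul1r ?mulr0n ?mulr1n.
Qed.

(** The complement of the corner L is not a rectangle. Cut into the rows from L on, and the columns
    from L on within the first L rows, it gives two masks of [tl K a], whence the factor 2. *)
Lemma tl_mono a c K L : (K <= L)%N -> bop (tl K a) c -> bop (tl L a) (c + c).
Proof.
move=> KL h.
have h1 := bop_mask (fun i => (L <= i)%N) predT h.
have h2 := bop_mask (fun i => (i < L)%N) (fun j => (L <= j)%N) h.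
apply: bnd_ext (bndD h1 h2) => _ _ i j; rewrite !fctE /tl /= ?andbT.
rewrite [(L <= i)%N]leqNgt [(L <= j)%N]leqNgt.
case: (ltnP i L) => iL; case: (ltnP j L) => jL; rewrite /= ?mulr0n ?mulr1n ?addr0 ?add0r//.
- by rewrite [(j < K)%N]ltnNge (leq_trans KL jL) andbF.
- by rewrite [(i < K)%N]ltnNge (leq_trans KL iL).
- by rewrite [(i < K)%N]ltnNge (leq_trans KL iL).
Qed.

Lemma cpt_ext a b : (forall i j, a i j = b i j) -> cpt a -> cpt b.
Proof.
move=> ab ha e e0; have [K hK] := ha e e0; exists K.
by apply: bop_ext hK => i j; rewrite /tl ab.
Qed.

Lemma cpt_fin a K : (forall i j, ~~ ((i < K) && (j < K))%N -> a i j = 0) -> cpt a.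
Proof.
move=> h e e0; exists K; apply: bop_ext (bnd0 _ _ (ltW e0)) => i j.
rewrite /tl; case: (boolP ((i < K) && (j < K))%N) => //= hij.
by rewrite h ?mul0rn.
Qed.

Lemma cptD a b : cpt a -> cpt b -> cpt (a + b).
Proof.
move=> ha hb e e0; have e4 : 0 < e / 4 by lra.
have [K hK] := ha _ e4; have [L hL] := hb _ e4; exists (maxn K L).
have h := bndD (tl_mono (leq_maxl K L) hK) (tl_mono (leq_maxr K L) hL).
apply: bnd_ext (bnd_le _ h); last by lra.
by move=> _ _ i j; rewrite /tl !fctE mulrnDl.
Qed.

Lemma cpt0 : cpt 0.
Proof. by apply: (@cpt_fin _ 0%N). Qed.

Lemma cptZ a z : cpt a -> cpt (z *: a).
Proof.
move=> ha e e0; have z0 : 0 < nc z + 1 by rewrite ltr_wpDl ?nc_ge0.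
have [K hK] := ha _ (divr_gt0 e0 z0); exists K.
apply: bnd_ext (bnd_le _ (bndZ z hK)).
  by move=> _ _ i j; rewrite /tl !fctE scalerMnr.
by rewrite mulrCA ler_piMr ?ltW// ltr_pdivrMr// mul1r ltrDl.
Qed.

Lemma cpt_approx a : (forall e, 0 < e -> exists2 b, cpt b & bop (a - b) e) -> cpt a.
Proof.
move=> h e e0; have e4 : 0 < e / 4 by lra.
have [b hb ab] := h _ e4; have [K hK] := hb _ e4; exists K.
have h0 : bop (tl 0 (a - b)) (e / 4) by apply: bop_ext ab => i j; rewrite /tl mulr1n.
have h1 := tl_mono (leq0n K) h0.
apply: bnd_ext (bnd_le _ (bndD h1 hK)); last by lra.
by move=> _ _ i j; rewrite /tl !fctE -mulrnDl subrK.
Qed.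

Lemma cpt_sch a b c : cpt a -> bop b c -> cpt (sch a b).
Proof.
move=> ha hb e e0; have c0 := bnd_ge0 hb; have c1 : 0 < c + 1 by lra.
have [K hK] := ha _ (divr_gt0 e0 c1); exists K.
apply: bnd_ext (bnd_le _ (bop_sch hK hb)).
  by move=> _ _ i j; rewrite /tl /sch mulrnAl.
by rewrite -mulrA ler_piMr ?ltW// mulrC ltr_pdivrMr// mul1r ltrDl.
Qed.

Lemma cpt_csc a f : (forall k, nc (f k) <= 1) -> cpt a -> cpt (csc f a).
Proof.
move=> f1 ha e e0; have [K hK] := ha e e0; exists K.
apply: bnd_ext (bnd_csc f1 hK) => _ _ i j.
by rewrite /tl /csc mulrnAl.
Qed.

Lemma cpt_prod a b f N c d : (forall k, nc (f k) <= 1) ->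
  bop a c -> bop b d -> cpt a -> cpt b -> cpt (prodK N f a b).
Proof.
move=> f1 ha hb ca cb; apply: cpt_approx => e e0.
have c0 := bnd_ge0 ha; have d0 := bnd_ge0 hb.
pose k := 2 * (c + d + 1); have k0 : 0 < k by rewrite /k; lra.
have e'0 : 0 < e / k by rewrite divr_gt0.
have [K hK] := ca _ e'0; have [L hL] := cb _ e'0.
pose a1 : imx := fun i j => a i j *+ ((i < K) && (j < K))%N.
pose b1 : imx := fun i j => b i j *+ ((i < L) && (j < L))%N.
exists (prodK N f a1 b1).
  apply: (@cpt_fin _ (maxn K L)) => i j; rewrite negb_and -!leqNgt => h.
  rewrite /prodK big1// => l _; rewrite /a1 /b1.
  move: h; rewrite !geq_max => /orP[/andP[h _]|/andP[_ h]].
    by rewrite ltnNge h mulr0n !mul0r.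
  by rewrite [(j < L)%N]ltnNge h andbF mulr0n mulr0.
have h1 := bop_prod N f1 hK hb.
have h2 := bop_prod N f1 (bop_mask (fun i => (i < K)%N) (fun i => (i < K)%N) ha) hL.
apply: bnd_ext (bnd_le _ (bndD h1 h2)).
  move=> _ _ i j; rewrite /prodK !fctE -big_split/= -sumrB; apply: eq_bigr => l _.
  rewrite /tl /a1 /b1; case: (_ && _); case: (_ && _); rewrite /= ?mulr0n ?mulr1n; ring.
rewrite [c * _]mulrC -mulrDr addrC -mulrA ler_piMr ?ltW//.
by rewrite mulrC ltr_pdivrMr// mul1r /k; lra.
Qed.

Lemma SI_ge0 I (x : I -> I -> imx) c : SI x c -> 0 <= c.
Proof. by move=> [_ /bnd_ge0]. Qed.

Lemma SI_le I (x : I -> I -> imx) c d : c <= d -> SI x c -> SI x d.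
Proof. by move=> cd [h1 h2]; split=> //; apply: bnd_le h2. Qed.

Lemma SI0 I c : 0 <= c -> SI (0 : I -> I -> imx) c.
Proof. by move=> c0; split=> [i j|]; [exact: cpt0|exact: bnd0]. Qed.

Lemma SID I (x y : I -> I -> imx) c d : SI x c -> SI y d -> SI (x + y) (c + d).
Proof.
by move=> [x1 x2] [y1 y2]; split=> [i j|]; [exact: cptD|exact: bndD].
Qed.

Lemma SIZ I (x : I -> I -> imx) c z : SI x c -> SI (z *: x) (nc z * c).
Proof. by move=> [x1 x2]; split=> [i j|]; [exact: cptZ|exact: bndZ]. Qed.

Lemma SI_dsum I J (x : I -> I -> imx) (y : J -> J -> imx) c :
  SI x c -> SI y c -> SI (dsum x y) c.
Proof.
move=> [x1 x2] [y1 y2]; split; last exact: bnd_dsum.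
by move=> [i|i] [j|j] //=; apply: cpt0.
Qed.

Lemma SI_sch I J (x : I -> I -> imx) (y : J -> J -> imx) c d :
  SI x c -> SI y d -> SI (amp sch x y) (c * d).
Proof.
move=> [x1 x2] [y1 y2]; split=> [r s|]; last exact: bnd_sch.
exact: cpt_sch (x1 _ _) (bnd_bop _ _ y2).
Qed.

Lemma SI_prod I J (x : I -> I -> imx) (y : J -> J -> imx) f N c d :
  (forall k, nc (f k) <= 1) ->
  SI x c -> SI y d -> SI (amp (prodK N f) x y) (c * d).
Proof.
move=> f1 [x1 x2] [y1 y2]; split=> [r s|]; last exact: bnd_prod.
exact: cpt_prod (bnd_bop _ _ x2) (bnd_bop _ _ y2) _ _.
Qed.

Lemma SI_csc I (x : I -> I -> imx) f c : (forall k, nc (f k) <= 1) ->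
  SI x c -> SI (fun i j => csc f (x i j)) c.
Proof.
by move=> f1 [x1 x2]; split=> [i j|]; [exact: cpt_csc|exact: bnd_csc].
Qed.

Lemma SI_entry I (x : I -> I -> imx) c i j k l : SI x c -> nc (x i j k l) <= c.
Proof.
move=> [_ /(bnd_rect (k.+1) (l.+1))/opb_entry].
by move=> /(_ (i, ord_max) (j, ord_max)).
Qed.

(** The columns from K on avoid the corner K outside which a compact entry is small, and since I is
    finite one K serves all entries. *)
Lemma SI_tail I (x : I -> I -> imx) c : SI x c -> forall e, 0 < e -> exists N0, forall N,
  (N0 <= N)%N -> SI (fun i j => csc (fun k => (N <= k)%:R) (x i j)) e.
Proof.
move=> [x1 x2] e e0.
pose m : R := #|I|%:R * #|I|%:R; have m0 : 0 <= m by rewrite mulr_ge0.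
have m1 : 0 < m + 1 by lra.
have e1 : 0 < e / (m + 1) by rewrite divr_gt0.
have [K hK] := choice (fun r : I * I => x1 r.1 r.2 _ e1).
exists (\max_r K r) => N hN; split=> [i j|].
  apply: cpt_csc (x1 i j) => k; case: (N <= k)%N; rewrite ?nc1 ?nc0//.
have b1 (b : bool) : nc b%:R <= 1 by case: b; rewrite ?nc1 ?nc0.
apply: bnd_le (bop_bnd (ltW e1) _).
  by rewrite -/m mulrCA ler_piMr ?ltW// ltr_pdivrMr// mul1r; lra.
move=> i j; have hj := hK (i, j).
apply: bop_ext (bop_mask predT (fun k => (N <= k)%N) hj) => k l /=.
rewrite /tl /csc mulr_natr; case: (leqP N l) => Nl //=; rewrite !mulr1n.
suff -> : (l < K (i, j))%N = false by rewrite andbF mulr1n.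
apply/negbTE; rewrite -leqNgt; apply: leq_trans Nl; apply: leq_trans hN.
exact: leq_bigmax.
Qed.

End InfiniteMatrices.

Arguments sch {R} a b.

Lemma nondec_cauchy (R : realType) (u : nat -> R) c :
  (forall n, u n <= u n.+1) -> (forall n, u n <= c) ->
  forall e, 0 < e -> exists N, forall n, (N <= n)%N -> u n <= u N + e.
Proof.
move=> ui uc e e0.
have hs : has_sup (range u).
  by split; [exists (u 0%N), 0%N|exists c => _ [n _ <-]].
have [_ [N _ <-] hN] := sup_adherent e0 hs.
exists N => n _; rewrite -lerBlDr; apply: le_trans (ltW hN).
by rewrite lerD2r; apply: ub_le_sup; [exists c => _ [m _ <-]|exists n].
Qed.

(** * Trace class operators: duality, products and limits *)

Section TraceClass.
Variable R : realType.
Local Notation nc := (@ComplexField.Normc.normc R).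
Local Notation imx := (nat -> nat -> R[i]).
Implicit Types (I J G H : finType) (c d e : R) (a b : imx) (K L N : nat).

Lemma pairmZr I J G H K L (x : I -> J -> imx) (y : G -> H -> imx) z r s :
  pairm K L x (fun g h => z *: y g h) r s = z * pairm K L x y r s.
Proof.
rewrite /pairm mulr_sumr; apply: eq_bigr => k _; rewrite mulr_sumr.
apply: eq_bigr => l _; exact: mulrCA.
Qed.

Lemma SO_ge0 I (x : I -> I -> imx) c : SO x c -> 0 <= c.
Proof. by case. Qed.

Lemma SO_ext I (x y : I -> I -> imx) c :
  (forall i j k l, x i j k l = y i j k l) -> SO x c -> SO y c.
Proof.
move=> e [c0 hx]; split=> // G H K L z hz; apply: opb_ext (hx _ _ _ _ _ hz) => r s.
by apply: eq_bigr => k _; apply: eq_bigr => l _; rewrite e.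
Qed.

Lemma SO_scaled I G H K L (x : I -> I -> imx) (y : G -> H -> imx) c d :
  SO x c -> opb (trm (K := K) (L := L) y) d -> opb (pairm K L x y) (c * d).
Proof.
move=> [c0 hx] hy; have d0 := opb_ge0 hy; apply: opb_inf => [|e e0].
  exact: mulr_ge0.
have c1 : 0 < c + 1 by lra.
have e1 : 0 < e / (c + 1) by rewrite divr_gt0.
(* The bound d may be 0 and then cannot be normalised to 1, so y is divided by a slightly larger t >
   0 and e is made to tend to 0. *)
pose t := d + e / (c + 1); have t0 : 0 < t by rewrite /t; lra.
have ht : opb (trm (K := K) (L := L) (fun g h => (t^-1)%:C%C *: y g h)) 1.
  apply: opb_le (opbZ (t^-1)%:C%C hy); rewrite nc_real ger0_norm ?invr_ge0 ?(ltW t0)//.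
  rewrite ler_pdivrMl// mulr1 /t; lra.
apply: opb_ext (opb_le _ (opbZ t%:C%C (hx _ _ _ _ _ ht))) => [r s|].
  rewrite pairmZr mulrA -rmorphM/= divff ?gt_eqF//; exact: mul1r.
rewrite nc_real ger0_norm ?(ltW t0)// mulrC /t mulrDr lerD2l.
by rewrite mulrCA ler_piMr ?ltW// ltr_pdivrMr// mul1r; lra.
Qed.

Lemma SO_le I (x : I -> I -> imx) c d : c <= d -> SO x c -> SO x d.
Proof.
move=> cd [c0 hx]; split=> [|G H K L y hy]; first exact: le_trans cd.
exact: opb_le (hx _ _ _ _ _ hy).
Qed.

Lemma SO0 I c : 0 <= c -> SO (0 : I -> I -> imx) c.
Proof.
move=> c0; split=> // G H K L y _; apply: opb_ext (opb0 _ _ c0) => r s.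
by rewrite /pairm big1// => k _; rewrite big1// => l _; rewrite mul0r.
Qed.

Lemma SOD I (x y : I -> I -> imx) c d : SO x c -> SO y d -> SO (x + y) (c + d).
Proof.
move=> [c0 hx] [d0 hy]; split=> [|G H K L z hz]; first exact: addr_ge0.
apply: opb_ext (opbD (hx _ _ _ _ _ hz) (hy _ _ _ _ _ hz)) => r s.
rewrite /pairm -big_split; apply: eq_bigr => k _; rewrite -big_split.
by apply: eq_bigr => l _; rewrite /= ?fctE mulrDl.
Qed.

Lemma SOZ I (x : I -> I -> imx) c z : SO x c -> SO (z *: x) (nc z * c).
Proof.
move=> [c0 hx]; split=> [|G H K L y hy]; first by rewrite mulr_ge0 ?nc_ge0.
apply: opb_ext (opbZ z (hx _ _ _ _ _ hy)) => r s.
rewrite /pairm mulr_sumr; apply: eq_bigr => k _; rewrite mulr_sumr.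
by apply: eq_bigr => l _; rewrite mulrA.
Qed.

Lemma SO_mlr I J (x : J -> J -> imx) (u : I -> J -> R[i]) (v : J -> I -> R[i]) c d e :
  opb u d -> SO x c -> opb v e -> SO (mlr u x v) (d * c * e).
Proof.
move=> hu [c0 hx] hv; have d0 := opb_ge0 hu; have e0 := opb_ge0 hv.
split=> [|G H K L y hy]; first by rewrite !mulr_ge0.
apply: opb_ext (opb_mlr hu (hx _ _ _ _ _ hy) hv) => -[i g] [j h].
rewrite /pairm/=; symmetry.
under eq_bigr do under eq_bigr do rewrite mlrE mulr_suml.
under eq_bigr do rewrite exchange_big/=.
rewrite exchange_big/=; apply: eq_bigr => p _.
under eq_bigr do under eq_bigr do rewrite mulr_suml.
under eq_bigr do rewrite exchange_big/=.
rewrite exchange_big/=; apply: eq_bigr => q _.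
rewrite mulr_sumr; apply: eq_bigr => k _; rewrite mulr_sumr.
by apply: eq_bigr => l _; rewrite !mulrA.
Qed.

Lemma SO_dsum I J (x : I -> I -> imx) (y : J -> J -> imx) c :
  SO x c -> SO y c -> SO (dsum x y) c.
Proof.
move=> [c0 hx] [_ hy]; split=> // G H K L z hz.
apply: opb_ext (opb_dsumG (hx _ _ _ _ _ hz) (hy _ _ _ _ _ hz)).
move=> [[i|i] g] [[j|j] h] //=; rewrite /pairm/= big1// => k _.
  by rewrite big1// => l _; rewrite mul0r.
by rewrite big1// => l _; rewrite mul0r.
Qed.

Lemma SO_csc I (x : I -> I -> imx) f c : (forall k, nc (f k) <= 1) ->
  SO x c -> SO (fun i j => csc f (x i j)) c.
Proof.
move=> f1 [c0 hx]; split=> // G H K L y hy.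
have hy' : opb (trm (K := K) (L := L) (fun g h => csc f (y g h))) 1.
  exact: opb_ext (opb_colscale (e := fun s : H * 'I_L => f s.2) (fun s => f1 s.2) hy).
apply: opb_ext (hx _ _ _ _ _ hy') => r s.
apply: eq_bigr => k _; apply: eq_bigr => l _; rewrite /csc; ring.
Qed.

Lemma ord_neq M (i j : 'I_M) : j != i -> (i == j :> nat) = false.
Proof. by apply: contraNF => /eqP/val_inj ->. Qed.

Lemma assoc_inj (A B D : finType) : injective (fun r : A * B * D => (r.1.1, (r.1.2, r.2))).
Proof. by move=> [[? ?] ?] [[? ?] ?] [-> -> ->]. Qed.

(* Duality: <x * x', y> = <x, x' * y>, and the entries of x' * y are themselves
   values of the pairing with x'. *)
Lemma SO_sch I J (x : I -> I -> imx) (x' : J -> J -> imx) c d :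
  SO x c -> SO x' d -> SO (amp sch x x') (c * d).
Proof.
move=> hx hx'; have c0 := SO_ge0 hx; have d0 := SO_ge0 hx'.
split=> [|G H K L y hy]; first exact: mulr_ge0.
pose v (r : G * 'I_K) (s : H * 'I_L) : imx := fun k l =>
  y r.1 s.1 k l *+ ((r.2 == k :> nat) && (s.2 == l :> nat)).
have hv : opb (trm (K := K) (L := L) v) 1.
  pose f (A : finType) M (r : A * 'I_M) := (r, r.2).
  have fI A M : injective (@f A M) by move=> ? ? [].
  have fc (A : finType) M (r : A * 'I_M * 'I_M) : r \notin codom (@f A M) ->
      (r.1.2 == r.2 :> nat) = false.
    apply: contraNF => /eqP e; apply/codomP; exists r.1; rewrite /f.
    by case: r e => r1 r2 /= /val_inj ->.
  apply: (opb_extend (@fI _ _) (@fI _ _) _ _ _ hy).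
  - by move=> r s; rewrite /trm /v /= !eqxx mulr1n.
  - by move=> r s /fc e; rewrite /trm /v e mulr0n.
  - by move=> r s /fc e; rewrite /trm /v e andbF mulr0n.
pose w (r : J * G) (s : J * H) : imx := fun k l => x' r.1 s.1 k l * y r.2 s.2 k l.
have hw : opb (trm (K := K) (L := L) w) d.
  rewrite -[d]mulr1.
  apply: opb_ext (opb_sub (@assoc_inj _ _ _) (@assoc_inj _ _ _) (SO_scaled hx' hv)).
  move=> [[j g] k] [[j' h] l]; rewrite /pairm /trm /w /v /=.
  rewrite (bigD1 k)//= (bigD1 l)//= !eqxx mulr1n big1 ?addr0 => [|l' ll']; last first.
    by rewrite ord_neq ?mulr0n ?mulr0.
  rewrite big1 ?addr0// => k' kk'; rewrite big1// => l' _.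
  by rewrite ord_neq ?mulr0n ?mulr0.
apply: opb_ext (opb_sub (@assoc_inj _ _ _) (@assoc_inj _ _ _) (SO_scaled hx hw)).
move=> [[i j] g] [[i' j'] h]; apply: eq_bigr => k _; apply: eq_bigr => l _.
by rewrite /= mulrA.
Qed.

(** Transposition again: the pairing of x * y with z is that of x with y * z, and y * z is a
    compression of a tensor product, hence bounded by d. *)
Lemma SO_sch_bnd I J (x : I -> I -> imx) (y : J -> J -> imx) c d :
  SO x c -> bnd y d -> SO (amp sch x y) (c * d).
Proof.
move=> hx hy; have c0 := SO_ge0 hx; have d0 := bnd_ge0 hy.
split=> [|G H K L z hz]; first exact: mulr_ge0.
pose w (r : J * G) (s : J * H) : imx := fun k l => y r.1 s.1 k l * z r.2 s.2 k l.
have hw : opb (trm (K := K) (L := L) w) d.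
  pose f (A B D : finType) (r : A * B * D) := ((r.1.1, r.2), (r.1.2, r.2)).
  have fI A B D : injective (@f A B D) by move=> [[? ?] ?] [[? ?] ?] [-> -> ->].
  rewrite -[d]mulr1.
  exact: opb_ext (opb_sub (fI _ _ _) (fI _ _ _) (opb_tens (bnd_rect K L hy) hz)).
apply: opb_ext (opb_sub (@assoc_inj _ _ _) (@assoc_inj _ _ _) (SO_scaled hx hw)).
move=> [[i j] g] [[i' j'] h]; apply: eq_bigr => k _; apply: eq_bigr => l _.
by rewrite /= mulrA.
Qed.

Lemma SO_sub I J (f g : J -> I) (x : I -> I -> imx) c :
  injective f -> injective g -> SO x c -> SO (fun i j => x (f i) (g j)) c.
Proof.
move=> fI gI [c0 hx]; split=> // G H K L y hy.
apply: opb_ext (opb_sub (f := fun r => (f r.1, r.2)) (g := fun r => (g r.1, r.2))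
  _ _ (hx _ _ _ _ _ hy)) => //.
- by move=> [? ?] [? ?] [/fI -> ->].
- by move=> [? ?] [? ?] [/gI -> ->].
Qed.

Lemma SO_bnd_sch I J (x : I -> I -> imx) (y : J -> J -> imx) c d :
  bnd x c -> SO y d -> SO (amp sch x y) (c * d).
Proof.
move=> hx hy; rewrite mulrC.
have sw : injective (fun r : I * J => (r.2, r.1)) by move=> [? ?] [? ?] [-> ->].
apply: SO_ext (SO_sub sw sw (SO_sch_bnd hy hx)) => r s k l.
exact: mulrC.
Qed.

(* For the trace pairing Tr(a b^T), the adjoint of (x, x') |-> x x' sends y to
   (y (x) 1) composed with the flip. *)
Lemma SO_prod I J (x : I -> I -> imx) (x' : J -> J -> imx) f N c d :
  (forall k, nc (f k) <= 1) ->
  SO x c -> SO x' d -> SO (amp (prodK N f) x x') (c * d).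
Proof.
move=> f1 hx hx'; have c0 := SO_ge0 hx; have d0 := SO_ge0 hx'.
split=> [|G H K L y hy]; first exact: mulr_ge0.
pose v (r : G * 'I_K) (s : H * 'I_N) : imx := fun k l =>
  y r.1 s.1 r.2 l *+ (k == s.2 :> nat).
have hv : opb (trm (K := N) (L := L) v) 1.
  have sw : injective (fun r : H * 'I_N * 'I_L => ((r.1.1, r.2), r.1.2)).
    by move=> [[? ?] ?] [[? ?] ?] [-> -> ->].
  have h := opb_sub (f := fun r : G * 'I_K * 'I_N => r) (@inj_id _) sw (opb_amp 'I_N hy).
  by apply: opb_ext h => -[[g i] k] [[h j] l].
pose w (r : J * G) (s : J * H) : imx := fun i k =>
  \sum_(l < L) f k * x' r.1 s.1 k l * y r.2 s.2 i l.
have hw : opb (trm (K := K) (L := N) w) d.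
  rewrite -[d]mulr1.
  apply: opb_ext (opb_colscale (e := fun s : J * H * 'I_N => f s.2)
    (fun s => f1 s.2) (opb_sub (@assoc_inj _ _ _) (@assoc_inj _ _ _) (SO_scaled hx' hv))).
  move=> [[j g] i] [[j' h] k]; rewrite /pairm /trm /w /v /=.
  rewrite (bigD1 k)//= [X in _ + X]big1 ?addr0 => [|k' kk']; last first.
    by rewrite big1// => l _; rewrite eq_sym ord_neq ?mulr0n ?mulr0.
  rewrite mulr_suml; apply: eq_bigr => l _; rewrite eqxx mulr1n; ring.
apply: opb_ext (opb_sub (@assoc_inj _ _ _) (@assoc_inj _ _ _) (SO_scaled hx hw)).
move=> [[i j] g] [[i' j'] h]; rewrite /pairm /w /amp /prodK /=.
apply: eq_bigr => k _.
under eq_bigr do rewrite mulr_sumr.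
rewrite exchange_big/=; apply: eq_bigr => l _; rewrite mulr_suml.
by apply: eq_bigr => n _; rewrite !mulrA.
Qed.

(** The trace class norm dominates the Hilbert-Schmidt norm. Let s be the left side: the conjugate
    of the corner has operator norm at most sqrt s, and pairing x with it gives s <= c * sqrt s. *)
Lemma SO_hs I (x : I -> I -> imx) c i j K : SO x c ->
  \sum_(k < K) \sum_(l < K) nc (x i j k l) ^+ 2 <= c ^+ 2.
Proof.
move=> hx; have c0 := SO_ge0 hx; set s := \sum_(k < K) _.
have s0 : 0 <= s by do 2!(apply: sumr_ge0 => ? _); apply: sqr_ge0.
pose y (_ _ : unit) : imx := fun k l => (x i j k l)^*%C.
have hy : opb (trm (K := K) (L := K) y) (Num.sqrt s).
  have pj : injective (fun r : unit * 'I_K => r.2) by move=> [[] ?] [[] ?] /= ->.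
  have := opb_hs (a := fun k l : 'I_K => (x i j k l)^*%C) (sqrtr_ge0 s) _.
  move=> /(_ _)/(opb_sub pj pj); apply.
  by rewrite sqr_sqrtr//; under eq_bigr do under eq_bigr do rewrite nc_conj.
have := opb_entry (i, tt) (j, tt) (SO_scaled hx hy).
rewrite /pairm /y /=.
under eq_bigr do under eq_bigr do rewrite mul_conj.
under eq_bigr do rewrite sum_RtoC.
rewrite sum_RtoC nc_real ger0_norm// -/s => h.
rewrite -[leLHS]sqr_sqrtr// lerXn2r ?nnegrE ?sqrtr_ge0//.
move: h; rewrite -{1}[s]sqr_sqrtr// expr2.
have := sqrtr_ge0 s; rewrite le_eqVlt => /predU1P[<-//|sp].
by rewrite ler_pM2r.
Qed.

(** The operator norm is bounded by the Hilbert-Schmidt norm of the whole array, whose [#|I| ^ 2]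
    blocks contribute at most c ^ 2 each. The factor [#|I|] is affordable because only boundedness
    and convergence are drawn from this. *)
Lemma SO_bnd I (x : I -> I -> imx) c : SO x c -> bnd x (#|I|%:R * c).
Proof.
move=> hx K; have c0 := SO_ge0 hx; apply: opb_hs; first by rewrite mulr_ge0.
rewrite sum_pair; under eq_bigr do under eq_bigr do rewrite sum_pair.
apply: (@le_trans _ _ (\sum_(i : I) \sum_(j : I) c ^+ 2)).
  apply: ler_sum => i _; rewrite exchange_big/=; apply: ler_sum => j _.
  exact: SO_hs hx.
rewrite !sumr_const -[leLHS]mulr_natl -[X in _ * X <= _]mulr_natl.
by rewrite exprMn mulrA expr2.
Qed.

Lemma SO_cpt I (x : I -> I -> imx) c i j : SO x c -> cpt (x i j).
Proof.
move=> hx e e0.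
pose u K := \sum_(k < K) \sum_(l < K) nc (x i j k l) ^+ 2.
have sq (K L : nat) : (K <= L)%N -> u L = u K +
    \sum_(k < L) \sum_(l < L) nc (tl K (x i j) k l) ^+ 2.
  move=> KL; rewrite {2}/u.
  have -> : \sum_(k < K) \sum_(l < K) nc (x i j k l) ^+ 2 =
     \sum_(k < L) \sum_(l < L) nc (x i j k l) ^+ 2 *+ ((k < K) && (l < K))%N.
    rewrite (big_ord_widen L (fun k => \sum_(l < K) nc (x i j k l) ^+ 2))// big_mkcond/=.
    apply: eq_bigr => k _; case: ifP => kK /=; last by rewrite big1.
    rewrite (big_ord_widen L (fun l => nc (x i j k l) ^+ 2))// big_mkcond/=.
    by apply: eq_bigr => l _; case: ifP.
  rewrite -big_split; apply: eq_bigr => k _; rewrite -big_split; apply: eq_bigr => l _.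
  rewrite /tl /=; case: (_ && _); rewrite ?mulr1n ?mulr0n ?nc0 ?expr0n ?addr0 ?add0r//.
have ui n : u n <= u n.+1.
  rewrite (sq n n.+1)// lerDl; do 2!(apply: sumr_ge0 => ? _); exact: sqr_ge0.
have uc n : u n <= c ^+ 2 by apply: SO_hs hx.
have [K hK] := nondec_cauchy ui uc (exprn_gt0 2 e0).
exists K; apply: bopI => L; apply: opb_hs; first exact: ltW.
have := hK (maxn K L) (leq_maxl _ _); rewrite (sq K)// ?leq_maxl// lerD2l; apply: le_trans.
have Lm := leq_maxr K L.
rewrite (big_ord_widen (maxn K L) (fun k => \sum_(l < L) nc (tl K (x i j) k l) ^+ 2))//.
rewrite big_mkcond/=; apply: ler_sum => k _.
case: ifP => _; last by apply: sumr_ge0 => ? _; exact: sqr_ge0.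
rewrite (big_ord_widen (maxn K L) (fun l => nc (tl K (x i j) k l) ^+ 2))//.
rewrite big_mkcond/=; apply: ler_sum => l _; case: ifP => _ //; exact: sqr_ge0.
Qed.

Lemma SO_SI I (x : I -> I -> imx) c : SO x c -> SI x (#|I|%:R * c).
Proof. by move=> hx; split=> [i j|]; [exact: SO_cpt hx|exact: SO_bnd]. Qed.

Lemma SO_entry I (x : I -> I -> imx) c i j k l : SO x c -> nc (x i j k l) <= c.
Proof.
move=> hx; rewrite -(ler_pXn2r (_ : 0 < 2)%N) ?nnegrE ?nc_ge0 ?(SO_ge0 hx)//.
apply: le_trans (SO_hs i j (maxn k l).+1 hx).
have kK : (k < (maxn k l).+1)%N by rewrite ltnS leq_maxl.
have lK : (l < (maxn k l).+1)%N by rewrite ltnS leq_maxr.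
rewrite (bigD1 (Ordinal kK))//= (bigD1 (Ordinal lK))//= -addrA lerDl.
rewrite addr_ge0//; first by apply: sumr_ge0 => ? _; exact: sqr_ge0.
by do 2!(apply: sumr_ge0 => ? _); exact: sqr_ge0.
Qed.

(** Lower semicontinuity: each test in [SO] sees finitely many entries, so approximation of every
    corner is enough. *)
Lemma SO_lim I (x : I -> I -> imx) c : 0 <= c ->
  (forall K e, 0 < e -> exists2 y, SO y c &
    forall i j k l, (k < K)%N -> (l < K)%N -> nc (x i j k l - y i j k l) <= e) ->
  SO x c.
Proof.
move=> c0 h; split=> // G H K L z hz; apply: opb_lim => // e e0.
pose m : R := 1 + \sum_(k < K) \sum_(l < L) \sum_g \sum_h nc (z g h k l).
have m1 : 0 < m.
  by rewrite ltr_pwDl//; do 4!(apply: sumr_ge0 => ? _); exact: nc_ge0.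
have [y hy xy] := h (maxn K L) _ (divr_gt0 e0 m1).
exists (pairm K L y z); first by case: hy => _; apply.
move=> [i g] [j h']; rewrite /pairm -sumrB.
under eq_bigr => k _ do (rewrite -sumrB; under eq_bigr do rewrite -mulrBl).
apply: le_trans (nc_sum _ _ _) _.
apply: (@le_trans _ _ (e / m * \sum_(k < K) \sum_(l < L) nc (z g h' k l))).
  rewrite mulr_sumr; apply: ler_sum => k _; apply: le_trans (nc_sum _ _ _) _.
  rewrite mulr_sumr; apply: ler_sum => l _; rewrite ncM ler_wpM2r ?nc_ge0//.
  by apply: xy; rewrite (leq_trans (ltn_ord _))// ?leq_maxl ?leq_maxr.
rewrite mulrAC ler_pdivrMr// ler_pM2l// /m ler_wpDl//.
apply: ler_sum => k _; apply: ler_sum => l _.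
rewrite (bigD1 g)//= (bigD1 h')//= -addrA lerDl addr_ge0//.
  by apply: sumr_ge0 => ? _; exact: nc_ge0.
by do 2!(apply: sumr_ge0 => ? _); exact: nc_ge0.
Qed.

End TraceClass.

(** * Goursat's lemma and the maximum principle on the strip *)

Section ComplexAnalysis.
Variable R : realType.
Local Notation nc := (@ComplexField.Normc.normc R).
Local Notation C := (R[i]).
Implicit Types (f g : C -> C) (z u v a b : C) (e d : R) (n j N : nat).

(** Compactness of [[-q, q]] for a property that is monotone in n: the supremum of the points up to
    which a single n works could otherwise be pushed further by half the local radius. *)
Lemma itv_cover (q : R) (P : nat -> R -> Prop) :
  (forall m n t, (m <= n)%N -> P m t -> P n t) ->
  (forall t, `|t| <= q -> exists2 d : R, 0 < d & exists N, forall s, `|s - t| < d -> P N s) ->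
  exists N, forall t, `|t| <= q -> P N t.
Proof.
move=> Pm Pt; have [q0|q0] := ltP q 0.
  by exists 0%N => t tq; have := le_trans (normr_ge0 t) tq; rewrite leNgt q0.
pose A : set R := [set x : R | x <= q /\ exists N, forall t, - q <= t <= x -> P N t]%classic.
have hs : has_sup A.
  split; last by exists q => x [].
  exists (- q); split; first lra.
  have [|d d0 [N hN]] := Pt (- q); first by rewrite normrN ger0_norm.
  by exists N => t tq; apply: hN; rewrite (_ : t - - q = 0) ?normr0//; lra.
pose c := sup A.
have cq : c <= q by apply: sup_le_ub; [case: hs|move=> x []].
have qc : - q <= c.
  apply: ub_le_sup; first by case: hs.
  split; first lra.
  have [|d d0 [N hN]] := Pt (- q); first by rewrite normrN ger0_norm.
  by exists N => t tq; apply: hN; rewrite (_ : t - - q = 0) ?normr0//; lra.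
have [|d d0 [N1 hN1]] := Pt c; first by rewrite ler_norml; lra.
have [x [xq [N2 hN2]] xc] := sup_adherent d0 hs.
have hx t : - q <= t <= c + d / 2 -> P (maxn N1 N2) t.
  move=> tq; have [tx|tx] := leP t x.
    by apply: Pm (leq_maxr _ _) (hN2 _ _); lra.
  apply: Pm (leq_maxl _ _) (hN1 _ _); rewrite ltr_norml.
  by move: xc; rewrite -/c => xc; lra.
have [qd|qd] := leP q (c + d / 2).
  by exists (maxn N1 N2) => t; rewrite ler_norml => tq; apply: hx; lra.
have : c + d / 2 <= c.
  apply: ub_le_sup; first by case: hs.
  by split; [lra|exists (maxn N1 N2)].
lra.
Qed.

Definition cdiff f z := exists l, forall e, 0 < e -> exists2 d : R, 0 < d &
  forall h, nc h < d -> nc (f (z + h) - f z - l * h) <= e * nc h.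

Lemma cdiff_cst c z : cdiff (fun=> c) z.
Proof.
exists 0 => e e0; exists 1 => // h _.
by rewrite subrr mul0r subrr nc0 mulr_ge0 ?nc_ge0 ?(ltW e0).
Qed.

Lemma cdiffM f g z : cdiff f z -> cdiff g z -> cdiff (fun x => f x * g x) z.
Proof.
move=> [l hl] [m hm]; exists (l * g z + f z * m) => e e0.
have nm := nc_ge0 m; have nl := nc_ge0 l; have nf := nc_ge0 (f z); have ng := nc_ge0 (g z).
pose G := nc (g z) + nc m + nc (f z) + 2; have G0 : 0 < G by rewrite /G; lra.
have [d1 d10 h1] := hl _ (divr_gt0 e0 (mulr_gt0 (ltr0n _ 2) G0)).
have [d2 d20 h2] := hm _ (divr_gt0 e0 (mulr_gt0 (ltr0n _ 2) G0)).
have [d3 d30 h3] := hm _ ltr01.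
pose L := 2 * (nc l * (nc m + 1) + 1).
have L0 : 0 < L by rewrite /L mulr_gt0// ltr_wpDl// mulr_ge0// addr_ge0.
exists (Num.min (Num.min d1 d2) (Num.min (Num.min d3 1) (e / L))).
  by rewrite !lt_min d10 d20 d30 ltr01 divr_gt0.
move=> h; rewrite !lt_min => /andP[/andP[hd1 hd2] /andP[/andP[hd3 hd4] hd5]].
have nh := nc_ge0 h.
have dg : nc (g (z + h) - g z) <= (nc m + 1) * nc h.
  rewrite -[g (z + h) - g z](subrK (m * h)); apply: le_trans (ncD _ _) _.
  by rewrite ncM mulrDl addrC lerD2l h3.
have gh : nc (g (z + h)) <= nc (g z) + nc m + 1.
  rewrite -[g (z + h)](subrK (g z)); apply: le_trans (ncD _ _) _.
  have : (nc m + 1) * nc h <= (nc m + 1) by rewrite ler_piMr// ?ltW//; lra.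
  lra.
rewrite (_ : _ - _ = (f (z + h) - f z - l * h) * g (z + h) + l * h * (g (z + h) - g z)
  + f z * (g (z + h) - g z - m * h)); last by ring.
have t3 : nc (f z * (g (z + h) - g z - m * h)) <= nc (f z) * (e / (2 * G) * nc h).
  by rewrite ncM ler_wpM2l// h2.
have t1 : nc ((f (z + h) - f z - l * h) * g (z + h)) <=
    e / (2 * G) * nc h * (nc (g z) + nc m + 1).
  by rewrite ncM ler_pM ?nc_ge0// h1.
have t2 : nc (l * h * (g (z + h) - g z)) <= e / 2 * nc h.
  rewrite !ncM; apply: (@le_trans _ _ (nc l * nc h * ((nc m + 1) * nc h))).
    by rewrite ler_wpM2l// mulr_ge0.
  rewrite (_ : _ * _ = (nc l * (nc m + 1) * nc h) * nc h); last by ring.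
  rewrite ler_wpM2r//; have := hd5; rewrite ltr_pdivlMr// /L => hL.
  have := nh; nra.
have s : e / (2 * G) * nc h * (nc (g z) + nc m + 1) + nc (f z) * (e / (2 * G) * nc h)
    <= e / 2 * nc h.
  rewrite (_ : _ + _ = e / (2 * G) * (nc (g z) + nc m + 1 + nc (f z)) * nc h); last by ring.
  rewrite ler_wpM2r//; set K := (_ + nc (f z)).
  rewrite (_ : e / (2 * G) * K = e / 2 * (K / G)); last by field; rewrite gt_eqF.
  by rewrite ler_piMr ?divr_ge0 ?(ltW e0)// ler_pdivrMr// mul1r /K /G; lra.
apply: le_trans (ncD _ _) _; apply: le_trans (lerD (ncD _ _) (lexx _)) _; lra.
Qed.

Lemma cdiffX f z n : cdiff f z -> cdiff (fun x => f x ^+ n) z.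
Proof.
move=> hf; elim: n => [|n IH]; first exact: cdiff_cst.
rewrite (_ : (fun x => _) = (fun x => f x * f x ^+ n)); first exact: cdiffM.
by apply/funext => x; rewrite exprS.
Qed.

Lemma cdiffB f z c : cdiff f z -> cdiff (fun x => f x - c) z.
Proof.
move=> [l hl]; exists l => e e0; have [d d0 h] := hl e e0; exists d => // x xd.
by rewrite (_ : f (z + x) - c - (f z - c) = f (z + x) - f z) ?h//; ring.
Qed.

Lemma cdiffV z p : z != p -> cdiff (fun x => (x - p)^-1) z.
Proof.
rewrite -subr_eq0 => zp; exists (- (z - p)^-1 ^+ 2) => e e0.
have n0 : 0 < nc (z - p) by rewrite nc_gt0.
exists (Num.min (nc (z - p) / 2) (e * nc (z - p) ^+ 3 / 2)).
  by rewrite lt_min !divr_gt0 ?mulr_gt0 ?exprn_gt0.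
move=> h; rewrite lt_min => /andP[h1 h2].
have hz : nc (z - p) / 2 <= nc (z + h - p).
  have := ncD (z + h - p) (- h); rewrite ncN (_ : z + h - p - h = z - p); last by ring.
  lra.
have zh0 : z + h - p != 0 by rewrite -nc_gt0; apply: lt_le_trans hz; lra.
rewrite (_ : _ - _ = h ^+ 2 * ((z - p)^-1 ^+ 2 * (z + h - p)^-1)); last first.
  by field; rewrite zp zh0.
rewrite (ncM (h ^+ 2)) (ncM ((z - p)^-1 ^+ 2)) (ncX h) (ncX (z - p)^-1) !ncV.
rewrite expr2 -mulrA mulrC ler_wpM2r ?nc_ge0//.
have : (nc (z + h - p))^-1 <= 2 / nc (z - p).
  by rewrite -[2 / _]invf_div lef_pV2 ?posrE ?divr_gt0// nc_gt0.
move=> hi; apply: (@le_trans _ _ (nc h * ((nc (z - p))^-1 ^+ 2 * (2 / nc (z - p))))).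
  by rewrite ler_wpM2l ?nc_ge0// ler_wpM2l// exprn_ge0// invr_ge0 nc_ge0.
rewrite (_ : _ * _ = nc h * 2 / nc (z - p) ^+ 3); last first.
  by field; rewrite gt_eqF.
by rewrite ler_pdivrMr ?exprn_gt0//; lra.
Qed.

(** Left Riemann sum of the integral of f over the segment from a to a + v. Dyadic subdivision makes
    halving the segment an exact identity, [segS]. *)
Definition seg n f a v : C :=
  v / 2 ^+ n * \sum_(k < 2 ^ n) f (a + v * (k%:R / 2 ^+ n)).

Lemma segS n f a v : seg n.+1 f a v = seg n f a (v / 2) + seg n f (a + v / 2) (v / 2).
Proof.
have p0 : (2 ^+ n : C) != 0 by rewrite expf_neq0// pnatr_eq0.
have e1 : v / 2 / 2 ^+ n = v / 2 ^+ n.+1 by rewrite exprS invfM mulrA.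
rewrite /seg e1 -mulrDr; congr (_ * _).
rewrite expnS mul2n -addnn big_split_ord/=.
congr (_ + _); apply: eq_bigr => k _; congr f.
  by rewrite exprS; field; rewrite p0.
by rewrite exprS natrD natrX; field; rewrite p0.
Qed.

Lemma seg_bound n f a v (M : R) :
  (forall t, 0 <= t <= 1 -> nc (f (a + v * t%:C%C)) <= M) ->
  nc (seg n f a v) <= nc v * M.
Proof.
move=> h; rewrite /seg !ncM ncV ncX.
rewrite nc_nat.
have p0 : 0 < (2 : R) ^+ n by rewrite exprn_gt0.
rewrite -mulrA ler_wpM2l ?nc_ge0// mulrC ler_pdivrMr//.
apply: le_trans (nc_sum _ _ _) _.
apply: (@le_trans _ _ (\sum_(k < 2 ^ n) M)); last first.
  by rewrite sumr_const card_ord -[leLHS]mulr_natr natrX.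
apply: ler_sum => k _.
have -> : (k%:R / 2 ^+ n : C) = (k%:R / 2 ^+ n)%:C%C.
  by rewrite rmorphM fmorphV rmorphXn !rmorph_nat.
apply: h; rewrite divr_ge0 ?exprn_ge0//= ler_pdivrMr// mul1r -natrX ler_nat.
exact: ltnW.
Qed.

Lemma segB n f g a v : seg n (fun x => f x - g x) a v = seg n f a v - seg n g a v.
Proof. by rewrite /seg sumrB mulrBr. Qed.

Lemma segZ n f c a v : seg n (fun x => c * f x) a v = c * seg n f a v.
Proof. by rewrite /seg -mulr_sumr mulrCA. Qed.

(* Left Riemann sums, along 2 ^ n subdivisions, of the integral of f over the
   boundary of the parallelogram with corner z and sides u, v. *)
Definition ctr n f z u v : C :=
  seg n f z u + seg n f (z + u) v - seg n f (z + v) u - seg n f z v.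

Lemma ctrS n f z u v : ctr n.+1 f z u v =
  ctr n f z (u / 2) (v / 2) + ctr n f (z + u / 2) (u / 2) (v / 2) +
  ctr n f (z + v / 2) (u / 2) (v / 2) + ctr n f (z + u / 2 + v / 2) (u / 2) (v / 2).
Proof.
rewrite /ctr !segS.
have e1 : z + u / 2 + u / 2 = z + u by rewrite -addrA -splitr.
have e2 : z + v / 2 + v / 2 = z + v by rewrite -addrA -splitr.
have e3 : z + v / 2 + u / 2 = z + u / 2 + v / 2 by rewrite addrAC.
have e4 : z + u / 2 + v / 2 + u / 2 = z + u + v / 2 by rewrite addrAC e1.
have e5 : z + u / 2 + v / 2 + v / 2 = z + v + u / 2 by rewrite -addrA -splitr addrAC.
rewrite e1 e2 e3 e4 e5; ring.
Qed.

Lemma ctrB n f g z u v : ctr n (fun x => f x - g x) z u v = ctr n f z u v - ctr n g z u v.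
Proof. by rewrite /ctr !segB; ring. Qed.

(** The sum vanishes exactly, and not only in the limit: for an affine function the error of a left
    Riemann sum depends on the direction of the edge alone, so it cancels between opposite edges. *)
Lemma ctr_affine n b c p z u v : ctr n (fun x => c + b * (x - p)) z u v = 0.
Proof.
have p0 : (2 ^+ n : C) != 0 by rewrite expf_neq0// pnatr_eq0.
have e a w : seg n (fun x => c + b * (x - p)) a w =
    w * (c + b * (a - p)) + b * w ^+ 2 / 2 ^+ n * \sum_(k < 2 ^ n) (k%:R / 2 ^+ n).
  rewrite /seg (eq_bigr (fun k : 'I_(2 ^ n) =>
    (c + b * (a - p)) + b * w * (k%:R / 2 ^+ n))); last by move=> k _; ring.
  have cst (D : C) : \sum_(k < 2 ^ n) D = D * 2 ^+ n.
    by rewrite sumr_const card_ord -[LHS]mulr_natr natrX.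
  rewrite big_split/= cst -mulr_sumr.
  by field; rewrite p0.
rewrite /ctr !e; ring.
Qed.

Lemma ctr_bound n f z u v (M : R) :
  (forall s t, 0 <= s <= 1 -> 0 <= t <= 1 ->
     nc (f (z + u * s%:C%C + v * t%:C%C)) <= M) ->
  nc (ctr n f z u v) <= 2 * (nc u + nc v) * M.
Proof.
move=> h; have i0 : (0 : R) <= (0 : R) <= (1 : R) by apply/andP; split.
have i1 : (0 : R) <= (1 : R) <= (1 : R) by apply/andP; split.
have b1 : nc (seg n f z u) <= nc u * M.
  by apply: seg_bound => t t1; have := h t 0 t1 i0; rewrite mulr0 addr0.
have b2 : nc (seg n f (z + u) v) <= nc v * M.
  by apply: seg_bound => t t1; have := h 1 t i1 t1; rewrite mulr1.
have b3 : nc (seg n f (z + v) u) <= nc u * M.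
  by apply: seg_bound => t t1; have := h t 1 t1 i1; rewrite mulr1 addrAC.
have b4 : nc (seg n f z v) <= nc v * M.
  by apply: seg_bound => t t1; have := h 0 t i0 t1; rewrite mulr0 addr0.
have c1 := ncD (seg n f z u) (seg n f (z + u) v).
have c2 := ncB (seg n f z u + seg n f (z + u) v) (seg n f (z + v) u).
have c3 := ncB (seg n f z u + seg n f (z + u) v - seg n f (z + v) u) (seg n f z v).
rewrite /ctr; lra.
Qed.

(* Goursat's bisection, run directly on the Riemann sums: interior edges cancel
   exactly in ctrS, so no integral needs to be defined. *)
Lemma goursat f z u v :
  (forall s t, 0 <= s <= 1 -> 0 <= t <= 1 -> cdiff f (z + u * s%:C%C + v * t%:C%C)) ->
  forall e, 0 < e -> exists N, forall n, (N <= n)%N -> nc (ctr n f z u v) <= e.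
Proof.
move=> fd e e0; apply: contrapT => hbad.
pose h j : R := 2^-1 ^+ j.
have h0 j : 0 < h j by rewrite exprn_gt0// invr_gt0.
have hS j : h j.+1 = h j / 2 by rewrite /h exprSr.
pose pt (r : R * R) := z + u * r.1%:C%C + v * r.2%:C%C.
pose ct n j r := ctr n f (pt r) (u * (h j)%:C%C) (v * (h j)%:C%C).
pose bad j (r : R * R) := ~ exists N, forall n, (N <= n)%N ->
  nc (ct n j r) <= e * h j ^+ 2.
have stp j r : bad j r -> exists r', bad j.+1 r' /\
   r.1 <= r'.1 /\ r.2 <= r'.2 /\ r'.1 + h j.+1 <= r.1 + h j /\ r'.2 + h j.+1 <= r.2 + h j.
  move=> br; apply: contrapT => /forallNP hn; apply: br.
  pose r1 : R * R := r.
  pose r2 : R * R := (r.1 + h j.+1, r.2).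
  pose r3 : R * R := (r.1, r.2 + h j.+1).
  pose r4 : R * R := (r.1 + h j.+1, r.2 + h j.+1).
  have hj := h0 j; have hj2 : h j = 2 * h j.+1 by rewrite hS; field.
  have g r' : r.1 <= r'.1 -> r.2 <= r'.2 -> r'.1 + h j.+1 <= r.1 + h j ->
     r'.2 + h j.+1 <= r.2 + h j -> exists N, forall n, (N <= n)%N ->
       nc (ct n j.+1 r') <= e * h j.+1 ^+ 2.
    by move=> k1 k2 k3 k4; apply: contrapT => k; apply: (hn r').
  have [N1 k1] : exists N, forall n, (N <= n)%N -> nc (ct n j.+1 r1) <= e * h j.+1 ^+ 2.
    by apply: g; rewrite /r1 /=; lra.
  have [N2 k2] : exists N, forall n, (N <= n)%N -> nc (ct n j.+1 r2) <= e * h j.+1 ^+ 2.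
    by apply: g; rewrite /r2 /=; lra.
  have [N3 k3] : exists N, forall n, (N <= n)%N -> nc (ct n j.+1 r3) <= e * h j.+1 ^+ 2.
    by apply: g; rewrite /r3 /=; lra.
  have [N4 k4] : exists N, forall n, (N <= n)%N -> nc (ct n j.+1 r4) <= e * h j.+1 ^+ 2.
    by apply: g; rewrite /r4 /=; lra.
  exists (maxn (maxn N1 N2) (maxn N3 N4)).+1 => -[//|n]; rewrite ltnS !geq_max.
  move=> /andP[/andP[n1 n2] /andP[n3 n4]].
  have {}k1 := k1 n n1; have {}k2 := k2 n n2; have {}k3 := k3 n n3; have {}k4 := k4 n n4.
  have e2 (w : C) : w * (h j)%:C%C / 2 = w * (h j.+1)%:C%C.
    by rewrite hS rmorphM fmorphV rmorph_nat mulrA.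
  rewrite /ct ctrS !e2.
  have -> : pt r + u * (h j.+1)%:C%C = pt r2 by rewrite /pt /= rmorphD; ring.
  have -> : pt r + v * (h j.+1)%:C%C = pt r3 by rewrite /pt /= rmorphD; ring.
  have -> : pt r2 + v * (h j.+1)%:C%C = pt r4 by rewrite /pt /= rmorphD; ring.
  rewrite -/(ct n j.+1 r1) -/(ct n j.+1 r2) -/(ct n j.+1 r3) -/(ct n j.+1 r4).
  have c1 := ncD (ct n j.+1 r1) (ct n j.+1 r2).
  have c2 := ncD (ct n j.+1 r1 + ct n j.+1 r2) (ct n j.+1 r3).
  have c3 := ncD (ct n j.+1 r1 + ct n j.+1 r2 + ct n j.+1 r3) (ct n j.+1 r4).
  have : h j ^+ 2 = 4 * h j.+1 ^+ 2 by rewrite hS; field.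
  by move=> ->; lra.
have [nx hnx] : exists nx : nat -> R * R -> R * R, forall j r, bad j r -> bad j.+1 (nx j r) /\
   r.1 <= (nx j r).1 /\ r.2 <= (nx j r).2 /\
   (nx j r).1 + h j.+1 <= r.1 + h j /\ (nx j r).2 + h j.+1 <= r.2 + h j.
  have P (p : nat * (R * R)) : exists r', bad p.1 p.2 -> bad p.1.+1 r' /\
     p.2.1 <= r'.1 /\ p.2.2 <= r'.2 /\ r'.1 + h p.1.+1 <= p.2.1 + h p.1 /\
     r'.2 + h p.1.+1 <= p.2.2 + h p.1.
    have [b|nb] := pselect (bad p.1 p.2); last by exists p.2.
    by have [r' hr'] := stp _ _ b; exists r'.
  have [F hF] := choice P; exists (fun j r => F (j, r)) => j r; exact: (hF (j, r)).
pose fix rr j : R * R := if j is j'.+1 then nx j' (rr j') else (0, 0).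
have bad0 : bad 0%N (0, 0).
  move=> [N hN]; apply: hbad; exists N => n nN; have := hN n nN.
  by rewrite /ct /pt /h !expr0 expr1n !mulr1 !mulr0 !addr0.
have badj j : bad j (rr j) by elim: j => [//|j IH]; exact: (hnx j _ IH).1.
have mono j : (rr j).1 <= (rr j.+1).1 /\ (rr j).2 <= (rr j.+1).2 /\
   (rr j.+1).1 + h j.+1 <= (rr j).1 + h j /\ (rr j.+1).2 + h j.+1 <= (rr j).2 + h j.
  exact: (hnx j _ (badj j)).2.
(* Nested intervals [[x j, x j + h j]]: the supremum of the left ends lies in all of them. *)
have lim (x : nat -> R) : x 0%N = 0 -> (forall j, x j <= x j.+1 /\ x j.+1 + h j.+1 <= x j + h j) ->
    exists c, 0 <= c <= 1 /\ forall j, x j <= c <= x j + h j.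
  move=> x0 hx.
  have up j k : x j <= x (j + k)%N /\ x (j + k)%N + h (j + k)%N <= x j + h j.
    elim: k => [|k [I1 I2]]; rewrite ?addn0// addnS.
    by have [k1 k2] := hx (j + k)%N; split; lra.
  have xy j k : x k <= x j + h j.
    have [jk|/ltnW jk] := leqP j k.
      by have := (up j (k - j)%N).2; rewrite subnKC// => ?; have := h0 k; lra.
    by have := (up k (j - k)%N).1; rewrite subnKC// => ?; have := h0 j; lra.
  have hs : has_sup (range x) by split; [exists (x 0%N), 0%N|exists (x 0%N + h 0%N) => _ [k _ <-]].
  have H j : x j <= sup (range x) <= x j + h j.
    apply/andP; split; first by apply: ub_le_sup; [case: hs|exists j].
    by apply: sup_le_ub; [case: hs|move=> _ [k _ <-]].
  exists (sup (range x)); split => //; have := H 0%N.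
  by rewrite x0 /h expr0; lra.
have [s [s01 hs]] : exists c, 0 <= c <= 1 /\ forall j, (rr j).1 <= c <= (rr j).1 + h j.
  by apply: lim => // j; have [? [? [? ?]]] := mono j.
have [t [t01 ht]] : exists c, 0 <= c <= 1 /\ forall j, (rr j).2 <= c <= (rr j).2 + h j.
  by apply: lim => // j; have [? [? [? ?]]] := mono j.
have [l hl] := fd s t s01 t01.
pose p := z + u * s%:C%C + v * t%:C%C.
pose D := nc u + nc v; have D0 : 0 <= D by rewrite addr_ge0 ?nc_ge0.
(* In cell j, [ctr_bound] gives the factor 2 * D * h j and the distance to p is at most D * h j,
   hence the constant 2 * D ^ 2; the added 1 keeps the divisor positive when u = v = 0. *)
have D1 : 0 < 2 * D ^+ 2 + 1 by rewrite ltr_wpDl// mulr_ge0// sqr_ge0.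
have [d d0 hd] := hl _ (divr_gt0 e0 D1).
have [j jd] : exists j, D * h j < d.
  have [k hk] : exists k : nat, D / d < k%:R.
    have := archi_boundP (divr_ge0 D0 (ltW d0)); by exists (Num.bound (D / d)).
  exists k; rewrite /h exprVn ltr_pdivrMr ?exprn_gt0//.
  have : k%:R <= (2 : R) ^+ k by rewrite -natrX ler_nat ltnW// ltn_expl.
  by move: hk; rewrite ltr_pdivrMr// mulrC => hk kk; apply: lt_le_trans hk _; rewrite ler_pM2l.
apply: (badj j); exists 0%N => n _.
(* Subtracting the tangent affine map at p leaves the sum unchanged, and only the differentiability
   error remains. *)
rewrite /ct -[ctr _ _ _ _ _]subr0 -(ctr_affine n l (f p) p (pt (rr j)) (u * (h j)%:C%C)
   (v * (h j)%:C%C)) -ctrB.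
have hj := h0 j.
apply: le_trans (ctr_bound (M := e / (2 * D ^+ 2 + 1) * (D * h j)) _ _) _; last first.
  rewrite !ncM nc_real ger0_norm ?(ltW hj)// -mulrDl -/D.
  rewrite [leLHS](_ : _ = e * h j ^+ 2 * (2 * D ^+ 2 / (2 * D ^+ 2 + 1))); last first.
    by field; rewrite gt_eqF.
  apply: ler_piMr; first by rewrite mulr_ge0 ?sqr_ge0 ?(ltW e0).
  by rewrite ler_pdivrMr// mul1r lerDl.
move=> s' t' s1 t1.
pose x := pt (rr j) + u * (h j)%:C%C * s'%:C%C + v * (h j)%:C%C * t'%:C%C.
have xp : x - p = u * ((rr j).1 + h j * s' - s)%:C%C + v * ((rr j).2 + h j * t' - t)%:C%C.
  by rewrite /x /p /pt !rmorphB !rmorphD !rmorphM; ring.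
have ab (y c w : R) : y <= c <= y + h j -> 0 <= w <= 1 -> `|y + h j * w - c| <= h j.
  move=> yc w1; rewrite ler_norml; have : 0 <= h j * w <= h j.
    by case/andP: w1 => w1 w2; rewrite mulr_ge0 ?ler_piMr ?(ltW hj).
  lra.
have nxp : nc (x - p) <= D * h j.
  rewrite xp; apply: le_trans (ncD _ _) _; rewrite !ncM !nc_real mulrDl.
  by rewrite lerD// ler_wpM2l ?nc_ge0// ab.
have := hd (x - p) (le_lt_trans nxp jd); rewrite -/p (addrC p) subrK => k.
rewrite -/x opprD addrA; apply: le_trans k _.
by rewrite ler_wpM2l// divr_ge0// ltW.
Qed.

(** Boundedness makes the singular corner removable: after a bisection only one quarter touches z
    and [goursat] disposes of the other three; after j halvings the remaining quarter contributes at
    most its perimeter times B, which carries the factor 2^-j. *)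
Lemma goursat_corner f z u v (B : R) :
  (forall s t, 0 <= s <= 1 -> 0 <= t <= 1 -> nc (f (z + u * s%:C%C + v * t%:C%C)) <= B) ->
  (forall s t, 0 <= s <= 1 -> 0 <= t <= 1 -> (0 < s) || (0 < t) ->
     cdiff f (z + u * s%:C%C + v * t%:C%C)) ->
  forall e, 0 < e -> exists N, forall n, (N <= n)%N -> nc (ctr n f z u v) <= e.
Proof.
move=> fB fd.
have B0 : 0 <= B by apply: le_trans (nc_ge0 _) (fB 0 0 _ _); apply/andP; split.
have key j : forall e, 0 < e -> forall u v,
   (forall s t, 0 <= s <= 1 -> 0 <= t <= 1 -> nc (f (z + u * s%:C%C + v * t%:C%C)) <= B) ->
   (forall s t, 0 <= s <= 1 -> 0 <= t <= 1 -> (0 < s) || (0 < t) ->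
     cdiff f (z + u * s%:C%C + v * t%:C%C)) ->
   exists N, forall n, (N <= n)%N ->
     nc (ctr n f z u v) <= e + 2 * (nc u + nc v) * B * 2^-1 ^+ j.
  elim: j => [|j IH] e e0 {fB fd}u {}v fB fd.
    by exists 0%N => n _; rewrite expr0 mulr1; apply: le_trans (ctr_bound _ fB) _; lra.
  have e4 : 0 < e / 4 by lra.
  have half2 : (2^-1 : R)%:C%C = 2^-1 :> C by rewrite fmorphV rmorph_nat.
  have nc2 : nc 2^-1 = 2^-1 by rewrite ncV nc_nat.
  have half (t : R) : 0 <= t <= 1 -> 0 <= t / 2 <= 1 by move=> ?; lra.
  have half' (t : R) : 0 <= t <= 1 -> 0 <= (1 + t) / 2 <= 1 by move=> ?; lra.
  have E1 (s t : R) : z + u / 2 * s%:C%C + v / 2 * t%:C%C =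
      z + u * (s / 2)%:C%C + v * (t / 2)%:C%C by rewrite !rmorphM/= half2; ring.
  have E2 (s t : R) : z + u / 2 + u / 2 * s%:C%C + v / 2 * t%:C%C =
      z + u * ((1 + s) / 2)%:C%C + v * (t / 2)%:C%C.
    by rewrite !rmorphM !rmorphD/= half2 rmorph1; ring.
  have E3 (s t : R) : z + v / 2 + u / 2 * s%:C%C + v / 2 * t%:C%C =
      z + u * (s / 2)%:C%C + v * ((1 + t) / 2)%:C%C.
    by rewrite !rmorphM !rmorphD/= half2 rmorph1; ring.
  have E4 (s t : R) : z + u / 2 + v / 2 + u / 2 * s%:C%C + v / 2 * t%:C%C =
      z + u * ((1 + s) / 2)%:C%C + v * ((1 + t) / 2)%:C%C.
    by rewrite !rmorphM !rmorphD/= half2 rmorph1; ring.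
  have [||N1 k1] := IH _ e4 (u / 2) (v / 2).
  - by move=> s t s1 t1; rewrite E1; apply: fB; apply: half.
  - move=> s t s1 t1 st; rewrite E1; apply: fd; rewrite ?half//.
    by case/orP: st => ?; apply/orP; [left|right]; lra.
  have [s t s1 t1|N2 k2] := @goursat f (z + u / 2) (u / 2) (v / 2) _ _ e4.
    by rewrite E2; apply: fd; rewrite ?half' ?half//; apply/orP; left; lra.
  have [s t s1 t1|N3 k3] := @goursat f (z + v / 2) (u / 2) (v / 2) _ _ e4.
    by rewrite E3; apply: fd; rewrite ?half' ?half//; apply/orP; right; lra.
  have [s t s1 t1|N4 k4] := @goursat f (z + u / 2 + v / 2) (u / 2) (v / 2) _ _ e4.
    by rewrite E4; apply: fd; rewrite ?half' ?half//; apply/orP; left; lra.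
  exists (maxn (maxn N1 N2) (maxn N3 N4)).+1 => -[//|n]; rewrite ltnS !geq_max.
  move=> /andP[/andP[n1 n2] /andP[n3 n4]].
  have {}k1 := k1 n n1; have {}k2 := k2 n n2; have {}k3 := k3 n n3; have {}k4 := k4 n n4.
  rewrite ctrS exprSr.
  set c1 := ctr _ _ _ _ _ in k1 *; set c2 := ctr _ _ _ _ _ in k2 *.
  set c3 := ctr _ _ _ _ _ in k3 *; set c4 := ctr _ _ _ _ _ in k4 *.
  have d1 := ncD c1 c2; have d2 := ncD (c1 + c2) c3; have d3 := ncD (c1 + c2 + c3) c4.
  move: k1; rewrite !ncM nc2 => k1.
  rewrite (_ : 2 * _ * _ * _ = 2 * (nc u / 2 + nc v / 2) * B * 2^-1 ^+ j); last by field.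
  lra.
move=> e e0; have e2 : 0 < e / 2 by lra.
pose k : R := 2 * (nc u + nc v) * B.
have k0 : 0 <= k by rewrite !mulr_ge0 ?addr_ge0 ?nc_ge0.
have [j hj] : exists j, k * 2^-1 ^+ j <= e / 2.
  exists (Num.bound (k / (e / 2))); rewrite exprVn ler_pdivrMr ?exprn_gt0//.
  have := archi_boundP (divr_ge0 k0 (ltW e2)); set m := Num.bound _.
  rewrite ltr_pdivrMr// => hk; apply: le_trans (ltW hk) _; rewrite mulrC ler_pM2l//.
  by rewrite -natrX ler_nat ltnW// ltn_expl.
have [N hN] := key j _ e2 u v fB fd; exists N => n /hN h.
by apply: le_trans h _; rewrite -/k; lra.
Qed.

End ComplexAnalysis.

(** * Maximum principle on rectangles and on the strip *)

Section MaximumPrinciple.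
Variable R : realType.
Local Notation nc := (@ComplexField.Normc.normc R).
Local Notation C := (R[i]).
Local Notation pt x y := (@Complex R x y).
Implicit Types (f g : C -> C) (z u v a b p : C) (e d x y : R) (n j N : nat).

Lemma Re_nc_le z : complex.Re z <= nc z.
Proof. by apply: le_trans (Re_nc z); rewrite ler_norm. Qed.

Lemma Im_nc_le z : complex.Im z <= nc z.
Proof. by apply: le_trans (Im_nc z); rewrite ler_norm. Qed.

Lemma ImD z u : complex.Im (z + u) = complex.Im z + complex.Im u.
Proof. by case: z u => ? ? []. Qed.

Lemma ImB z u : complex.Im (z - u) = complex.Im z - complex.Im u.
Proof. by case: z u => ? ? []. Qed.

Lemma Im_sum (I : Type) (r : seq I) (F : I -> C) :
  complex.Im (\sum_(i <- r) F i) = \sum_(i <- r) complex.Im (F i).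
Proof.
by elim: r => [|i r IH]; rewrite ?big_nil// !big_cons ImD IH.
Qed.

Lemma Im_scale (x : R) z : complex.Im (x%:C%C * z) = x * complex.Im z.
Proof. by case: z => a b /=; rewrite mul0r addr0. Qed.

Lemma Im_div a b (s : R) : complex.Im (b / (a + b * s%:C%C)) =
  (nc (a + b * s%:C%C) ^+ 2)^-1 * complex.Im (b * (a^*)%C).
Proof. by rewrite nc_sqr; case: a b => [a1 a2] [b1 b2] /=; ring. Qed.

(* Im (b / (a + b t)) has the constant sign of Im (b a^* ). *)
Lemma seg_inv n p a b : exists2 r, 0 <= r &
  complex.Im (seg n (fun z => (z - p)^-1) (p + a) b) = complex.Im (b * (a^*)%C) * r /\
  forall D, 0 < D -> (forall t, 0 <= t <= 1 ->
    a + b * t%:C%C != 0 /\ nc (a + b * t%:C%C) ^+ 2 <= D) -> D^-1 <= r.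
Proof.
pose t (k : 'I_(2 ^ n)) : R := k%:R / 2 ^+ n.
have p0 : 0 < (2 : R) ^+ n by rewrite exprn_gt0.
have t01 k : 0 <= t k <= 1.
  rewrite divr_ge0 ?exprn_ge0//= ler_pdivrMr// mul1r -natrX ler_nat.
  exact: ltnW.
pose r := (2 ^+ n)^-1 * \sum_(k < 2 ^ n) (nc (a + b * (t k)%:C%C) ^+ 2)^-1.
exists r.
  rewrite mulr_ge0 ?invr_ge0 ?exprn_ge0// sumr_ge0// => k _.
  by rewrite invr_ge0 exprn_ge0// nc_ge0.
split=> [|D D0 hD].
  have tE (k : 'I_(2 ^ n)) : (k%:R / 2 ^+ n : C) = (t k)%:C%C.
    by rewrite rmorphM fmorphV rmorphXn !rmorph_nat.
  have -> : seg n (fun z => (z - p)^-1) (p + a) b =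
      ((2 ^+ n)^-1 : R)%:C%C * \sum_(k < 2 ^ n) (b / (a + b * (t k)%:C%C)).
    rewrite fmorphV rmorphXn rmorph_nat /seg -mulrA mulrCA; congr (_ * _).
    rewrite mulr_sumr; apply: eq_bigr => k _; rewrite tE; congr (_ * _^-1); ring.
  rewrite Im_scale Im_sum mulrCA; congr (_ * _); rewrite mulr_sumr.
  by apply: eq_bigr => k _; rewrite Im_div; exact: mulrC.
rewrite /r ler_pdivlMl//.
apply: (@le_trans _ _ (\sum_(k < 2 ^ n) D^-1)).
  by rewrite sumr_const card_ord -[leRHS]mulr_natl natrX.
apply: ler_sum => k _; have [n0 nD] := hD _ (t01 k).
by rewrite lef_pV2 ?posrE// exprn_gt0// nc_gt0.
Qed.

(** Bernoulli's inequality: the powers of x > 1 are unbounded. This closes the power trick of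
    [rect_max]. *)
Lemma expn_bounded (x K : R) : (forall m, x ^+ m <= K) -> x <= 1.
Proof.
move=> h; rewrite leNgt; apply/negP => x1.
have B m : 1 + m%:R * (x - 1) <= x ^+ m.
  elim: m => [|m IH]; first by rewrite mul0r addr0.
  rewrite exprS -natr1; have m0 : 0 <= m%:R :> R by [].
  have : x * (1 + m%:R * (x - 1)) <= x * x ^+ m by rewrite ler_wpM2l//; lra.
  have := mulr_ge0 m0 (sqr_ge0 (x - 1)); rewrite expr2; lra.
have y0 : 0 < x - 1 by lra.
have K0 : 0 <= `|K| / (x - 1) by rewrite divr_ge0// ltW.
have := archi_boundP K0; rewrite ltr_pdivrMr// => hK.
have := le_trans (B _) (h (Num.bound (`|K| / (x - 1)))); have := ler_norm K; lra.
Qed.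

Lemma pt_scale (x y : R) (s t : R) : pt x 0 * s%:C%C + pt 0 y * t%:C%C = pt (x * s) (y * t).
Proof. by apply/eqP; rewrite eq_complex /=; apply/andP; split; apply/eqP; ring. Qed.

(** Coordinates are offsets from an interior point p. The two horizontal extents differ because th
    is in general not the middle of the strip. *)
Definition rect (p1 p2 q x y : R) := (- p2 <= x <= p1) && (- q <= y <= q).
Definition edge (p1 p2 q x y : R) := [|| x == p1, x == - p2, y == q | y == - q].

Lemma corner_rect (p1 p2 q x y s t : R) : 0 < p1 -> 0 < p2 -> 0 < q ->
  (x == p1) || (x == - p2) -> (y == q) || (y == - q) ->
  0 <= s <= 1 -> 0 <= t <= 1 -> rect p1 p2 q (x * s) (y * t).
Proof.
move=> p10 p20 q0 hx hy /andP[s0 s1] /andP[t0 t1]; rewrite /rect.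
have a1 : 0 <= p1 * s <= p1 by rewrite mulr_ge0 ?(ltW p10)//= ler_piMr// ltW.
have a2 : 0 <= p2 * s <= p2 by rewrite mulr_ge0 ?(ltW p20)//= ler_piMr// ltW.
have a3 : 0 <= q * t <= q by rewrite mulr_ge0 ?(ltW q0)//= ler_piMr// ltW.
apply/andP; split.
  by clear a3 hy; case/orP: hx => /eqP ->; lra.
by clear a1 a2 hx; case/orP: hy => /eqP ->; lra.
Qed.

(** A Cauchy estimate with a poor constant K that depends on the rectangle alone. The quotient (f -
    f p) / (z - p) is bounded and differentiable off p, so the boundary sums of f / (z - p) and of f
    p / (z - p) agree in the limit. The first is at most a multiple of M; the second is bounded
    below through the imaginary part of the sum of 1 / (z - p). *)
Lemma rect_est (p1 p2 q : R) : 0 < p1 -> 0 < p2 -> 0 < q -> exists K : R, forall f p (B M : R),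
  (forall x y, rect p1 p2 q x y -> cdiff f (p + pt x y)) ->
  (forall x y, rect p1 p2 q x y -> nc (f (p + pt x y)) <= B) ->
  (forall x y, rect p1 p2 q x y -> edge p1 p2 q x y -> nc (f (p + pt x y)) <= M) ->
  nc (f p) <= K * M.
Proof.
move=> p10 p20 q0.
pose dl := Num.min p1 (Num.min p2 q); have dl0 : 0 < dl by rewrite !lt_min p10 p20.
have dl1 : dl <= p1 by rewrite /dl ge_min lexx.
have dl2 : dl <= p2 by rewrite /dl !ge_min lexx orbT.
have dl3 : dl <= q by rewrite /dl !ge_min lexx !orbT.
pose kp := q * p1 / (p1 ^+ 2 + q ^+ 2).
have D0 : 0 < p1 ^+ 2 + q ^+ 2 by rewrite addr_gt0// exprn_gt0.
have kp0 : 0 < kp by rewrite divr_gt0// mulr_gt0.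
exists (8 * (p1 + p2 + q) / dl / kp) => f p B M fd fB fM.
rewrite mulrAC ler_pdivlMr//.
pose k z := (z - p)^-1.
pose g z := f z * k z - f p * k z.
pose u1 := pt p1 0; pose u2 := pt (- p2) 0; pose w1 := pt 0 q; pose w2 := pt 0 (- q).
(* The boundary sum over the eight half sides. When the contours of the four subrectangles with
   corner p are combined, the sums along the segments from p to the sides cancel; this is [oute]. *)
pose out n F := seg n F (p + u1) w1 - seg n F (p + w1) u1 - seg n F (p + u2) w1
  + seg n F (p + w1) u2 + seg n F (p + u2) w2 - seg n F (p + w2) u2
  - seg n F (p + u1) w2 + seg n F (p + w2) u1.
have r00 : rect p1 p2 q 0 0 by rewrite /rect; apply/andP; split; lra.
have pz : p + pt 0 0 = p by exact: addr0.
have [l hl] := fd 0 0 r00; rewrite pz in hl.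
have [d d0 hd] := hl 1 ltr01.
have B0 : 0 <= B by apply: le_trans (nc_ge0 _) (fB 0 0 r00).
have gB x y : rect p1 p2 q x y -> nc (g (p + pt x y)) <= nc l + 1 + 2 * B / d.
  (* At p itself [g] has the value 0, so it is bounded but in general discontinuous there, which is
     why [goursat_corner] is used. *)
  move=> rxy; have [e0|ne0] := eqVneq (pt x y) 0.
    rewrite e0 addr0 /g subrr nc0 !addr_ge0 ?nc_ge0 ?divr_ge0 ?mulr_ge0//; exact: ltW.
  have n0 : 0 < nc (pt x y) by rewrite nc_gt0.
  have -> : g (p + pt x y) = (f (p + pt x y) - f p) / pt x y.
    by rewrite /g /k addrAC subrr add0r mulrBl.
  rewrite ncM ncV ler_pdivrMr//; have [nd|nd] := ltP (nc (pt x y)) d.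
    have h1 := hd _ nd; rewrite -[f _ - f p](subrK (l * pt x y)).
    apply: le_trans (ncD _ _) _; rewrite ncM.
    have : 0 <= 2 * B / d * nc (pt x y).
      by rewrite !mulr_ge0 ?nc_ge0// invr_ge0 ltW.
    lra.
  have hB : nc (f (p + pt x y) - f p) <= 2 * B.
    have := ncB (f (p + pt x y)) (f p); have := fB x y rxy; have := fB 0 0 r00.
    rewrite pz; lra.
  apply: le_trans hB _; rewrite mulrDl.
  have h1 : 2 * B <= 2 * B / d * nc (pt x y).
    by rewrite mulrAC ler_pdivlMr// ler_wpM2l// mulr_ge0.
  have : 0 <= (nc l + 1) * nc (pt x y) by rewrite mulr_ge0 ?addr_ge0 ?nc_ge0.
  lra.
have gd x y : rect p1 p2 q x y -> pt x y != 0 -> cdiff g (p + pt x y).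
  move=> rxy ne0.
  have -> : g = fun z => (f z - f p) * k z by apply/funext => z; rewrite /g mulrBl.
  apply: cdiffM; first exact/cdiffB/fd.
  by apply: cdiffV; rewrite -subr_eq0 addrAC subrr add0r.
have cg x y : (x == p1) || (x == - p2) -> (y == q) || (y == - q) ->
    forall e, 0 < e -> exists N, forall n, (N <= n)%N -> nc (ctr n g p (pt x 0) (pt 0 y)) <= e.
  move=> hx hy.
  have rst s t : 0 <= s <= 1 -> 0 <= t <= 1 -> rect p1 p2 q (x * s) (y * t).
    exact: corner_rect.
  apply: goursat_corner => [s t s1 t1|s t s1 t1 st]; rewrite -addrA pt_scale.
    exact/gB/rst.
  apply: gd; first exact: rst.
  have x0 : x != 0 by case/orP: hx => /eqP ->; rewrite ?oppr_eq0 gt_eqF.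
  have y0 : y != 0 by case/orP: hy => /eqP ->; rewrite ?oppr_eq0 gt_eqF.
  rewrite eq_complex /= negb_and !mulf_eq0 (negPf x0) (negPf y0) /=.
  by case/orP: st => h; rewrite (gt_eqF h) ?orbT.
have oute n F : out n F = ctr n F p u1 w1 - ctr n F p u2 w1 + ctr n F p u2 w2 - ctr n F p u1 w2.
  by rewrite /out /ctr; ring.
have M0 : 0 <= M.
  apply: le_trans (nc_ge0 (f (p + pt p1 0))) (fM _ _ _ _); last by rewrite /edge eqxx.
  by rewrite /rect; apply/andP; split; lra.
pose S := p1 + p2 + q.
have sb n a b : nc b <= S -> (forall t, 0 <= t <= 1 -> exists x y,
     a + b * t%:C%C = pt x y /\ rect p1 p2 q x y && edge p1 p2 q x y) ->
     nc (seg n (fun z => f z * k z) (p + a) b) <= S * (M / dl).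
  move=> bS hab; apply: le_trans (seg_bound (M := M / dl) _ _) _.
    move=> t t1; have [x [y [-> /andP[rxy exy]]]] : exists x y,
       p + a + b * t%:C%C = p + pt x y /\ rect p1 p2 q x y && edge p1 p2 q x y.
      by have [x [y [e1 e2]]] := hab t t1; exists x, y; rewrite -addrA e1.
    rewrite ncM ler_pM ?nc_ge0// ?fM// /k addrAC subrr add0r ncV.
    have dn : dl <= nc (pt x y).
      case/or4P: exy => /eqP e1.
      - by apply: le_trans (Re_nc_le _); rewrite /= e1.
      - by apply: le_trans (Re_nc _); rewrite /= e1 normrN ger0_norm// ltW.
      - by apply: le_trans (Im_nc_le _); rewrite /= e1.
      - by apply: le_trans (Im_nc _); rewrite /= e1 normrN ger0_norm// ltW.
    by rewrite lef_pV2 ?posrE// (lt_le_trans dl0).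
  by rewrite ler_wpM2r// divr_ge0// ltW.
have sv n x y : (x == p1) || (x == - p2) -> (y == q) || (y == - q) ->
    nc (seg n (fun z => f z * k z) (p + pt x 0) (pt 0 y)) <= S * (M / dl).
  move=> hx hy; apply: sb.
    rewrite /= expr0n/= add0r sqrtr_sqr /S.
    by case/orP: hy => /eqP ->; rewrite ?normrN gtr0_norm//; lra.
  move=> t /andP[t0 t1]; exists x, (y * t); split.
    by apply/eqP; rewrite eq_complex /=; apply/andP; split; apply/eqP; ring.
  have i1 : (0 : R) <= (1 : R) <= (1 : R) by rewrite ler01 lexx.
  have t01 : 0 <= t <= 1 by rewrite t0.
  have := corner_rect p10 p20 q0 hx hy i1 t01; rewrite mulr1 => ->.
  by rewrite /edge; case/orP: hx => ->; rewrite ?orbT.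
have sh n x y : (x == p1) || (x == - p2) -> (y == q) || (y == - q) ->
    nc (seg n (fun z => f z * k z) (p + pt 0 y) (pt x 0)) <= S * (M / dl).
  move=> hx hy; apply: sb.
    rewrite /= expr0n/= addr0 sqrtr_sqr /S.
    by case/orP: hx => /eqP ->; rewrite ?normrN gtr0_norm//; lra.
  move=> t /andP[t0 t1]; exists (x * t), y; split.
    by apply/eqP; rewrite eq_complex /=; apply/andP; split; apply/eqP; ring.
  have i1 : (0 : R) <= (1 : R) <= (1 : R) by rewrite ler01 lexx.
  have t01 : 0 <= t <= 1 by rewrite t0.
  have := corner_rect p10 p20 q0 hx hy t01 i1; rewrite mulr1 => ->.
  by rewrite /edge; case/orP: hy => ->; rewrite ?orbT.
have nc8 (a1 a2 a3 a4 a5 a6 a7 a8 : C) : nc (a1 - a2 - a3 + a4 + a5 - a6 - a7 + a8) <=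
    nc a1 + nc a2 + nc a3 + nc a4 + nc a5 + nc a6 + nc a7 + nc a8.
  by do 3!(apply: le_trans (ncD _ _) _; rewrite lerD2r; do 2?(apply: le_trans (ncB _ _) _; rewrite lerD2r));
  rewrite ?lexx.
have outf n : nc (out n (fun z => f z * k z)) <= 8 * S * (M / dl).
  apply: le_trans (nc8 _ _ _ _ _ _ _ _) _.
  have := sv n p1 q; have := sv n p1 (- q); have := sv n (- p2) q; have := sv n (- p2) (- q).
  have := sh n p1 q; have := sh n p1 (- q); have := sh n (- p2) q; have := sh n (- p2) (- q).
  rewrite !eqxx ?orbT -/u1 -/u2 -/w1 -/w2.
  do 8!move=> /(_ isT isT) ?; lra.
(* The eight imaginary parts all contribute with the same sign, so a lower bound for one half side
   is enough: on the upper right one the squared distance to p is at most p1 ^ 2 + q ^ 2, which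
   explains [kp]. *)
have outk n : kp <= nc (out n k).
  apply: le_trans (Im_nc_le _); rewrite /out !(ImB, ImD).
  have [r1 r10 [-> h1]] := seg_inv n p u1 w1.
  have [r2 r20 [-> _]] := seg_inv n p w1 u1.
  have [r3 r30 [-> _]] := seg_inv n p u2 w1.
  have [r4 r40 [-> _]] := seg_inv n p w1 u2.
  have [r5 r50 [-> _]] := seg_inv n p u2 w2.
  have [r6 r60 [-> _]] := seg_inv n p w2 u2.
  have [r7 r70 [-> _]] := seg_inv n p u1 w2.
  have [r8 r80 [-> _]] := seg_inv n p w2 u1.
  rewrite /= !(mul0r, mulr0, addr0, add0r, subr0, oppr0, mulNr, mulrN, opprK, sub0r).
  have r1D : (p1 ^+ 2 + q ^+ 2)^-1 <= r1.
    apply: h1 => // t /andP[t0 t1].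
    have -> : u1 + w1 * t%:C%C = pt p1 (q * t).
      by apply/eqP; rewrite eq_complex /=; apply/andP; split; apply/eqP; ring.
    rewrite eq_complex /= (gt_eqF p10)/=; split=> //.
    rewrite sqr_sqrtr ?addr_ge0 ?sqr_ge0// lerD2l lerXn2r ?nnegrE ?mulr_ge0 ?(ltW q0)//.
    by rewrite ler_piMr// ltW.
  have P1 : 0 <= q * p1 by rewrite mulr_ge0 ?ltW.
  have P2 : 0 <= q * p2 by rewrite mulr_ge0 ?ltW.
  have : kp <= q * p1 * r1 by rewrite /kp ler_wpM2l.
  have := mulr_ge0 P1 r20; have := mulr_ge0 P2 r30; have := mulr_ge0 P2 r40.
  have := mulr_ge0 P2 r50; have := mulr_ge0 P2 r60; have := mulr_ge0 P1 r70.
  have := mulr_ge0 P1 r80; lra.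
have outg n : out n g = out n (fun z => f z * k z) - f p * out n k.
  by rewrite /out /g !segB !segZ; ring.
apply/ler_addgt0Pr => e e0; have e4 : 0 < e / 4 by lra.
have o1 : (p1 == p1) || (p1 == - p2) by rewrite eqxx.
have o2 : (- p2 == p1) || (- p2 == - p2) by rewrite eqxx orbT.
have o3 : (q == q) || (q == - q) by rewrite eqxx.
have o4 : (- q == q) || (- q == - q) by rewrite eqxx orbT.
have [N1 k1] := cg _ _ o1 o3 _ e4.
have [N2 k2] := cg _ _ o2 o3 _ e4.
have [N3 k3] := cg _ _ o2 o4 _ e4.
have [N4 k4] := cg _ _ o1 o4 _ e4.
pose n := maxn (maxn N1 N2) (maxn N3 N4).
have n1 : (N1 <= n)%N by rewrite /n !leq_max leqnn.
have n2 : (N2 <= n)%N by rewrite /n !leq_max leqnn !orbT.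
have n3 : (N3 <= n)%N by rewrite /n !leq_max leqnn !orbT.
have n4 : (N4 <= n)%N by rewrite /n !leq_max leqnn !orbT.
have {}k1 := k1 n n1; have {}k2 := k2 n n2; have {}k3 := k3 n n3; have {}k4 := k4 n n4.
have og : nc (out n g) <= e.
  rewrite oute; apply: le_trans (ncB _ _) _.
  have c1 := ncB (ctr n g p u1 w1) (ctr n g p u2 w1).
  have c2 := ncD (ctr n g p u1 w1 - ctr n g p u2 w1) (ctr n g p u2 w2).
  move: k1 k2 k3 k4; rewrite -/u1 -/u2 -/w1 -/w2; lra.
have : nc (f p) * kp <= nc (f p * out n k) by rewrite ncM ler_wpM2l ?nc_ge0.
have -> : f p * out n k = out n (fun z => f z * k z) - out n g by rewrite outg; ring.
move/le_trans; apply; apply: le_trans (ncB _ _) _; have := outf n.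
rewrite /S (_ : 8 * _ * (M / dl) = 8 * (p1 + p2 + q) / dl * M); last by ring.
lra.
Qed.

Lemma inv_small e : 0 < e -> exists N : nat, N.+1%:R^-1 < e.
Proof.
move=> e0; exists (Num.bound e^-1).
have i0 : 0 <= e^-1 by rewrite invr_ge0 ltW.
rewrite -[e in _ < e]invrK ltf_pV2 ?posrE ?invr_gt0 ?ltr0n//.
by apply: lt_trans (archi_boundP i0) _; rewrite ltr_nat.
Qed.

(** The constant disappears by taking powers: [rect_est] applied to f ^ m bounds (|f p| / M) ^ m by
    the same K for all m. *)
Lemma rect_max (p1 p2 q : R) f p (B M : R) : 0 < p1 -> 0 < p2 -> 0 < q ->
  (forall x y, rect p1 p2 q x y -> cdiff f (p + pt x y)) ->
  (forall x y, rect p1 p2 q x y -> nc (f (p + pt x y)) <= B) ->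
  (forall x y, rect p1 p2 q x y -> edge p1 p2 q x y -> nc (f (p + pt x y)) <= M) ->
  0 < M -> nc (f p) <= M.
Proof.
move=> p10 p20 q0 fd fB fM M0; have [K hK] := rect_est p10 p20 q0.
rewrite -[leRHS]mul1r -ler_pdivrMr//; apply: (@expn_bounded _ K) => m.
rewrite exprMn exprVn ler_pdivrMr ?exprn_gt0// -ncX.
apply: (hK (fun z => f z ^+ m) p (B ^+ m)).
- by move=> x y /fd; apply: cdiffX.
- move=> x y /fB h; rewrite ncX lerXn2r ?nnegrE ?nc_ge0//.
  exact: le_trans (nc_ge0 _) h.
- by move=> x y r e; rewrite ncX lerXn2r ?nnegrE ?nc_ge0 ?fM// ltW.
Qed.

(** The strip is unbounded and f is differentiable only inside. The factor a / (z + a) damps f at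
    infinity, at the cost of (th + a) / a at th, and continuity up to the boundary allows the
    vertical sides of the rectangle to lie slightly inside the strip. *)
Lemma strip_max f (th B M : R) : 0 < th < 1 ->
  (forall z, 0 <= complex.Re z <= 1 -> nc (f z) <= B) ->
  (forall z, 0 <= complex.Re z <= 1 -> forall e, 0 < e -> exists2 d, 0 < d &
    forall w, 0 <= complex.Re w <= 1 -> nc (w - z) < d -> nc (f w - f z) <= e) ->
  (forall z, 0 < complex.Re z < 1 -> cdiff f z) ->
  (forall t, nc (f (pt 0 t)) <= M) -> (forall t, nc (f (pt 1 t)) <= M) ->
  nc (f (pt th 0)) <= M.
Proof.
move=> /andP[th0 th1] fB fc fd fl fr.
have M0 : 0 <= M by apply: le_trans (nc_ge0 _) (fl 0).
have B0 : 0 <= B by apply: le_trans (nc_ge0 _) (fB (pt 0 0) _); rewrite /= lexx ler01.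
apply/ler_addgt0Pr => e e0; pose M' := M + e / 2; have M'0 : 0 < M' by rewrite /M'; lra.
(* With this a the loss M' * th / a is exactly e / 2. The height q below is such that the damped
   function, at most B * a / q there, is at most M'. *)
pose a := 2 * th * M' / e; have a0 : 0 < a by rewrite divr_gt0// !mulr_gt0.
pose q := B * a / M' + 1.
have q0 : 0 < q.
  by apply: ltr_wpDl => //; exact: divr_ge0 (mulr_ge0 B0 (ltW a0)) (ltW M'0).
have qB : B * a <= M' * q.
  by rewrite /q mulrDr mulr1 [M' * (_ / _)]mulrC divfK ?gt_eqF// lerDl ltW.
(* Continuity at each boundary point, made uniform over |t| <= q by compactness. *)
have side (x0 : R) : 0 <= x0 <= 1 -> (forall t, nc (f (pt x0 t)) <= M) ->
    exists N, forall t, `|t| <= q -> forall x, 0 <= x <= 1 ->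
      `|x - x0| <= N.+1%:R^-1 -> nc (f (pt x t)) <= M'.
  move=> x01 hx0; apply: (@itv_cover _ q (fun N t => forall x, 0 <= x <= 1 ->
      `|x - x0| <= N.+1%:R^-1 -> nc (f (pt x t)) <= M')).
    move=> m n t mn h x x1 xn; apply: h => //; apply: le_trans xn _.
    by rewrite lef_pV2 ?posrE ?ltr0n// ler_nat.
  move=> t _; have e2 : 0 < e / 2 by lra.
  have [d d0 hd] := fc (pt x0 t) x01 _ e2; exists (d / 2); first lra.
  have d2 : 0 < d / 2 by lra.
  have [N hN] := inv_small d2.
  exists N => s st x x1 xx0.
  rewrite -[f (pt x s)](subrK (f (pt x0 t))); apply: le_trans (ncD _ _) _.
  rewrite /M' addrC; apply: lerD; first exact: hx0.
  apply: hd => //; apply: le_lt_trans (nc_ReIm _) _ => /=.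
  have := lt_le_trans (le_lt_trans xx0 hN) (lexx _); lra.
have z01 : (0 : R) <= (0 : R) <= (1 : R) by rewrite lexx ler01.
have o01 : (0 : R) <= (1 : R) <= (1 : R) by rewrite lexx ler01.
have [N1 h1] := side 0 z01 fl; have [N2 h2] := side 1 o01 fr.
pose g z := f z * (a%:C%C * (z - (- a)%:C%C)^-1).
pose n1 : R := (maxn N1 N2).+1%:R^-1; have n10 : 0 < n1 by rewrite invr_gt0 ltr0n.
have n11 : n1 <= N1.+1%:R^-1 by rewrite lef_pV2 ?posrE ?ltr0n// ler_nat ltnS leq_maxl.
have n12 : n1 <= N2.+1%:R^-1 by rewrite lef_pV2 ?posrE ?ltr0n// ler_nat ltnS leq_maxr.
pose eta := Num.min n1 (Num.min (th / 2) ((1 - th) / 2)).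
have eta0 : 0 < eta by rewrite !lt_min n10 /=; apply/andP; split; lra.
have eta1 : eta <= n1 by rewrite ge_min lexx.
have eta2 : eta <= th / 2 by rewrite !ge_min lexx orbT.
have eta3 : eta <= (1 - th) / 2 by rewrite !ge_min lexx !orbT.
have damp z : 0 <= complex.Re z -> nc (a%:C%C * (z - (- a)%:C%C)^-1) <= 1 /\ nc (a%:C%C * (z - (- a)%:C%C)^-1) * `|complex.Im z| <= a.
  move=> z0; rewrite ncM ncV nc_real gtr0_norm//.
  have r1 : a <= nc (z - (- a)%:C%C).
    by apply: le_trans (Re_nc_le _); case: z z0 => zr zi /= z0; lra.
  have r2 : `|complex.Im z| <= nc (z - (- a)%:C%C).
    by apply: le_trans (Im_nc _); case: z {z0 r1} => zr zi /=; rewrite oppr0 addr0.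
  have n0 := lt_le_trans a0 r1.
  apply: conj; first by rewrite ler_pdivrMr// mul1r.
  by rewrite -mulrA ler_piMr ?(ltW a0)// mulrC ler_pdivrMr// mul1r.
have inst x y : rect (1 - eta - th) (th - eta) q x y ->
    0 < complex.Re (pt th 0 + pt x y) < 1.
  by move=> /andP[/andP[x1 x2] _] /=; apply/andP; split; lra.
have gM : nc (g (pt th 0)) <= M'.
  apply: (@rect_max (1 - eta - th) (th - eta) q g (pt th 0) B) => //; try lra.
  - move=> x y r; have /andP[s1 s2] := inst _ _ r.
    apply: cdiffM; first by apply: fd; rewrite s1 s2.
    apply: cdiffM; first exact: cdiff_cst.
    apply: cdiffV; apply/eqP => h; move: s1; rewrite h /=; lra.
  - move=> x y r; have /andP[s1 s2] := inst _ _ r.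
    rewrite /g ncM; have [d1 _] := damp _ (ltW s1).
    apply: le_trans (ler_wpM2l (nc_ge0 _) d1) _; rewrite mulr1.
    by apply: fB; rewrite !ltW.
  - move=> x y r; have /andP[s1 s2] := inst _ _ r.
    have [d1 d2] := damp _ (ltW s1); rewrite /g ncM.
    have ty : `|y| <= q by case/andP: r => _; rewrite ler_norml.
    have c1 := ler_wpM2l (nc_ge0 (f (pt th 0 + pt x y))) d1; rewrite mulr1 in c1.
    have fxy : f (pt th 0 + pt x y) = f (pt (th + x) y).
      by congr f; apply/eqP; rewrite eq_complex /= add0r !eqxx.
    have top : `|y| = q -> nc (f (pt th 0 + pt x y)) *
        nc (a%:C%C * (pt th 0 + pt x y - (- a)%:C%C)^-1) <= M'.
      have Imy : complex.Im (pt th 0 + pt x y) = y by rewrite /= add0r.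
      move=> yq; rewrite Imy yq in d2.
      have fb : nc (f (pt th 0 + pt x y)) <= B by apply: fB; rewrite !ltW.
      rewrite -(ler_pM2r q0); apply: le_trans qB; rewrite -mulrA.
      by apply: ler_pM => //; rewrite ?mulr_ge0 ?nc_ge0 ?(ltW q0).
    case/or4P => /eqP xy.
    + apply: le_trans c1 _; rewrite fxy; apply: h2 => //.
        by move: s1 s2 => /= s1 s2; rewrite !ltW.
      rewrite (_ : th + x - 1 = - eta); last by rewrite xy; ring.
      by rewrite normrN gtr0_norm// (le_trans eta1 n12).
    + apply: le_trans c1 _; rewrite fxy; apply: h1 => //.
        by move: s1 s2 => /= s1 s2; rewrite !ltW.
      rewrite (_ : th + x - 0 = eta); last by rewrite xy; ring.
      by rewrite gtr0_norm// (le_trans eta1 n11).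
    + by apply: top; rewrite xy gtr0_norm.
    + by apply: top; rewrite xy normrN gtr0_norm.
have tha : 0 < th + a by lra.
move: gM; rewrite /g !ncM nc_real gtr0_norm// ncV.
have -> : nc (pt th 0 - (- a)%:C%C) = th + a.
  by rewrite /= oppr0 addr0 opprK expr0n addr0 sqrtr_sqr gtr0_norm.
rewrite mulrA ler_pdivrMr// -ler_pdivlMr// => /le_trans; apply.
rewrite mulrDr mulrDl mulfK ?gt_eqF//.
have -> : M' * th / a = e / 2 by rewrite /a; field; rewrite !gt_eqF.
by rewrite /M'; lra.
Qed.

End MaximumPrinciple.

(** * Complex interpolation *)

Section CalderonFunctions.
Variable R : realType.
Local Notation nc := (@ComplexField.Normc.normc R).
Local Notation C := (R[i]).
Local Notation pt x y := (@Complex R x y).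
Implicit Types (z w : C) (c d e K M N t : R).

Lemma scale_swap (W : lmodType C) (a b : C) (v : W) : a *: (b *: v) = b *: (a *: v).
Proof. by rewrite !scalerA mulrC. Qed.

Definition inS z := 0 <= complex.Re z <= 1.
Definition inO z := 0 < complex.Re z < 1.

Record normpred (W : lmodType C) (S : W -> R -> Prop) : Prop := {
  np_ge0 : forall x c, S x c -> 0 <= c;
  np_le : forall x c d, c <= d -> S x c -> S x d;
  np0 : forall c, 0 <= c -> S 0 c;
  npD : forall x y c d, S x c -> S y d -> S (x + y) (c + d);
  npZ : forall x c (a : C), S x c -> S (a *: x) (nc a * c)
}.

Record reg (W : lmodType C) (S : W -> R -> Prop) (f : C -> W) : Prop := {
  reg_bdd : exists K, forall z, inS z -> S (f z) K;
  reg_cont : forall z, inS z -> forall e, 0 < e -> exists2 d : R, 0 < d &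
    forall w, inS w -> nc (w - z) < d -> S (f w - f z) e;
  reg_an : forall z, inO z -> exists l, forall e, 0 < e -> exists2 d : R, 0 < d &
    forall h, h != 0 -> nc h < d -> S (h^-1 *: (f (z + h) - f z) - l) e
}.

(** The Calderon space, in the form suited to a couple with T continuously contained in S: the sum
    norm is then equivalent to S, so that [reg] already contains the continuity on Re z = 0 and only
    the continuity for T on Re z = 1 has to be added. *)
Record cal (W : lmodType C) (S T : W -> R -> Prop) (f : C -> W) (M : R) : Prop := {
  cal_reg : reg S f;
  cal_l : forall t, S (f (pt 0 t)) M;
  cal_r : forall t, T (f (pt 1 t)) M;
  cal_rc : forall t e, 0 < e -> exists2 d : R, 0 < d &
    forall s, `|s - t| < d -> T (f (pt 1 s) - f (pt 1 t)) e
}.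

Lemma inOS z : inO z -> inS z.
Proof. by move=> /andP[h1 h2]; rewrite /inS !ltW. Qed.

Lemma inO_nbhs z : inO z -> exists2 d : R, 0 < d & forall h, nc h < d -> inO (z + h).
Proof.
move=> /andP[h1 h2]; exists (Num.min (complex.Re z) (1 - complex.Re z)).
  by rewrite lt_min h1 subr_gt0.
move=> h; rewrite lt_min => /andP[k1 k2].
have := Re_nc h; rewrite ler_norml /inO; case: z h h1 h2 k1 k2 => a b [x y] /=.
by move=> ? ? ? ? /andP[? ?]; apply/andP; split; lra.
Qed.

Section Theory.
Variables (W : lmodType C) (S : W -> R -> Prop).
Hypothesis hS : normpred S.

Lemma npN x c : S x c -> S (- x) c.
Proof. by move=> /(npZ hS (-1)); rewrite ncN nc1 mul1r scaleN1r. Qed.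

Lemma npB x y c d : S x c -> S y d -> S (x - y) (c + d).
Proof. by move=> hx hy; apply: npD => //; apply: npN. Qed.

Lemma reg_der f z : reg S f -> inO z -> exists l, (exists K, S l K) /\
  forall e, 0 < e -> exists2 d : R, 0 < d &
    forall h, h != 0 -> nc h < d -> S (h^-1 *: (f (z + h) - f z) - l) e.
Proof.
move=> rf hz; have [l hl] := reg_an rf hz; exists l; split=> //.
have [d d0 hd] := hl 1 ltr01; have [d' d'0 hd'] := inO_nbhs hz.
have [K hK] := reg_bdd rf.
pose h : C := ((Num.min d d' / 2)%:C)%C.
have m0 : 0 < Num.min d d' by rewrite lt_min d0.
have nh : nc h = Num.min d d' / 2 by rewrite nc_real gtr0_norm// divr_gt0.
have h0 : h != 0 by rewrite -nc_gt0 nh divr_gt0.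
have hm : nc h < Num.min d d' by rewrite nh; lra.
move: (hm); rewrite lt_min => /andP[h1 h2].
have k1 := npZ hS h^-1 (npB (hK _ (inOS (hd' _ h2))) (hK _ (inOS hz))).
have k2 := npB k1 (hd _ h0 h1); rewrite subKr in k2.
by exists (nc h^-1 * (K + K) + 1).
Qed.

Lemma regD f g : reg S f -> reg S g -> reg S (fun z => f z + g z).
Proof.
move=> rf rg; split.
- have [K hK] := reg_bdd rf; have [L hL] := reg_bdd rg; exists (K + L) => z sz.
  by apply: npD; [exact: hS|exact: hK|exact: hL].
- move=> z sz e e0; have e2 : 0 < e / 2 by lra.
  have [d1 d10 h1] := reg_cont rf sz e2; have [d2 d20 h2] := reg_cont rg sz e2.
  exists (Num.min d1 d2) => [|w sw]; first by rewrite lt_min d10.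
  rewrite lt_min => /andP[k1 k2]; rewrite opprD addrACA [e]splitr.
  exact: (npD hS (h1 _ sw k1) (h2 _ sw k2)).
- move=> z oz; have [l hl] := reg_an rf oz; have [m hm] := reg_an rg oz.
  exists (l + m) => e e0; have e2 : 0 < e / 2 by lra.
  have [d1 d10 h1] := hl _ e2; have [d2 d20 h2] := hm _ e2.
  exists (Num.min d1 d2) => [|h hn0]; first by rewrite lt_min d10.
  rewrite lt_min => /andP[k1 k2].
  rewrite opprD addrACA scalerDr opprD addrACA [e]splitr.
  exact: (npD hS (h1 _ hn0 k1) (h2 _ hn0 k2)).
Qed.

Lemma reg_flip f : reg S f -> reg S (fun z => f (1 - z)).
Proof.
move=> rf.
have fS z : inS z -> inS (1 - z).
  by case: z => a b /andP[/= ? ?]; apply/andP; split=> /=; lra.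
split.
- by have [K hK] := reg_bdd rf; exists K => z /fS; apply: hK.
- move=> z /fS sz e e0; have [d d0 h] := reg_cont rf sz e0; exists d => // w /fS sw wz.
  by apply: h => //; rewrite opprB addrC addrA subrK -nc_distC.
- move=> z oz; have oz' : inO (1 - z).
    by move: oz; case: z => a b /andP[/= ? ?]; apply/andP; split=> /=; lra.
  have [l hl] := reg_an rf oz'; exists (- l) => e e0; have [d d0 h] := hl e e0.
  exists d => // k k0 kd; have := h (- k); rewrite oppr_eq0 ncN => /(_ k0 kd) /npN.
  by rewrite invrN scaleNr !opprD !opprK addrA.
Qed.

End Theory.

Lemma reg_bil (W1 W2 W3 : lmodType C) (S1 : W1 -> R -> Prop) (S2 : W2 -> R -> Prop)
    (S3 : W3 -> R -> Prop) (B : W1 -> W2 -> W3) (k : R) :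
  normpred S1 -> normpred S2 -> normpred S3 ->
  (forall x x' y, B (x + x') y = B x y + B x' y) ->
  (forall x y y', B x (y + y') = B x y + B x y') ->
  (forall (a : C) x y, B (a *: x) y = a *: B x y) ->
  (forall (a : C) x y, B x (a *: y) = a *: B x y) ->
  0 <= k -> (forall x y c d, S1 x c -> S2 y d -> S3 (B x y) (k * c * d)) ->
  forall f g, reg S1 f -> reg S2 g -> reg S3 (fun z => B (f z) (g z)).
Proof.
move=> h1 h2 h3 Bl Br Zl Zr k0 hB f g rf rg.
have BlB x x' y : B (x - x') y = B x y - B x' y by rewrite Bl -scaleN1r Zl scaleN1r.
have BrB x y y' : B x (y - y') = B x y - B x y' by rewrite Br -scaleN1r Zr scaleN1r.
have [K0 hK0] := reg_bdd rf; have [L0 hL0] := reg_bdd rg.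
pose K := Num.max K0 0; pose L := Num.max L0 0.
have K0' : 0 <= K by rewrite le_max lexx orbT.
have L0' : 0 <= L by rewrite le_max lexx orbT.
have hK z : inS z -> S1 (f z) K by move=> /hK0; apply: (np_le h1); rewrite le_max lexx.
have hL z : inS z -> S2 (g z) L by move=> /hL0; apply: (np_le h2); rewrite le_max lexx.
have small (c e : R) : 0 <= c -> 0 < e -> exists2 d : R, 0 < d & c * d <= e.
  move=> c0 e0; have c1 : 0 < c + 1 by lra.
  exists (e / (c + 1)); first exact: divr_gt0.
  by rewrite mulrCA ler_piMr ?ltW// ltr_pdivrMr// mul1r; lra.
split.
- by exists (k * K * L) => z sz; apply: hB; [exact: hK|exact: hL].
- move=> z sz e e0; have e2 : 0 < e / 2 by lra.
  have kL : 0 <= k * L by rewrite mulr_ge0.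
  have kK : 0 <= k * K by rewrite mulr_ge0.
  have [e1 e10 he1] := small _ _ kL e2; have [e3 e30 he3] := small _ _ kK e2.
  have [d1 d10 hd1] := reg_cont rf sz e10; have [d2 d20 hd2] := reg_cont rg sz e30.
  exists (Num.min d1 d2) => [|w sw]; first by rewrite lt_min d10.
  rewrite lt_min => /andP[k1 k2].
  have := npD h3 (hB _ _ _ _ (hd1 _ sw k1) (hL _ sw)) (hB _ _ _ _ (hK _ sz) (hd2 _ sw k2)).
  rewrite BlB BrB addrA subrK; apply: (np_le h3).
  by rewrite mulrAC; lra.
- move=> z oz; have [l [[A hA] hl]] := reg_der h1 rf oz.
  have [m [_ hm]] := reg_der h2 rg oz.
  have A0 := np_ge0 h1 hA.
  exists (B l (g z) + B (f z) m) => e e0; have e3 : 0 < e / 3 by lra.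
  have kL : 0 <= k * L by rewrite mulr_ge0.
  have kK : 0 <= k * K by rewrite mulr_ge0.
  have kA : 0 <= k * A by rewrite mulr_ge0.
  have [e1 e10 he1] := small _ _ kL e3; have [e4 e40 he4] := small _ _ kK e3.
  have [e5 e50 he5] := small _ _ kA e3.
  have [d1 d10 hd1] := hl _ e10; have [d2 d20 hd2] := hm _ e40.
  have [d3 d30 hd3] := reg_cont rg (inOS oz) e50.
  have [d4 d40 hd4] := inO_nbhs oz.
  exists (Num.min (Num.min d1 d2) (Num.min d3 d4)) => [|h hn0].
    by rewrite !lt_min d10 d20 d30.
  rewrite !lt_min => /andP[/andP[k1 k2] /andP[k3 k4]].
  have szh := inOS (hd4 _ k4).
  have kz : nc (z + h - z) < d3 by rewrite addrAC subrr add0r.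
  (* The product rule in three terms: the error of the quotient of f against g (z + h), the
     derivative of f against g (z + h) - g z, and f z against the error of the quotient of g. *)
  have := npD h3 (npD h3 (hB _ _ _ _ (hd1 _ hn0 k1) (hL _ szh))
     (hB _ _ _ _ hA (hd3 _ szh kz))) (hB _ _ _ _ (hK _ (inOS oz)) (hd2 _ hn0 k2)).
  rewrite BlB !BrB Zl Zr BlB BrB.
  have -> (a b d l1 l2 m1 : W3) : h^-1 *: (a - b) - l1 + (l1 - l2) + (h^-1 *: (b - d) - m1) =
      h^-1 *: (a - d) - (l2 + m1).
    rewrite !scalerBr; move: (h^-1 *: a) (h^-1 *: b) (h^-1 *: d) => a' b' d'.
    rewrite (_ : a' - b' - l1 + (l1 - l2) = a' - b' - l2); last by rewrite addrA subrK.
    rewrite addrAC addrA addrA subrK.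
    by rewrite opprD addrA addrAC.
  apply: (np_le h3).
  have q1 : k * e1 * L <= e / 3 by rewrite mulrAC.
  lra.
Qed.

Lemma normpred_nc : normpred (fun (x : C^o) c => nc x <= c).
Proof.
split.
- by move=> x c; apply: le_trans (nc_ge0 _).
- by move=> x c d cd /le_trans; apply.
- by move=> c; rewrite nc0.
- by move=> x y c d hx hy; apply: le_trans (ncD _ _) (lerD hx hy).
- by move=> x c a hx; rewrite ncM ler_wpM2l ?nc_ge0.
Qed.

Notation S_C := (fun (x : C^o) (c : R) => nc x <= c).

Lemma cdiff_cont (f : C -> C) z : cdiff f z -> forall e, 0 < e -> exists2 d : R, 0 < d &
  forall w, nc (w - z) < d -> nc (f w - f z) <= e.
Proof.
move=> [l hl] e e0; have [d d0 hd] := hl 1 ltr01.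
have l1 : 0 < nc l + 1 by rewrite ltr_wpDl ?nc_ge0.
exists (Num.min d (e / (nc l + 1))) => [|w]; first by rewrite lt_min d0 divr_gt0.
rewrite lt_min => /andP[k1]; rewrite ltr_pdivlMr// => k2.
have := hd _ k1; rewrite (addrC z) subrK => k3.
rewrite -[f w - f z](subrK (l * (w - z))); apply: le_trans (ncD _ _) _; rewrite ncM.
lra.
Qed.

Lemma reg_cdiff (f : C -> C) K : (forall z, inS z -> nc (f z) <= K) ->
  (forall z, inS z -> cdiff f z) -> reg S_C f.
Proof.
move=> fK fd; split; first by exists K.
- move=> z /fd/cdiff_cont h e /h[d d0 hd]; exists d => // w _; exact: hd.
- move=> z /inOS/fd[l hl]; exists l => e e0; have [d d0 hd] := hl e e0.
  exists d => // h h0 /hd k; have nh : 0 < nc h by rewrite nc_gt0.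
  rewrite (_ : _ - l = h^-1 * (f (z + h) - f z - l * h)); last first.
    by rewrite /GRing.scale/=; field.
  by rewrite ncM ncV ler_pdivrMl// [nc h * e]mulrC.
Qed.

Lemma cdiff_reg (f : C -> C) z : reg S_C f -> inO z -> cdiff f z.
Proof.
move=> rf oz; have [l hl] := reg_an rf oz; exists l => e e0.
have [d d0 hd] := hl e e0; exists d => // h kh.
have [->|h0] := eqVneq h 0; first by rewrite addr0 subrr mulr0 subrr nc0 mulr0.
have nh : 0 < nc h by rewrite nc_gt0.
have := hd h h0 kh; rewrite /GRing.scale/= => k.
rewrite (_ : _ - _ = h * (h^-1 * (f (z + h) - f z) - l)); last first.
  by field.
by rewrite ncM mulrC ler_wpM2r ?nc_ge0.
Qed.

(** * Interpolation of the couple (S_oo, S_1) *)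

Section SchattenCouple.
Local Notation imx := (nat -> nat -> C).
Implicit Types (I J G H : finType).

(* A name for the module of matrices over imx, without which unification unfolds
   the nested pointwise instances. *)
Definition MM I : lmodType C := I -> I -> imx.
Definition SIm I (x : MM I) c := SI (x : I -> I -> imx) c.
Definition SOm I (x : MM I) c := SO (x : I -> I -> imx) c.
Local Notation calM I := (cal (@SIm I) (@SOm I)).

Lemma MMD I (x y : MM I) : x + y = (x : I -> I -> imx) + (y : I -> I -> imx).
Proof. reflexivity. Qed.

Lemma MMZ I (a : C) (x : MM I) : a *: x = a *: (x : I -> I -> imx).
Proof. reflexivity. Qed.

Lemma MMDE I (x y : MM I) i j k l : (x + y) i j k l = x i j k l + y i j k l.
Proof. reflexivity. Qed.

Lemma MMZE I (a : C) (x : MM I) i j k l : (a *: x) i j k l = a * x i j k l.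
Proof. reflexivity. Qed.

Lemma MMP I (x y : MM I) : (forall i j k l, x i j k l = y i j k l) -> x = y.
Proof.
move=> h; apply/funext => i; apply/funext => j; apply/funext => k; apply/funext => l.
exact: h.
Qed.

Lemma SImD I (x y : MM I) c d : SIm x c -> SIm y d -> SIm (x + y) (c + d).
Proof. rewrite /SIm MMD; exact: SID. Qed.

Lemma SOmD I (x y : MM I) c d : SOm x c -> SOm y d -> SOm (x + y) (c + d).
Proof. rewrite /SOm MMD; exact: SOD. Qed.

Lemma SImZ I (x : MM I) c (a : C) : SIm x c -> SIm (a *: x) (nc a * c).
Proof. rewrite /SIm MMZ; exact: SIZ. Qed.

Lemma SOmZ I (x : MM I) c (a : C) : SOm x c -> SOm (a *: x) (nc a * c).
Proof. rewrite /SOm MMZ; exact: SOZ. Qed.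

Lemma normpred_SI I : normpred (@SIm I).
Proof.
split.
- by move=> x c; exact: SI_ge0.
- by move=> x c d; exact: SI_le.
- by move=> c; exact: SI0.
- by move=> x y c d; exact: SImD.
- by move=> x c a; exact: SImZ.
Qed.

Lemma normpred_SO I : normpred (@SOm I).
Proof.
split.
- by move=> x c; exact: SO_ge0.
- by move=> x c d; exact: SO_le.
- by move=> c; exact: SO0.
- by move=> x y c d; exact: SOmD.
- by move=> x c a; exact: SOmZ.
Qed.

(** Level I of (S_oo, S_1)_th, which is S_p for p = 1 / th. *)
Definition SP (th : R) I (x : MM I) c := exists2 f : C -> MM I, calM I f c & f (pt th 0) = x.

Lemma cal_ge0 I (f : C -> MM I) c : calM I f c -> 0 <= c.
Proof. by case=> _ /(_ 0)/SI_ge0. Qed.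

Lemma cal_bound I (f : C -> MM I) c d : calM I f c -> (forall t, SIm (f (pt 0 t)) d) ->
  (forall t, SOm (f (pt 1 t)) d) -> calM I f d.
Proof. by case=> h1 h2 h3 h4 h5 h6; split. Qed.

Lemma calD I (f g : C -> MM I) c d : calM I f c -> calM I g d -> calM I (fun z => f z + g z) (c + d).
Proof.
move=> [f1 f2 f3 f4] [g1 g2 g3 g4]; split.
- exact (regD (normpred_SI I) f1 g1).
- by move=> t; apply: SImD.
- by move=> t; apply: SOmD.
- move=> t e e0; have e2 : 0 < e / 2 by lra.
  have [d1 d10 h1] := f4 t _ e2; have [d2 d20 h2] := g4 t _ e2.
  exists (Num.min d1 d2) => [|s]; first by rewrite lt_min d10.
  rewrite lt_min => /andP[k1 k2]; rewrite opprD addrACA [e]splitr.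
  exact: SOmD (h1 _ k1) (h2 _ k2).
Qed.

Lemma cal_bil I J H (B : MM I -> MM J -> MM H) :
  (forall x x' y, B (x + x') y = B x y + B x' y) ->
  (forall x y y', B x (y + y') = B x y + B x y') ->
  (forall (a : C) x y, B (a *: x) y = a *: B x y) ->
  (forall (a : C) x y, B x (a *: y) = a *: B x y) ->
  (forall x y c d, SIm x c -> SIm y d -> SIm (B x y) (c * d)) ->
  (forall x y c d, SOm x c -> SOm y d -> SOm (B x y) (c * d)) ->
  forall (f : C -> MM I) (g : C -> MM J) c d, calM I f c -> calM J g d -> calM H (fun z => B (f z) (g z)) (c * d).
Proof.
move=> Bl Br Zl Zr hI hO f g c d [f1 f2 f3 f4] [g1 g2 g3 g4].
have BlB x x' y : B (x - x') y = B x y - B x' y by rewrite Bl -scaleN1r Zl scaleN1r.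
have BrB x y y' : B x (y - y') = B x y - B x y' by rewrite Br -scaleN1r Zr scaleN1r.
split.
- apply: (reg_bil (k := 1) (normpred_SI I) (normpred_SI J) (normpred_SI H)) f1 g1 => //.
  by move=> x y a b hx hy; rewrite mul1r; apply: hI.
- by move=> t; apply: hI.
- by move=> t; apply: hO.
- move=> t e e0; have c0 := SI_ge0 (f2 0); have d0 := SI_ge0 (g2 0).
  have k0 : 0 < 2 * (c + d + e + 1) by lra.
  have [d1 d10 h1] := f4 t _ (divr_gt0 e0 k0); have [d2 d20 h2] := g4 t _ (divr_gt0 e0 k0).
  exists (Num.min d1 d2) => [|s]; first by rewrite lt_min d10.
  rewrite lt_min => /andP[k1 k2].
  have := SOmD (hO _ _ _ _ (h1 _ k1) (g3 s)) (hO _ _ _ _ (f3 t) (h2 _ k2)).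
  rewrite BlB BrB addrA subrK; apply: SO_le.
  rewrite [c * _]mulrC -mulrDr mulrAC ler_pdivrMr//.
  by rewrite ler_pM2l//; lra.
Qed.

(** The scalar factor [psi] is meant for damping. The bound K stays unspecified because [cal_bound]
    reads the true bound off the boundary values afterwards. *)
Lemma cal_lin I J (L : MM I -> MM J) (psi : C -> C) (k : R) :
  (forall x x', L (x + x') = L x + L x') -> (forall (a : C) x, L (a *: x) = a *: L x) ->
  (forall x c, SIm x c -> SIm (L x) (k * c)) ->
  (forall x c, SOm x c -> SOm (L x) (k * c)) -> 0 <= k ->
  (forall z, inS z -> cdiff psi z) -> (exists K, forall z, inS z -> nc (psi z) <= K) ->
  forall (f : C -> MM I) c, calM I f c -> exists K, calM J (fun z => psi z *: L (f z)) K.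
Proof.
move=> LD LZ hI hO k0 pd [K0 hK0] f c [f1 f2 f3 f4].
pose K := Num.max K0 0; have K0' : 0 <= K by rewrite le_max lexx orbT.
have hK z : inS z -> nc (psi z) <= K by move=> /hK0 h; rewrite le_max h.
have LB x x' : L (x - x') = L x - L x' by rewrite LD -scaleN1r LZ scaleN1r.
have c0 : 0 <= c by exact: SI_ge0 (f2 0).
have s0 t : inS (pt 0 t) by rewrite /inS /= lexx ler01.
have s1 t : inS (pt 1 t) by rewrite /inS /= lexx ler01.
exists (K * (k * c)); split.
- apply: (reg_bil (S1 := S_C) (B := fun a x => a *: L x) (k := k) normpred_nc
    (normpred_SI I) (normpred_SI J)) (reg_cdiff hK pd) f1 => //.
  + by move=> x x' y; rewrite scalerDl.
  + by move=> x y y'; rewrite LD scalerDr.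
  + by move=> a x y; rewrite scalerA.
  + by move=> a x y; rewrite LZ scale_swap.
  + move=> a x u v hu hx; rewrite mulrAC mulrC; apply: SI_le (SImZ a (hI _ _ hx)).
    by rewrite ler_wpM2r// mulr_ge0// (SI_ge0 hx).
- move=> t; apply: SI_le (SImZ _ (hI _ _ (f2 t))).
  by rewrite ler_wpM2r ?mulr_ge0 ?hK.
- move=> t; apply: SO_le (SOmZ _ (hO _ _ (f3 t))).
  by rewrite ler_wpM2r ?mulr_ge0 ?hK.
- move=> t e e0.
  have m0 : 0 < 2 * (K * k + k * c + 1) by rewrite mulr_gt0// ltr_wpDl// addr_ge0// mulr_ge0.
  have e1 := divr_gt0 e0 m0.
  have [d1 d10 h1] := f4 t _ e1; have [d2 d20 h2] := cdiff_cont (pd _ (s1 t)) e1.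
  exists (Num.min d1 d2) => [|s]; first by rewrite lt_min d10.
  rewrite lt_min => /andP[k1 k2].
  have nps : nc (pt 1 s - pt 1 t) < d2.
    by rewrite /= subrr expr0n/= add0r sqrtr_sqr.
  have := SOmD (SOmZ (psi (pt 1 s)) (hO _ _ (h1 _ k1)))
    (SOmZ (psi (pt 1 s) - psi (pt 1 t)) (hO _ _ (f3 t))).
  rewrite LB scalerBr scalerBl addrA subrK; apply: SO_le.
  set e' := e / _ in e1 h1 h2 *.
  have q1 : nc (psi (pt 1 s)) * (k * e') <= K * k * e'.
    by rewrite mulrA ler_wpM2r ?(ltW e1)// ler_wpM2r// hK.
  have q2 : nc (psi (pt 1 s) - psi (pt 1 t)) * (k * c) <= k * c * e'.
    by rewrite mulrC ler_wpM2l ?mulr_ge0// h2.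
  apply: le_trans (lerD q1 q2) _; rewrite -mulrDl /e' mulrA ler_pdivrMr// mulrC ler_pM2l//.
  have : 0 <= K * k + k * c by rewrite addr_ge0// mulr_ge0.
  lra.
Qed.

Lemma cal_lin1 I J (L : MM I -> MM J) (k : R) :
  (forall x x', L (x + x') = L x + L x') -> (forall (a : C) x, L (a *: x) = a *: L x) ->
  (forall x c, SIm x c -> SIm (L x) (k * c)) ->
  (forall x c, SOm x c -> SOm (L x) (k * c)) -> 0 <= k ->
  forall (f : C -> MM I) c, calM I f c -> calM J (fun z => L (f z)) (k * c).
Proof.
move=> LD LZ hI hO k0 f c hf.
have [|K hK] := cal_lin (psi := fun=> 1) LD LZ hI hO k0 (fun z _ => cdiff_cst 1 z) _ hf.
  by exists 1 => z _; rewrite nc1.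
have e : (fun z => 1 *: L (f z)) = (fun z => L (f z)).
  by apply/funext => z; rewrite scale1r.
by rewrite e in hK; apply: cal_bound hK _ _ => t; [apply/hI/(cal_l hf)|apply/hO/(cal_r hf)].
Qed.

Lemma SP_ge0 th I (x : MM I) c : SP th x c -> 0 <= c.
Proof. by move=> [f /cal_ge0]. Qed.

Lemma SP_le th I (x : MM I) c d : c <= d -> SP th x c -> SP th x d.
Proof.
move=> cd [f hf fx]; exists f => //; apply: cal_bound (hf) _ _ => t.
  exact: SI_le cd (cal_l hf t).
exact: SO_le cd (cal_r hf t).
Qed.

Lemma SP_lin th I J (L : MM I -> MM J) (k : R) :
  (forall x x', L (x + x') = L x + L x') -> (forall (a : C) x, L (a *: x) = a *: L x) ->
  (forall x c, SIm x c -> SIm (L x) (k * c)) ->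
  (forall x c, SOm x c -> SOm (L x) (k * c)) -> 0 <= k ->
  forall x c, SP th x c -> SP th (L x) (k * c).
Proof.
move=> LD LZ hI hO k0 x c [f hf fx]; exists (fun z => L (f z)); first exact: cal_lin1.
by rewrite fx.
Qed.

Lemma SPZ th I (x : MM I) c (a : C) : SP th x c -> SP th (a *: x) (nc a * c).
Proof.
apply: SP_lin => [x0 x'|b x0|x0 c0|x0 c0|]; [exact: scalerDr|exact: scale_swap|
 exact: SImZ|exact: SOmZ|exact: nc_ge0].
Qed.

Lemma SP_csc th I (x : MM I) (p : nat -> C) c : (forall k, nc (p k) <= 1) ->
  SP th x c -> SP th (fun i j => csc p (x i j)) c.
Proof.
move=> p1; rewrite -{2}[c]mul1r.
apply: (SP_lin (L := fun x i j => csc p (x i j))) => [x0 x'|b x0|x0 c0|x0 c0|] //.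
- by apply: MMP => i j k l; exact: mulrDl.
- by apply: MMP => i j k l; exact/esym/mulrA.
- by rewrite mul1r; apply: SI_csc.
- by rewrite mul1r; apply: SO_csc.
Qed.

Lemma SP_dsum th I J (x : MM I) (y : MM J) c :
  SP th x c -> SP th y c -> SP th (dsum x y) c.
Proof.
move=> [f hf fx] [g hg gy]; exists (fun z => dsum (f z) (g z)); last by rewrite fx gy.
have h1 : calM (I + J)%type (fun z => dsum (f z) 0) (1 * c).
  apply: (cal_lin1 (L := fun x => dsum x (0 : J -> J -> imx))) hf => [x0 x'|b x0|x0 c0|x0 c0|] //.
  - apply: MMP => -[i|i] [j|j] k l; rewrite MMDE //=; exact/esym/addr0.
  - apply: MMP => -[i|i] [j|j] k l; rewrite MMZE //=; exact/esym/mulr0.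
  - by rewrite mul1r => h; apply: SI_dsum h (SI0 _ (SI_ge0 h)).
  - by rewrite mul1r => h; apply: SO_dsum h (SO0 _ (SO_ge0 h)).
have h2 : calM (I + J)%type (fun z => dsum 0 (g z)) (1 * c).
  apply: (cal_lin1 (L := fun x => dsum (0 : I -> I -> imx) x)) hg => [x0 x'|b x0|x0 c0|x0 c0|] //.
  - apply: MMP => -[i|i] [j|j] k l; rewrite MMDE //=; exact/esym/addr0.
  - apply: MMP => -[i|i] [j|j] k l; rewrite MMZE //=; exact/esym/mulr0.
  - by rewrite mul1r => h; apply: SI_dsum (SI0 _ (SI_ge0 h)) h.
  - by rewrite mul1r => h; apply: SO_dsum (SO0 _ (SO_ge0 h)) h.
have := calD h1 h2.
have -> : (fun z => dsum (f z) 0 + dsum 0 (g z)) = (fun z => dsum (f z) (g z)).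
  apply/funext => z; apply: MMP => -[i|i] [j|j] k l; rewrite MMDE /=;
  [exact: addr0|exact: addr0|exact: addr0|exact: add0r].
(* The sum of the two functions comes with the bound c + c; its boundary values are direct sums,
   which restores c. *)
move=> h; apply: cal_bound h _ _ => t.
  exact: SI_dsum (cal_l hf t) (cal_l hg t).
exact: SO_dsum (cal_r hf t) (cal_r hg t).
Qed.

Lemma SP_bil th I J H (B : MM I -> MM J -> MM H) :
  (forall x x' y, B (x + x') y = B x y + B x' y) ->
  (forall x y y', B x (y + y') = B x y + B x y') ->
  (forall (a : C) x y, B (a *: x) y = a *: B x y) ->
  (forall (a : C) x y, B x (a *: y) = a *: B x y) ->
  (forall x y c d, SIm x c -> SIm y d -> SIm (B x y) (c * d)) ->
  (forall x y c d, SOm x c -> SOm y d -> SOm (B x y) (c * d)) ->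
  forall x y c d, SP th x c -> SP th y d -> SP th (B x y) (c * d).
Proof.
move=> B1 B2 B3 B4 B5 B6 x y c d [f hf fx] [g hg gy].
by exists (fun z => B (f z) (g z)); [exact: cal_bil|rewrite fx gy].
Qed.

Lemma SP_sch th I J (x : MM I) (y : MM J) c d :
  SP th x c -> SP th y d -> SP th (amp sch x y) (c * d).
Proof.
apply: SP_bil => [x0 x' y0|x0 y0 y'|a x0 y0|a x0 y0|*|*].
- by apply: MMP => i j k l; exact: mulrDl.
- by apply: MMP => i j k l; exact: mulrDr.
- by apply: MMP => i j k l; exact/esym/mulrA.
- by apply: MMP => i j k l; exact: mulrCA.
- exact: SI_sch.
- exact: SO_sch.
Qed.

Lemma SP_prod th I J (x : MM I) (y : MM J) (p : nat -> C) (N : nat) c d :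
  (forall k, nc (p k) <= 1) ->
  SP th x c -> SP th y d -> SP th (amp (prodK N p) x y) (c * d).
Proof.
move=> p1; apply: SP_bil => [x0 x' y0|x0 y0 y'|a x0 y0|a x0 y0|*|*].
- apply: MMP => i j k l; rewrite MMDE /amp /prodK -big_split/=.
  by apply: eq_bigr => n _; rewrite MMDE !mulrDl.
- apply: MMP => i j k l; rewrite MMDE /amp /prodK -big_split/=.
  by apply: eq_bigr => n _; rewrite MMDE mulrDr.
- apply: MMP => i j k l; rewrite MMZE /amp /prodK mulr_sumr.
  by apply: eq_bigr => n _; rewrite MMZE -!mulrA.
- apply: MMP => i j k l; rewrite MMZE /amp /prodK mulr_sumr.
  by apply: eq_bigr => n _; rewrite MMZE mulrCA.
- exact: SI_prod.
- exact: SO_prod.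
Qed.

End SchattenCouple.
End CalderonFunctions.

(** * Duality and vanishing tails in the interpolation spaces *)

Section InterpolatedSpaces.
Variable R : realType.
Local Notation nc := (@ComplexField.Normc.normc R).
Local Notation C := (R[i]).
Local Notation pt x y := (@Complex R x y).
Local Notation S_C := (fun (x : C^o) (c : R) => nc x <= c).
Implicit Types (I J G H : finType) (c d e th t : R).

(** Fixing the test matrix Y and the vectors [eta], [xi] makes the claim scalar. The second function
    is reflected by z -> 1 - z, so on each boundary line one factor is bounded and the other trace
    class, where [SO_bnd_sch] and [SO_sch_bnd] apply. *)
Lemma SP_dual th I J (x : MM R I) (y : MM R J) c d : 0 < th < 1 ->
  SP th x c -> SP (1 - th) y d -> SO (amp sch x y) (c * d).
Proof.
move=> th01 [f hf fx] [g hg gy].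
have c0 := cal_ge0 hf; have d0 := cal_ge0 hg.
split=> [|G H K L Y hY]; first exact: mulr_ge0.
apply/opb_dual => [|xi eta]; first exact: mulr_ge0.
pose Phi (x : MM R I) (y : MM R J) : C^o :=
  \sum_r \sum_s eta r * pairm K L (amp sch x y) Y r s * xi s.
have PhiE (a : MM R I) (b : MM R J) : Phi a b = \sum_r \sum_s \sum_(k < K) \sum_(l < L)
   eta r * (a r.1.1 s.1.1 k l * b r.1.2 s.1.2 k l * Y r.2 s.2 k l) * xi s.
  apply: eq_bigr => r _; apply: eq_bigr => s _; rewrite /pairm mulr_sumr mulr_suml.
  by apply: eq_bigr => k _; rewrite mulr_sumr mulr_suml.
pose kap : R := \sum_(r : (I * J) * G) \sum_(s : (I * J) * H) \sum_(k < K) \sum_(l < L)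
   nc (eta r) * nc (Y r.2 s.2 k l) * nc (xi s).
have kap0 : 0 <= kap.
  by do 4!(apply: sumr_ge0 => ? _); rewrite !mulr_ge0 ?nc_ge0.
have rPhi : reg S_C (fun z => Phi (f z) (g (1 - z))).
  apply: (reg_bil (B := Phi) (k := kap) (normpred_SI R I) (normpred_SI R J)
    (normpred_nc R) _ _ _ _ kap0 _ (cal_reg hf) (reg_flip (normpred_SI R J) (cal_reg hg))).
  - move=> a a' b; rewrite !PhiE; do 4!(rewrite -big_split/=; apply: eq_bigr => ? _).
    by rewrite MMDE; ring.
  - move=> a b b'; rewrite !PhiE; do 4!(rewrite -big_split/=; apply: eq_bigr => ? _).
    by rewrite MMDE; ring.
  - move=> k a b; rewrite !PhiE [RHS]/GRing.scale/=; do 4!(rewrite mulr_sumr; apply: eq_bigr => ? _).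
    by rewrite MMZE; ring.
  - move=> k a b; rewrite !PhiE [RHS]/GRing.scale/=; do 4!(rewrite mulr_sumr; apply: eq_bigr => ? _).
    by rewrite MMZE; ring.
  move=> a b u v ha hb; rewrite PhiE /kap -mulrA.
  rewrite mulr_suml; apply: le_trans (nc_sum _ _ _) _; apply: ler_sum => r _.
  rewrite mulr_suml; apply: le_trans (nc_sum _ _ _) _; apply: ler_sum => s _.
  rewrite mulr_suml; apply: le_trans (nc_sum _ _ _) _; apply: ler_sum => k _.
  rewrite mulr_suml; apply: le_trans (nc_sum _ _ _) _; apply: ler_sum => l _.
  rewrite !ncM [leLHS](_ : _ = nc (eta r) * nc (Y r.2 s.2 k l) * nc (xi s) *
    (nc (a r.1.1 s.1.1 k l) * nc (b r.1.2 s.1.2 k l))); last by ring.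
  rewrite ler_wpM2l ?mulr_ge0 ?nc_ge0//.
  by rewrite ler_pM ?nc_ge0 ?(SI_entry _ _ _ _ ha) ?(SI_entry _ _ _ _ hb).
pose M := c * d * nrm eta * nrm xi.
have bnd0 (a : MM R I) (b : MM R J) : SO (amp sch a b) (c * d) -> nc (Phi a b) <= M.
  move=> [_ /(_ _ _ _ _ _ hY)] h; have := opb_ge0 h => cd0.
  by move/opb_dual: h => /(_ cd0 xi eta).
have e0 t : 1 - pt 0 t = pt 1 (- t).
  by apply/eqP; rewrite eq_complex /= subr0 sub0r !eqxx.
have e1 t : 1 - pt 1 t = pt 0 (- t).
  by apply/eqP; rewrite eq_complex /= subrr sub0r !eqxx.
have eth : 1 - pt th 0 = pt (1 - th) 0.
  by apply/eqP; rewrite eq_complex /= subr0 !eqxx.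
have -> : \sum_i \sum_j eta i * pairm K L (amp sch x y) Y i j * xi j =
   (fun z => Phi (f z) (g (1 - z))) (pt th 0) by rewrite eth fx gy.
have [B hB] := reg_bdd rPhi.
apply: (@strip_max _ (fun z => Phi (f z) (g (1 - z))) th B M th01).
- by move=> z hz; apply: hB.
- by move=> z hz e e_0; apply: (reg_cont rPhi).
- by move=> z hz; apply: cdiff_reg rPhi hz.
- move=> t; rewrite e0; apply: bnd0.
  have [_ hb] := cal_l hf t; exact: SO_bnd_sch hb (cal_r hg (- t)).
- move=> t; rewrite e1; apply: bnd0.
  have [_ hb] := cal_l hg (- t); exact: SO_sch_bnd (cal_r hf t) hb.
Qed.

Lemma expr_small (r c e : R) : 0 < r < 1 -> 0 < e -> exists n, r ^+ n * c <= e.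
Proof.
move=> /andP[r0 r1] e0; apply: contrapT => /forallNP h.
have : r^-1 <= 1.
  apply: (@expn_bounded _ _ (c / e)) => n; rewrite ler_pdivlMr// mulrC exprVn.
  rewrite ler_pdivrMr ?exprn_gt0// mulrC; apply: ltW; rewrite ltNge; exact/negP/h.
by rewrite invf_le1// leNgt r1.
Qed.

Lemma nc_ind (b : bool) : nc b%:R <= 1.
Proof. by case: b; rewrite ?nc1 ?nc0. Qed.

Definition tailc (N : nat) I (x : MM R I) : MM R I :=
  fun i j => csc (fun k => (N <= k)%:R) (x i j).

Lemma tailcD N I (x y : MM R I) : tailc N (x + y) = tailc N x + tailc N y.
Proof. by apply: MMP => i j k l; exact: mulrDl. Qed.

Lemma tailcZ N I (a : C) (x : MM R I) : tailc N (a *: x) = a *: tailc N x.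
Proof. by apply: MMP => i j k l; exact/esym/mulrA. Qed.

(* Since the boundary values on Re z = 0 are compact, multiplying by a power of
   (th + 1) / (z + 1), which decays at infinity and is small on Re z = 1, makes
   the tails small on both boundary lines. *)
Lemma SP_tail th I (x : MM R I) c : 0 < th < 1 -> SP th x c -> forall e, 0 < e ->
  exists N0, forall N, (N0 <= N)%N -> SP th (tailc N x) e.
Proof.
move=> /andP[th0 th1] [f hf fx] e e0.
have c0 := cal_ge0 hf.
(* On Re z = 1 the factor (th + 1) / (z + 1) has modulus at most r < 1, so a high power outweighs
   c. *)
pose r : R := (th + 1) / 2.
have [n0 hn0] : exists n, r ^+ n * c <= e.
  by apply: expr_small => //; apply/andP; split; rewrite /r; lra.
(* The successor guarantees at least one factor, so that the multiplier decays along Re z = 0 even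
   when n0 = 0. *)
pose n := n0.+1.
have hn : r ^+ n * c <= e.
  apply: le_trans hn0; rewrite ler_wpM2r// /n exprS ler_piMl ?exprn_ge0 /r; lra.
pose psi0 (z : C) : C := (th + 1)%:C%C * (z - (-1)%:C%C)^-1.
have n1 (z : C) : inS z -> 1 <= nc (z - (-1)%:C%C) /\ 1 + complex.Re z <= nc (z - (-1)%:C%C) /\
    `|complex.Im z| <= nc (z - (-1)%:C%C).
  move=> /andP[z0 z1].
  have h1 : 1 + complex.Re z <= nc (z - (-1)%:C%C).
    by apply: le_trans (Re_nc_le _); case: z z0 z1 => a b /= ? ?; rewrite opprK addrC.
  split; first lra.
  split=> //; apply: le_trans (Im_nc _); case: z {z0 z1 h1} => a b /=.
  by rewrite oppr0 addr0.
have psi0d z : inS z -> cdiff psi0 z.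
  move=> hz; apply: cdiffM; first exact: cdiff_cst.
  apply: cdiffV; rewrite -subr_eq0 -nc_gt0; have [h _] := n1 _ hz; lra.
have npsi z : nc (psi0 z) = (th + 1) / nc (z - (-1)%:C%C).
  by rewrite /psi0 ncM ncV nc_real gtr0_norm//; lra.
have psi2 z : inS z -> nc (psi0 z) <= 2.
  move=> hz; rewrite npsi; have [h _] := n1 _ hz.
  rewrite ler_pdivrMr; last lra.
  lra.
pose psi z := psi0 z ^+ n.
have psid z : inS z -> cdiff psi z by move=> hz; apply/cdiffX/psi0d.
have psib z : inS z -> nc (psi z) <= 2 ^+ n.
  by move=> hz; rewrite ncX lerXn2r ?nnegrE ?nc_ge0 ?psi2.
have psith : psi (pt th 0) = 1.
  rewrite /psi /psi0 (_ : pt th 0 - (-1)%:C%C = (th + 1)%:C%C); last first.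
    by apply/eqP; rewrite eq_complex /= opprK oppr0 addr0 !eqxx.
  rewrite mulfV ?expr1n// -nc_eq0 nc_real gtr0_norm ?gt_eqF//; lra.
have s0 t : inS (pt 0 t) by rewrite /inS /= lexx ler01.
have s1 t : inS (pt 1 t) by rewrite /inS /= lexx ler01.
pose e' := e / 2 ^+ n.
have p2 : 0 < (2 : R) ^+ n by rewrite exprn_gt0.
have e'0 : 0 < e' by rewrite divr_gt0.
(* For |t| > q one factor is at most 2 / q on Re z = 0 and the others at most 2, so the multiplier
   times c is at most e; for |t| <= q compactness provides a common tail index. *)
pose q : R := 2 ^+ n * c / e + 1.
have q0 : 0 < q by rewrite /q ltr_wpDl// divr_ge0 ?mulr_ge0 ?(ltW e0) ?(ltW p2).
have [N0 hN0] : exists N0, forall t, `|t| <= q -> forall N, (N0 <= N)%N ->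
    SIm (tailc N (f (pt 0 t))) e'.
  apply: (@itv_cover _ q (fun N0 t => forall N, (N0 <= N)%N -> SIm (tailc N (f (pt 0 t))) e')).
    by move=> m k t mk h N kN; apply: h; apply: leq_trans kN.
  move=> t _; have e2 : 0 < e' / 2 by lra.
  have [d d0 hd] := reg_cont (cal_reg hf) (s0 t) e2.
  have [N1 hN1] := SI_tail (cal_l hf t) e2.
  exists d => //; exists N1 => s st N N1N.
  have nst : nc (pt 0 s - pt 0 t) < d by rewrite /= subrr expr0n/= add0r sqrtr_sqr.
  have := SImD (SI_csc (fun k => nc_ind (N <= k)%N) (hd _ (s0 s) nst)) (hN1 _ N1N).
  rewrite -splitr -tailcD subrK; exact.
exists N0 => N N0N.
have tI (y : MM R I) a : SIm y a -> SIm (tailc N y) a.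
  by apply: SI_csc => k; apply: nc_ind.
have tO (y : MM R I) a : SOm y a -> SOm (tailc N y) a.
  by apply: SO_csc => k; apply: nc_ind.
have [|||||| K hK] := cal_lin (L := @tailc N I) (psi := psi) (k := 1) _ _ _ _ _ psid _ hf.
- exact: tailcD.
- exact: tailcZ.
- by move=> y a; rewrite mul1r; apply: tI.
- by move=> y a; rewrite mul1r; apply: tO.
- by [].
- by exists (2 ^+ n); apply: psib.
exists (fun z => psi z *: tailc N (f z)); last by rewrite psith scale1r fx.
apply: cal_bound hK _ _ => t.
  have [tq|qt] := leP `|t| q.
    apply: SI_le (SImZ (psi (pt 0 t)) (hN0 t tq N N0N)).
    apply: le_trans (ler_wpM2r (ltW e'0) (psib _ (s0 t))) _.
    by rewrite /e' mulrC divfK ?gt_eqF.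
  apply: SI_le (SImZ (psi (pt 0 t)) (tI _ _ (cal_l hf t))).
  have [h1 [_ h2]] := n1 _ (s0 t); rewrite /= in h2.
  have : nc (psi (pt 0 t)) <= 2 ^+ n / q.
    rewrite /psi /n exprS ncM exprS mulrAC; apply: ler_pM; rewrite ?nc_ge0//.
      rewrite npsi; apply: ler_pM; rewrite ?invr_ge0 ?nc_ge0//; try lra.
      by rewrite lef_pV2 ?posrE//; [apply: le_trans h2; exact: ltW|lra].
    by rewrite ncX lerXn2r ?nnegrE ?nc_ge0 ?psi2.
  move=> hp; apply: le_trans (ler_wpM2r c0 hp) _.
  by rewrite mulrAC ler_pdivrMr// /q mulrDr mulr1 mulrCA divff ?gt_eqF// mulr1 lerDl ltW.
apply: SO_le (SOmZ (psi (pt 1 t)) (tO _ _ (cal_r hf t))).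
apply: le_trans hn; rewrite ler_wpM2r// ncX lerXn2r ?nnegrE ?nc_ge0//; first by rewrite /r; lra.
rewrite npsi /r; have [_ [h _]] := n1 _ (s1 t).
have {}h : 2 <= nc (pt 1 t - (-1)%:C%C) by apply: le_trans h; rewrite [complex.Re _]/=; lra.
apply: ler_pM; rewrite ?invr_ge0 ?nc_ge0//; try lra.
by rewrite lef_pV2 ?posrE//; apply: lt_le_trans h.
Qed.

End InterpolatedSpaces.

(** * The projective norm and its image under the Schur product *)

Section ProjectiveNorm.
Variable R : realType.
Local Notation nc := (@ComplexField.Normc.normc R).
Local Notation C := (R[i]).
Local Notation imx := (nat -> nat -> C).
Implicit Types (I J G H A B : finType) (c d e r s : R).

Record opsp (E : forall I, (I -> I -> imx) -> R -> Prop) : Prop := {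
  os_ge0 : forall I (x : I -> I -> imx) c, E I x c -> 0 <= c;
  os_le : forall I (x : I -> I -> imx) c d, c <= d -> E I x c -> E I x d;
  osZ : forall I (x : I -> I -> imx) c (a : C), E I x c ->
    E I (fun i j k l => a * x i j k l) (nc a * c);
  os0 : forall I c, 0 <= c -> E I (fun _ _ => 0) c;
  os_dsum : forall I J (x : I -> I -> imx) (y : J -> J -> imx) c,
    E I x c -> E J y c -> E (I + J)%type (dsum x y) c
}.

Definition tensmx I J A B (u : I -> A -> C) (v : J -> B -> C) (r : I * J) (s : A * B) : C :=
  u r.1 s.1 * v r.2 s.2.

Section Generic.
Variables (E F : forall I, (I -> I -> imx) -> R -> Prop).
Hypotheses (hE : opsp E) (hF : opsp F).
(** Two instances are intended: the tensor product, which gives the projective norm itself, and the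
    Schur product, which gives its image under [psi]. *)
Variables (Z : lmodType C) (b : imx -> imx -> Z).
Hypothesis b0 : b 0 0 = 0.
Hypothesis bZl : forall (a : C) (x y : imx), b (fun k l => a * x k l) y = a *: b x y.
Hypothesis bZr : forall (a : C) (x y : imx), b x (fun k l => a * y k l) = a *: b x y.

(* The matrix X has projective norm at most r. *)
Definition Qb I (X : I -> I -> Z) r := 0 <= r /\
  exists A B (x : A -> A -> imx) (y : B -> B -> imx) (u : I -> A * B -> C)
    (v : A * B -> I -> C), [/\ opb u (Num.sqrt r), opb v (Num.sqrt r), E x 1, F y 1 &
      forall i j, X i j = mlr u (amp b x y) v i j].

Lemma Qb_ge0 I (X : I -> I -> Z) r : Qb X r -> 0 <= r.
Proof. by case. Qed.

Lemma Qb0 I r : 0 <= r -> Qb (fun _ _ : I => 0) r.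
Proof.
move=> r0; split=> //; exists unit, unit, (fun _ _ => 0), (fun _ _ => 0),
  (fun _ _ => 0), (fun _ _ => 0); split.
- exact/opb0/sqrtr_ge0.
- exact/opb0/sqrtr_ge0.
- exact: os0.
- exact: os0.
by move=> i j; rewrite /mlr big1// => k _; rewrite big1// => l _; rewrite mul0r scale0r.
Qed.

Lemma Qb_ext I (X Y : I -> I -> Z) r : (forall i j, X i j = Y i j) -> Qb X r -> Qb Y r.
Proof.
move=> XY [r0 [A [B [x [y [u [v [h1 h2 h3 h4 h5]]]]]]]]; split=> //.
by exists A, B, x, y, u, v; split=> // i j; rewrite -XY h5.
Qed.

Lemma Qb_le I (X : I -> I -> Z) r s : r <= s -> Qb X r -> Qb X s.
Proof.
move=> rs [r0 [A [B [x [y [u [v [h1 h2 h3 h4 h5]]]]]]]]; split; first exact: le_trans rs.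
have srs : Num.sqrt r <= Num.sqrt s by rewrite ler_wsqrtr.
exists A, B, x, y, u, v; split=> //; first exact: opb_le h1.
exact: opb_le h2.
Qed.

Lemma mlr_scale I J (u : I -> J -> C) (X : J -> J -> Z) (v : J -> I -> C) (p q w : C) i j :
  p * w * q = 1 ->
  mlr (fun i k => p * u i k) (fun k l => w *: X k l) (fun k j => q * v k j) i j = mlr u X v i j.
Proof.
move=> pwq; apply: eq_bigr => k _; apply: eq_bigr => l _; rewrite scalerA; congr (_ *: _).
by rewrite -[RHS]mul1r -pwq; ring.
Qed.

(** Homogeneity: the constants are redistributed so that x and y get norm 1 while u and v each get
    the square root of the product. The positivity assumptions allow the divisions. *)
Lemma Qb_intro I A B (u : I -> A * B -> C) (x : A -> A -> imx) (y : B -> B -> imx)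
    (v : A * B -> I -> C) c d e f : 0 < c -> 0 < d -> 0 < e -> 0 < f ->
  opb u c -> E x d -> F y e -> opb v f -> Qb (mlr u (amp b x y) v) (c * d * e * f).
Proof.
move=> c0 d0 e0 f0 hu hx hy hv.
have r0 : 0 < c * d * e * f by rewrite !mulr_gt0.
split; first exact: ltW.
pose t := Num.sqrt (c * d * e * f); have t0 : 0 < t by rewrite sqrtr_gt0.
have tt : t * t = c * d * e * f by rewrite -expr2 sqr_sqrtr// ltW.
exists A, B, (fun i j k l => (d^-1)%:C%C * x i j k l), (fun i j k l => (e^-1)%:C%C * y i j k l),
  (fun i k => (t / c)%:C%C * u i k), (fun k j => (t / f)%:C%C * v k j).
have nr (z : R) : 0 < z -> nc z%:C%C = z by move=> z0; rewrite nc_real gtr0_norm.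
split.
- by have := opbZ (t / c)%:C%C hu; rewrite nr ?divr_gt0// divfK ?gt_eqF.
- by have := opbZ (t / f)%:C%C hv; rewrite nr ?divr_gt0// divfK ?gt_eqF.
- by have := osZ hE (d^-1)%:C%C hx; rewrite nr ?invr_gt0// mulVf ?gt_eqF.
- by have := osZ hF (e^-1)%:C%C hy; rewrite nr ?invr_gt0// mulVf ?gt_eqF.
move=> i j.
have := @mlr_scale _ _ u (amp b x y) v (t / c)%:C%C (t / f)%:C%C ((d^-1)%:C%C * (e^-1)%:C%C) i j.
move=> <-; last first.
  rewrite -!rmorphM/= (_ : _ * _ * _ = 1) ?rmorph1//.
  have -> : t / c * (d^-1 * e^-1) * (t / f) = t * t / (c * d * e * f) by field; rewrite !gt_eqF.
  by rewrite tt divff ?gt_eqF.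
apply: eq_bigr => k _; apply: eq_bigr => l _; congr (_ *: _).
by rewrite /amp bZl bZr scalerA.
Qed.

Lemma QbZ I (X : I -> I -> Z) r (a : C) : Qb X r -> Qb (fun i j => a *: X i j) (nc a * r).
Proof.
move=> [r0 [A [B [x [y [u [v [h1 h2 h3 h4 h5]]]]]]]]; have na := nc_ge0 a.
split; first exact: mulr_ge0.
pose t := Num.sqrt (nc a); have t0 : 0 <= t by rewrite sqrtr_ge0.
have tt : t * t = nc a by rewrite -expr2 sqr_sqrtr.
exists A, B, x, y, (fun i k => t%:C%C * u i k), (fun k j => (a / t%:C%C) * v k j).
split=> //.
- by rewrite sqrtrM// -/t; have := opbZ t%:C%C h1; rewrite nc_real ger0_norm.
- rewrite sqrtrM// -/t; have := opbZ (a / t%:C%C) h2.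
  rewrite ncM ncV nc_real ger0_norm//; apply: opb_le; rewrite ler_wpM2r ?sqrtr_ge0// -tt.
  by have [->|n0] := eqVneq t 0; rewrite ?mul0r// mulfK.
move=> i j; rewrite h5 /mlr scaler_sumr; apply: eq_bigr => k _; rewrite scaler_sumr.
apply: eq_bigr => l _; rewrite scalerA; congr (_ *: _).
have [t00|n0] := eqVneq t 0.
  have a0 : a = 0 by apply/eqP; rewrite -nc_eq0 -tt t00 mul0r.
  by rewrite a0 !mul0r mulr0.
have nt : t%:C%C != 0 by rewrite -nc_eq0 nc_real normr_eq0.
by field.
Qed.

Lemma QbN I (X : I -> I -> Z) r : Qb X r -> Qb (fun i j => - X i j) r.
Proof.
move=> /(QbZ (-1)); rewrite ncN nc1 mul1r; apply: Qb_ext => i j.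
by rewrite scaleN1r.
Qed.

Lemma Qb_mlr1 I J (X : J -> J -> Z) (u : I -> J -> C) (v : J -> I -> C) r :
  opb u 1 -> opb v 1 -> Qb X r -> Qb (mlr u X v) r.
Proof.
move=> hu hv [r0 [A [B [x [y [u1 [v1 [h1 h2 h3 h4 h5]]]]]]]]; split=> //.
exists A, B, x, y, (fun i k => \sum_j u i j * u1 j k), (fun k i => \sum_j v1 k j * v j i).
split=> //.
- by rewrite -[Num.sqrt r]mul1r; exact: opb_comp hu h1.
- by rewrite -[Num.sqrt r]mulr1; exact: opb_comp h2 hv.
move=> i j; rewrite /mlr.
under eq_bigr do under eq_bigr do rewrite h5 /mlr.
transitivity (\sum_k \sum_l \sum_p \sum_q (u i k * v l j * (u1 k p * v1 q l)) *: amp b x y p q).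
  apply: eq_bigr => k _; apply: eq_bigr => l _; rewrite scaler_sumr; apply: eq_bigr => p _.
  by rewrite scaler_sumr; apply: eq_bigr => q _; rewrite scalerA.
under eq_bigr do rewrite exchange_big/=.
rewrite exchange_big/=; apply: eq_bigr => p _.
under eq_bigr do rewrite exchange_big/=.
rewrite exchange_big/=; apply: eq_bigr => q _.
rewrite [in RHS]mulr_suml scaler_suml; apply: eq_bigr => k _.
rewrite mulr_sumr scaler_suml; apply: eq_bigr => l _; congr (_ *: _); ring.
Qed.

Lemma Qb_sub I J (f g : I -> J) (X : J -> J -> Z) r : injective f -> injective g ->
  Qb X r -> Qb (fun i j => X (f i) (g j)) r.
Proof.
move=> fI gI [r0 [A [B [x [y [u1 [v1 [h1 h2 h3 h4 h5]]]]]]]]; split=> //.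
exists A, B, x, y, (fun i k => u1 (f i) k), (fun k j => v1 k (g j)); split=> //.
- exact: (opb_sub fI (@inj_id _) h1).
- exact: (opb_sub (@inj_id _) gI h2).
Qed.

(** The tensor product of two direct sums has indices of four kinds, and [blk] selects the two pure
    ones. Between these both tensor factors vanish at once, so that [b 0 0 = 0] removes the
    off-diagonal terms in [mlr_blk]. *)
Definition blk A1 A2 B1 B2 (t : A1 * B1 + A2 * B2) : (A1 + A2) * (B1 + B2) :=
  match t with inl p => (inl p.1, inl p.2) | inr p => (inr p.1, inr p.2) end.

Definition unblk A1 A2 B1 B2 (t : (A1 + A2) * (B1 + B2)) : option (A1 * B1 + A2 * B2) :=
  match t with
  | (inl a, inl b) => Some (inl (a, b))
  | (inr a, inr b) => Some (inr (a, b))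
  | _ => None
  end.

Lemma blkK A1 A2 B1 B2 : pcancel (@blk A1 A2 B1 B2) (@unblk A1 A2 B1 B2).
Proof. by move=> [[? ?]|[? ?]]. Qed.

Lemma unblk_codom A1 A2 B1 B2 (t : (A1 + A2) * (B1 + B2)) :
  t \notin codom (@blk A1 A2 B1 B2) -> unblk t = None.
Proof.
move=> h; case: t h => [[a|a] [b'|b']] //= h.
- by exfalso; apply/negP: h; rewrite negbK; apply/codomP; exists (inl (a, b')).
- by exfalso; apply/negP: h; rewrite negbK; apply/codomP; exists (inr (a, b')).
Qed.

Lemma mlr_blk I A1 A2 B1 B2 (x1 : A1 -> A1 -> imx) (x2 : A2 -> A2 -> imx)
    (y1 : B1 -> B1 -> imx) (y2 : B2 -> B2 -> imx)
    (u : I -> A1 * B1 + A2 * B2 -> C) (v : A1 * B1 + A2 * B2 -> I -> C) i j :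
  mlr (fun i t => if unblk t is Some t' then u i t' else 0)
      (amp b (dsum x1 x2) (dsum y1 y2))
      (fun t j => if unblk t is Some t' then v t' j else 0) i j =
  mlr (fun i p => u i (inl p)) (amp b x1 y1) (fun p j => v (inl p) j) i j +
  mlr (fun i p => u i (inr p)) (amp b x2 y2) (fun p j => v (inr p) j) i j.
Proof.
have bI := pcan_inj (@blkK A1 A2 B1 B2).
rewrite /mlr (sum_supp (f := @blk A1 A2 B1 B2))//; last first.
  by move=> t /unblk_codom ->; rewrite big1// => l _; rewrite mul0r scale0r.
under eq_bigr => k _.
  rewrite (sum_supp (f := @blk A1 A2 B1 B2))//; last first.
    by move=> t /unblk_codom ->; rewrite mulr0 scale0r.
  rewrite big_sumT; over.
rewrite big_sumT; congr (_ + _).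
  apply: eq_bigr => k _; rewrite [X in _ + X]big1 ?addr0 => [|[a b'] _].
    by apply: eq_bigr => -[a b'] _; case: k.
  by case: k => a1 b1; rewrite /amp /= b0 scaler0.
apply: eq_bigr => k _; rewrite big1 ?add0r => [|[a b'] _].
  by apply: eq_bigr => -[a b'] _; case: k.
by case: k => a1 b1; rewrite /amp /= b0 scaler0.
Qed.

Lemma opb_unblkl I A1 A2 B1 B2 (u : I -> A1 * B1 + A2 * B2 -> C) c : opb u c ->
  opb (fun i t => if unblk t is Some t' then u i t' else 0) c.
Proof.
move=> hu; have bI := pcan_inj (@blkK A1 A2 B1 B2).
apply: (opb_extend (@inj_id I) bI) hu => [i t|i t|i t].
- by rewrite blkK.
- by case/negP; apply/codomP; exists i.
- by move=> /unblk_codom ->.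
Qed.

Lemma opb_unblkr I A1 A2 B1 B2 (v : A1 * B1 + A2 * B2 -> I -> C) c : opb v c ->
  opb (fun t j => if unblk t is Some t' then v t' j else 0) c.
Proof. by move=> /opb_tr/opb_unblkl/opb_tr. Qed.

(** The inner matrices are added as direct sums and the outer ones as a row and a column. The square
    roots in [Qb] make the squared norms of the latter add up to r + s. *)
Lemma QbD I (X Y : I -> I -> Z) r s : Qb X r -> Qb Y s ->
  Qb (fun i j => X i j + Y i j) (r + s).
Proof.
move=> [r0 [A1 [B1 [x1 [y1 [u1 [v1 [h1 h2 h3 h4 h5]]]]]]]].
move=> [s0 [A2 [B2 [x2 [y2 [u2 [v2 [k1 k2 k3 k4 k5]]]]]]]].
split; first exact: addr_ge0.
pose u i (t : A1 * B1 + A2 * B2) := match t with inl p => u1 i p | inr p => u2 i p end.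
pose v (t : A1 * B1 + A2 * B2) i := match t with inl p => v1 p i | inr p => v2 p i end.
have rs : Num.sqrt r ^+ 2 + Num.sqrt s ^+ 2 <= Num.sqrt (r + s) ^+ 2.
  by rewrite !sqr_sqrtr// addr_ge0.
exists (A1 + A2)%type, (B1 + B2)%type, (dsum x1 x2), (dsum y1 y2),
  (fun i t => if unblk t is Some t' then u i t' else 0),
  (fun t j => if unblk t is Some t' then v t' j else 0).
split.
- exact/opb_unblkl/(opb_row (sqrtr_ge0 _) rs h1 k1).
- exact/opb_unblkr/(opb_col (sqrtr_ge0 _) rs h2 k2).
- exact: os_dsum.
- exact: os_dsum.
by move=> i j; rewrite mlr_blk h5 k5.
Qed.

Lemma Qb_sum I (X : nat -> I -> I -> Z) (r : nat -> R) m n :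
  (forall k, (m <= k < n)%N -> Qb (X k) (r k)) ->
  Qb (fun i j => \sum_(m <= k < n) X k i j) (\sum_(m <= k < n) r k).
Proof.
move=> h; have [nm|mn] := leqP n m.
  rewrite big_geq//; apply: Qb_ext (Qb0 _ (lexx 0)) => i j; rewrite big_geq//.
rewrite -(subnKC (ltnW mn)) in h *; elim: (n - m)%N h => [|d IH] h.
  by rewrite addn0 big_geq//; apply: Qb_ext (Qb0 _ (lexx 0)) => i j; rewrite big_geq.
rewrite addnS big_nat_recr ?leq_addr//=.
have hd : Qb (X (m + d)%N) (r (m + d)%N) by apply: h; rewrite leq_addr addnS ltnS leqnn.
have {}IH : Qb (fun i j => \sum_(m <= k < m + d) X k i j) (\sum_(m <= k < m + d) r k).
  by apply: IH => k /andP[h1 h2]; apply: h; rewrite h1 addnS ltnS ltnW.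
by apply: Qb_ext (QbD IH hd) => i j; rewrite big_nat_recr ?leq_addr.
Qed.

Lemma Qb_dsum I J (X : I -> I -> Z) (Y : J -> J -> Z) r : Qb X r -> Qb Y r ->
  Qb (dsum X Y) r.
Proof.
move=> [r0 [A1 [B1 [x1 [y1 [u1 [v1 [h1 h2 h3 h4 h5]]]]]]]].
move=> [_ [A2 [B2 [x2 [y2 [u2 [v2 [k1 k2 k3 k4 k5]]]]]]]].
split=> //.
exists (A1 + A2)%type, (B1 + B2)%type, (dsum x1 x2), (dsum y1 y2),
  (fun i t => if unblk t is Some t' then dsum u1 u2 i t' else 0),
  (fun t j => if unblk t is Some t' then dsum v1 v2 t' j else 0).
split.
- exact/opb_unblkl/(opb_dsum h1 k1).
- exact/opb_unblkr/(opb_dsum h2 k2).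
- exact: os_dsum.
- exact: os_dsum.
move=> [i|i] [j|j]; rewrite mlr_blk /= /mlr /=.
- rewrite h5 [X in _ + X]big1 ?addr0// => k _; rewrite big1// => l _.
  by rewrite mul0r scale0r.
- rewrite !big1 ?addr0// => k _; rewrite big1// => l _;
  by rewrite ?mulr0 ?mul0r scale0r.
- rewrite !big1 ?addr0// => k _; rewrite big1// => l _;
  by rewrite ?mulr0 ?mul0r scale0r.
- rewrite k5 big1 ?add0r// => k _; rewrite big1// => l _.
  by rewrite mul0r scale0r.
Qed.

(** A regrouping by the shuffle [sh], which brings A next to A' and B next to B'. With m1 and m2
    arbitrary it covers the Schur products as well as the matrix products with signs. *)
Lemma Qb_tens I J A B A' B' (x : A -> A -> imx) (y : B -> B -> imx)
    (x' : A' -> A' -> imx) (y' : B' -> B' -> imx)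
    (u : I -> A * B -> C) (v : A * B -> I -> C) (u' : J -> A' * B' -> C) (v' : A' * B' -> J -> C)
    (m1 m2 : imx -> imx -> imx) r s : 0 <= r -> 0 <= s ->
  opb u (Num.sqrt r) -> opb v (Num.sqrt r) -> opb u' (Num.sqrt s) -> opb v' (Num.sqrt s) ->
  E (amp m1 x x') 1 -> F (amp m2 y y') 1 ->
  Qb (mlr (tensmx u u') (fun p q => b (m1 (x p.1.1 q.1.1) (x' p.2.1 q.2.1))
      (m2 (y p.1.2 q.1.2) (y' p.2.2 q.2.2))) (tensmx v v')) (r * s).
Proof.
move=> r0 s0 hu hv hu' hv' hx hy; split; first exact: mulr_ge0.
pose sh (A1 A2 A3 A4 : finType) (t : (A1 * A2) * (A3 * A4)) := ((t.1.1, t.2.1), (t.1.2, t.2.2)).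
have shK A1 A2 A3 A4 : cancel (@sh A1 A2 A3 A4) (@sh A1 A3 A2 A4) by move=> [[? ?] [? ?]].
exists (A * A')%type, (B * B')%type, (amp m1 x x'), (amp m2 y y'),
  (fun i t => tensmx u u' i (sh _ _ _ _ t)), (fun t j => tensmx v v' (sh _ _ _ _ t) j).
split=> //.
- rewrite sqrtrM//; exact: opb_sub (@inj_id _) (can_inj (@shK _ _ _ _)) (opb_tens hu hu').
- rewrite sqrtrM//; exact: opb_sub (can_inj (@shK _ _ _ _)) (@inj_id _) (opb_tens hv hv').
move=> i j; rewrite /mlr (reindex (@sh A A' B B')); last first.
  by exists (@sh A B A' B') => t _; rewrite shK.
apply: eq_bigr => k _; rewrite (reindex (@sh A A' B B')); last first.
  by exists (@sh A B A' B') => t _; rewrite shK.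
by apply: eq_bigr => l _.
Qed.

End Generic.

Lemma amp_mlr (Z1 Z2 Z3 : lmodType C) (m : Z1 -> Z2 -> Z3) I J A B (X : A -> A -> Z1) (Y : B -> B -> Z2)
    (u : I -> A -> C) (v : A -> I -> C) (u' : J -> B -> C) (v' : B -> J -> C) i j :
  (forall y, m 0 y = 0) -> (forall x, m x 0 = 0) ->
  (forall x x' y, m (x + x') y = m x y + m x' y) ->
  (forall x y y', m x (y + y') = m x y + m x y') ->
  (forall (a : C) x y, m (a *: x) y = a *: m x y) ->
  (forall (a : C) x y, m x (a *: y) = a *: m x y) ->
  amp m (mlr u X v) (mlr u' Y v') i j = mlr (tensmx u u') (amp m X Y) (tensmx v v') i j.
Proof.
move=> m0l m0r mDl mDr mZl mZr; rewrite /amp /mlr.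
have msl (K : finType) (f : K -> Z1) y : m (\sum_k f k) y = \sum_k m (f k) y.
  by apply: (big_morph (m^~ y)) => // a b; apply: mDl.
have msr (K : finType) (f : K -> Z2) x : m x (\sum_k f k) = \sum_k m x (f k).
  by apply: (big_morph (m x)) => // a b; apply: mDr.
rewrite msl sum_pair.
under eq_bigr do rewrite msl.
under eq_bigr do under eq_bigr do rewrite msr.
under eq_bigr do rewrite exchange_big/=.
apply: eq_bigr => k _; apply: eq_bigr => l _.
under eq_bigr do rewrite msr.
rewrite sum_pair; apply: eq_bigr => p _; apply: eq_bigr => q _.
by rewrite mZl mZr scalerA /tensmx /=; congr (_ *: _); ring.
Qed.

End ProjectiveNorm.

(** * The image of the projective norm under the Schur product, and its completion *)

Section CompletedProjectiveNorm.
Variable R : realType.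
Local Notation nc := (@ComplexField.Normc.normc R).
Local Notation C := (R[i]).
Local Notation imx := (nat -> nat -> C).
Implicit Types (I J G H A B : finType) (c d e r s : R).

Definition MX : lmodType C := imx.

Lemma MXD (x y : MX) k l : (x + y) k l = x k l + y k l.
Proof. reflexivity. Qed.
Lemma MXN (x : MX) k l : (- x) k l = - x k l.
Proof. reflexivity. Qed.
Lemma MXZ (a : C) (x : MX) k l : (a *: x) k l = a * x k l.
Proof. reflexivity. Qed.
Lemma MX0 k l : (0 : MX) k l = 0.
Proof. reflexivity. Qed.
Lemma MXP (x y : MX) : (forall k l, x k l = y k l) -> x = y.
Proof. by move=> h; apply/funext => k; apply/funext => l; apply: h. Qed.
Lemma MX_sum (I : Type) (s : seq I) (P : pred I) (F : I -> MX) k l :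
  (\sum_(i <- s | P i) F i) k l = \sum_(i <- s | P i) F i k l.
Proof. by apply: (big_morph (fun x : MX => x k l)). Qed.

Definition schM : MX -> MX -> MX := sch.
Definition prodM N : MX -> MX -> MX := prodK N (fun=> 1).
Definition cscM (p : nat -> C) : MX -> MX := csc p.

(** What the sequel uses of S_p and its conjugate space, so that (S_1, S_oo) for p = 1 and the
    interpolated pairs for p > 1 are treated together. A scaling of the columns of a Schur product
    can be charged to either factor, hence [sp_csc] concerns E and [sp_tail] is an alternative. *)
Record schpair (E F : forall I, (I -> I -> imx) -> R -> Prop) : Prop := {
  sp_E : opsp E;
  sp_F : opsp F;
  sp_Esch : forall I J (x : I -> I -> imx) (y : J -> J -> imx),
    E I x 1 -> E J y 1 -> E _ (amp sch x y) 1;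
  sp_Fsch : forall I J (x : I -> I -> imx) (y : J -> J -> imx),
    F I x 1 -> F J y 1 -> F _ (amp sch x y) 1;
  sp_Eprod : forall I J (x : I -> I -> imx) (y : J -> J -> imx) p N,
    (forall k, nc (p k) <= 1) -> E I x 1 -> E J y 1 -> E _ (amp (prodK N p) x y) 1;
  sp_Fprod : forall I J (x : I -> I -> imx) (y : J -> J -> imx) p N,
    (forall k, nc (p k) <= 1) -> F I x 1 -> F J y 1 -> F _ (amp (prodK N p) x y) 1;
  sp_dual : forall I J (x : I -> I -> imx) (y : J -> J -> imx),
    E I x 1 -> F J y 1 -> SO (amp sch x y) 1;
  sp_csc : forall I (x : I -> I -> imx) p, (forall k, nc (p k) <= 1) ->
    E I x 1 -> E I (fun i j => csc p (x i j)) 1;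
  sp_tail : (forall I (x : I -> I -> imx), E I x 1 -> forall e, 0 < e -> exists N0,
      forall N, (N0 <= N)%N -> E I (fun i j => csc (fun k => (N <= k)%:R) (x i j)) e) \/
    (forall I (x : I -> I -> imx), F I x 1 -> forall e, 0 < e -> exists N0,
      forall N, (N0 <= N)%N -> F I (fun i j => csc (fun k => (N <= k)%:R) (x i j)) e)
}.

Variables (E F : forall I, (I -> I -> imx) -> R -> Prop).
Hypothesis hEF : schpair E F.
Let hE := sp_E hEF.
Let hF := sp_F hEF.

Local Notation Q := (@Qb R E F MX schM).

Lemma sch0 : schM 0 0 = 0.
Proof. by apply: MXP => k l; rewrite MX0; exact: mulr0. Qed.

Lemma schZl (a : C) (x y : imx) : schM (fun k l => a * x k l) y = a *: schM x y.
Proof. by apply: MXP => k l; rewrite MXZ; exact/esym/mulrA. Qed.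

Lemma schZr (a : C) (x y : imx) : schM x (fun k l => a * y k l) = a *: schM x y.
Proof. by apply: MXP => k l; rewrite MXZ; exact: mulrCA. Qed.

Lemma mlrME I A (u : I -> A -> C) (X : A -> A -> MX) (v : A -> I -> C) i j k l :
  mlr u X v i j k l = \sum_p \sum_q u i p * v q j * X p q k l.
Proof.
rewrite /mlr MX_sum; apply: eq_bigr => p _; rewrite MX_sum; apply: eq_bigr => q _.
exact: MXZ.
Qed.

Lemma Q_SO I (X : I -> I -> MX) r : Q X r -> SO X r.
Proof.
move=> [r0 [A [B [x [y [u [v [h1 h2 h3 h4 h5]]]]]]]].
have := SO_mlr h1 (sp_dual hEF h3 h4) h2; rewrite mulr1 -expr2 sqr_sqrtr//.
by apply: SO_ext => i j k l; rewrite mlrE h5 mlrME.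
Qed.

Lemma Q_csc I (X : I -> I -> MX) p r : (forall k, nc (p k) <= 1) ->
  Q X r -> Q (fun i j => cscM p (X i j)) r.
Proof.
move=> p1 [r0 [A [B [x [y [u [v [h1 h2 h3 h4 h5]]]]]]]]; split=> //.
exists A, B, (fun i j => csc p (x i j)), y, u, v; split=> //; first exact: (sp_csc hEF).
move=> i j; apply: MXP => k l; rewrite /cscM /csc h5 !mlrME mulr_suml.
apply: eq_bigr => a _; rewrite mulr_suml; apply: eq_bigr => b _.
by rewrite /amp /schM /sch; ring.
Qed.

Definition tailM N : MX -> MX := cscM (fun k => (N <= k)%:R).

(** The tail of x * y is (tail of x) * y, or x * (tail of y), according to the alternative in
    [sp_tail]. The bound r may be 0, hence the passage to r + 1 before dividing. *)
Lemma Q_tail I (X : I -> I -> MX) r e : Q X r -> 0 < e -> exists N0,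
  forall N, (N0 <= N)%N -> Q (fun i j => tailM N (X i j)) e.
Proof.
move=> [r0 [A [B [x [y [u [v [h1 h2 h3 h4 h5]]]]]]]] e0.
have r1 : 0 < r + 1 by lra.
have sr : 0 < Num.sqrt (r + 1) by rewrite sqrtr_gt0.
have srr : Num.sqrt r <= Num.sqrt (r + 1) by rewrite ler_wsqrtr//; lra.
have h1' := opb_le srr h1; have h2' := opb_le srr h2.
have e1 : 0 < e / (r + 1) by rewrite divr_gt0.
have ee : Num.sqrt (r + 1) * (e / (r + 1)) * 1 * Num.sqrt (r + 1) = e.
  rewrite mulr1 mulrAC -expr2 sqr_sqrtr ?(ltW r1)// mulrC divfK ?gt_eqF//.
have ee' : Num.sqrt (r + 1) * 1 * (e / (r + 1)) * Num.sqrt (r + 1) = e.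
  by rewrite mulr1 mulrAC -expr2 sqr_sqrtr ?(ltW r1)// mulrC divfK ?gt_eqF.
case: (sp_tail hEF) => ht.
  have [N0 hN0] := ht _ _ h3 _ e1; exists N0 => N N0N.
  have := Qb_intro hE hF schZl schZr sr e1 ltr01 sr h1' (hN0 N N0N) h4 h2'.
  rewrite ee; apply: Qb_ext => i j; apply: MXP => k l.
  rewrite /tailM /cscM /csc h5 !mlrME mulr_suml.
  apply: eq_bigr => a _; rewrite mulr_suml; apply: eq_bigr => b _.
  by rewrite /amp /schM /sch; ring.
have [N0 hN0] := ht _ _ h4 _ e1; exists N0 => N N0N.
have := Qb_intro hE hF schZl schZr sr ltr01 e1 sr h1' h3 (hN0 N N0N) h2'.
rewrite ee'; apply: Qb_ext => i j; apply: MXP => k l.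
rewrite /tailM /cscM /csc h5 !mlrME mulr_suml.
apply: eq_bigr => a _; rewrite mulr_suml; apply: eq_bigr => b _.
by rewrite /amp /schM /sch; ring.
Qed.

Lemma schMDl (x x' y : MX) : schM (x + x') y = schM x y + schM x' y.
Proof. by apply: MXP => k l; rewrite MXD; exact: mulrDl. Qed.
Lemma schMDr (x y y' : MX) : schM x (y + y') = schM x y + schM x y'.
Proof. by apply: MXP => k l; rewrite MXD; exact: mulrDr. Qed.
Lemma schMZl (a : C) (x y : MX) : schM (a *: x) y = a *: schM x y.
Proof. by apply: MXP => k l; rewrite MXZ; exact/esym/mulrA. Qed.
Lemma schMZr (a : C) (x y : MX) : schM x (a *: y) = a *: schM x y.
Proof. by apply: MXP => k l; rewrite MXZ; exact: mulrCA. Qed.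
Lemma schM0l y : schM 0 y = 0.
Proof. by apply: MXP => k l; exact: mul0r. Qed.
Lemma schM0r x : schM x 0 = 0.
Proof. by apply: MXP => k l; exact: mulr0. Qed.

Lemma Q_amp_sch I J (X : I -> I -> MX) (Y : J -> J -> MX) r s : Q X r -> Q Y s ->
  Q (amp schM X Y) (r * s).
Proof.
move=> [r0 [A [B [x [y [u [v [h1 h2 h3 h4 h5]]]]]]]].
move=> [s0 [A' [B' [x' [y' [u' [v' [k1 k2 k3 k4 k5]]]]]]]].
have := Qb_tens schM r0 s0 h1 h2 k1 k2 (sp_Esch hEF h3 k3) (sp_Fsch hEF h4 k4).
apply: Qb_ext => i j; rewrite [in RHS]/amp h5 k5.
rewrite -[RHS]/(amp schM (mlr u (amp schM x y) v) (mlr u' (amp schM x' y') v') i j).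
rewrite (amp_mlr _ _ _ _ _ _ _ _ schM0l schM0r schMDl schMDr schMZl schMZr).
apply: eq_bigr => p _; apply: eq_bigr => q _; congr (_ *: _).
by apply: MXP => k l; rewrite /amp /schM /sch; ring.
Qed.

Lemma prodMDl N (x x' y : MX) : prodM N (x + x') y = prodM N x y + prodM N x' y.
Proof.
apply: MXP => k l; rewrite MXD /prodM /prodK -big_split/=.
by apply: eq_bigr => n _; rewrite MXD !mulrDl.
Qed.
Lemma prodMDr N (x y y' : MX) : prodM N x (y + y') = prodM N x y + prodM N x y'.
Proof.
apply: MXP => k l; rewrite MXD /prodM /prodK -big_split/=.
by apply: eq_bigr => n _; rewrite MXD !mulrDr.
Qed.
Lemma prodMZl N (a : C) (x y : MX) : prodM N (a *: x) y = a *: prodM N x y.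
Proof.
apply: MXP => k l; rewrite MXZ /prodM /prodK mulr_sumr.
by apply: eq_bigr => n _; rewrite MXZ -!mulrA.
Qed.
Lemma prodMZr N (a : C) (x y : MX) : prodM N x (a *: y) = a *: prodM N x y.
Proof.
apply: MXP => k l; rewrite MXZ /prodM /prodK mulr_sumr.
by apply: eq_bigr => n _; rewrite MXZ mulrCA.
Qed.
Lemma prodM0l N y : prodM N 0 y = 0.
Proof. by apply: MXP => k l; rewrite /prodM /prodK big1// => n _; rewrite MX0 !mul0r. Qed.
Lemma prodM0r N x : prodM N x 0 = 0.
Proof. by apply: MXP => k l; rewrite /prodM /prodK big1// => n _; rewrite MX0 mulr0. Qed.
Lemma prodMBl N (x x' y : MX) : prodM N (x - x') y = prodM N x y - prodM N x' y.
Proof. by rewrite -scaleN1r prodMDl prodMZl scaleN1r. Qed.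
Lemma prodMBr N (x y y' : MX) : prodM N x (y - y') = prodM N x y - prodM N x y'.
Proof. by rewrite -scaleN1r prodMDr prodMZr scaleN1r. Qed.
Lemma schMBl (x x' y : MX) : schM (x - x') y = schM x y - schM x' y.
Proof. by rewrite -scaleN1r schMDl schMZl scaleN1r. Qed.
Lemma schMBr (x y y' : MX) : schM x (y - y') = schM x y - schM x y'.
Proof. by rewrite -scaleN1r schMDr schMZr scaleN1r. Qed.

(* (a * b)(c * d) = sum_k (a e_kk c) * (b e_kk d) is the average over the signs
   D of (a D c) * (b D d); the signs are averaged one at a time. *)
Definition mixed N m (f : nat -> bool) (a b c d : imx) : MX := fun i j =>
  \sum_(k < m) (a i k * b i k * (c k j * d k j)) +
  (\sum_(m <= k < N) a i k * (-1) ^+ f k * c k j) *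
  (\sum_(m <= k < N) b i k * (-1) ^+ f k * d k j).

(** Let S and T be the signed sums over k > m, and x, y the unsigned terms at m. The mean of (S +
    x)(T + y) and (S - x)(T - y) is S T + x y: the two signs at m kill the cross terms. *)
Lemma mixed_avg N m f (a b c d : imx) : (m < N)%N ->
  mixed N m.+1 f a b c d = 2^-1 *:
    (mixed N m (fun k => if k == m then false else f k) a b c d +
     mixed N m (fun k => if k == m then true else f k) a b c d).
Proof.
move=> mN; apply: MXP => i j; rewrite MXZ MXD /mixed big_ord_recr/=.
have rst (x y : imx) (t : bool) :
   \sum_(m <= k < N) x i k * (-1) ^+ (if k == m then t else f k) * y k j =
   x i m * (-1) ^+ t * y m j + \sum_(m.+1 <= k < N) x i k * (-1) ^+ f k * y k j.
  rewrite big_ltn// eqxx; congr (_ + _); apply: eq_big_nat => k /andP[km _].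
  by rewrite gtn_eqF.
by rewrite !rst expr0 expr1; field.
Qed.

Lemma Q_amp_prod N I J (X : I -> I -> MX) (Y : J -> J -> MX) r s : Q X r -> Q Y s ->
  Q (amp (prodM N) X Y) (r * s).
Proof.
move=> [r0 [A [B [x [y [u [v [h1 h2 h3 h4 h5]]]]]]]].
move=> [s0 [A' [B' [x' [y' [u' [v' [k1 k2 k3 k4 k5]]]]]]]].
pose W m f := mlr (tensmx u u') (fun p q : A * B * (A' * B') =>
  mixed N m f (x p.1.1 q.1.1) (y p.1.2 q.1.2) (x' p.2.1 q.2.1) (y' p.2.2 q.2.2))
  (tensmx v v').
have sg1 (f : nat -> bool) k : nc ((-1) ^+ f k) <= 1.
  by rewrite ncX ncN nc1 expr1n.
(* At m = 0 all signs are present and [Qb_tens] applies. Each step takes the mean of two matrices of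
   norm at most r * s, so the bound is kept; at m = N no sign is left. *)
have key m : (m <= N)%N -> forall f, Q (W m f) (r * s).
  elim: m => [_ f|m IH mN f].
    have := Qb_tens schM r0 s0 h1 h2 k1 k2 (sp_Eprod hEF N (sg1 f) h3 k3)
      (sp_Fprod hEF N (sg1 f) h4 k4).
    apply: Qb_ext => i j; apply: eq_bigr => p _; apply: eq_bigr => q _; congr (_ *: _).
    by apply: MXP => k l; rewrite /mixed big_ord0 add0r !big_mkord.
  have := QbZ 2^-1 (QbD hE hF sch0 (IH (ltnW mN) (fun k => if k == m then false else f k))
    (IH (ltnW mN) (fun k => if k == m then true else f k))).
  rewrite ncV nc_nat (_ : 2^-1 * _ = r * s); last by field.
  apply: Qb_ext => i j; rewrite /W /mlr -big_split/= scaler_sumr; apply: eq_bigr => p _.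
  rewrite -big_split/= scaler_sumr; apply: eq_bigr => q _.
  by rewrite -scalerDr mixed_avg// scale_swap.
apply: Qb_ext (key N (leqnn N) (fun=> false)) => i j; rewrite [in RHS]/amp h5 k5.
rewrite -[RHS]/(amp (prodM N) (mlr u (amp schM x y) v) (mlr u' (amp schM x' y') v') i j).
rewrite (amp_mlr _ _ _ _ _ _ _ _ (prodM0l N) (prodM0r N) (prodMDl N) (prodMDr N)
  (prodMZl N) (prodMZr N)).
apply: eq_bigr => p _; apply: eq_bigr => q _; congr (_ *: _).
apply: MXP => k l; rewrite /mixed big_geq// mul0r addr0.
by apply: eq_bigr => n _; rewrite mulr1.
Qed.

(** Entrywise convergence is enough to identify the limit in [Nb]: the sequences there are Cauchy
    for the projective norm, hence in S_1 by [Q_SO], and [SO_ecvg] turns this into convergence in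
    S_1. *)
Definition ecvg I (Y : nat -> I -> I -> MX) (X : I -> I -> MX) :=
  forall i j p q e, 0 < e -> exists K, forall k, (K <= k)%N ->
    nc (Y k i j p q - X i j p q) <= e.

(* X is a limit of a Cauchy sequence, for the projective norm, of matrices of
   projective norm at most r. *)
Definition Nb I (X : I -> I -> MX) r := 0 <= r /\ exists Y : nat -> I -> I -> MX,
  [/\ forall k, Q (Y k) r,
      forall e, 0 < e -> exists K, forall k l, (K <= k)%N -> (K <= l)%N ->
        Q (fun i j => Y k i j - Y l i j) e &
      ecvg Y X].

Lemma ecvg_unif I (Y : nat -> I -> I -> MX) X : ecvg Y X -> forall M e, 0 < e ->
  exists K, forall k, (K <= k)%N -> forall i j p q, (p < M)%N -> (q < M)%N ->
    nc (Y k i j p q - X i j p q) <= e.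
Proof.
move=> h M e e0.
have [K hK] := choice (fun t : I * I * ('I_M * 'I_M) =>
  h t.1.1 t.1.2 t.2.1 t.2.2 e e0).
exists (\max_t K t)%N => k Kk i j p q pM qM.
apply: (hK ((i, j), (Ordinal pM, Ordinal qM))); apply: leq_trans Kk.
exact: (leq_bigmax ((i, j), (Ordinal pM, Ordinal qM))).
Qed.

Lemma SO_ecvg I (Y : nat -> I -> I -> MX) X r N0 : 0 <= r ->
  (forall k, (N0 <= k)%N -> SO (Y k) r) -> ecvg Y X -> SO X r.
Proof.
move=> r0 hY hX; apply: SO_lim => // M e e0; have [K hK] := ecvg_unif hX M e0.
exists (Y (maxn K N0)); first by apply: hY; rewrite leq_maxr.
by move=> i j k l kM lM; rewrite nc_distC; apply: hK; rewrite ?leq_maxl.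
Qed.

Lemma ecvg_shift I (Y : nat -> I -> I -> MX) X (phi : nat -> nat) :
  (forall k, (k <= phi k)%N) -> ecvg Y X -> ecvg (fun k => Y (phi k)) X.
Proof.
move=> hphi h i j p q e e0; have [K hK] := h i j p q e e0; exists K => k Kk.
by apply: hK; apply: leq_trans Kk _.
Qed.

Lemma ecvgB_cst I (Y : nat -> I -> I -> MX) X (V : I -> I -> MX) : ecvg Y X ->
  ecvg (fun k i j => Y k i j - V i j) (fun i j => X i j - V i j).
Proof.
move=> h i j p q e e0; have [K hK] := h i j p q e e0; exists K => k Kk.
have := hK k Kk; rewrite !MXD !MXN.
by rewrite opprB addrA subrK.
Qed.

Lemma Nb_ge0 I (X : I -> I -> MX) r : Nb X r -> 0 <= r. Proof. by case. Qed.

Lemma Nb_SO I (X : I -> I -> MX) r : Nb X r -> SO X r.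
Proof.
move=> [r0 [Y [hY _ YX]]]; apply: (SO_ecvg (N0 := 0)) YX => // k _.
exact: Q_SO.
Qed.

Lemma Nb_le I (X : I -> I -> MX) r s : r <= s -> Nb X r -> Nb X s.
Proof.
move=> rs [r0 [Y [h1 h2 h3]]]; split; first exact: le_trans rs.
by exists Y; split=> // k; apply: Qb_le rs _.
Qed.

Lemma Nb_ext I (X X' : I -> I -> MX) r : (forall i j, X i j = X' i j) -> Nb X r -> Nb X' r.
Proof.
move=> e [r0 [Y [h1 h2 h3]]]; split=> //; exists Y; split=> // i j p q t t0.
by have [K hK] := h3 i j p q t t0; exists K => k /hK; rewrite e.
Qed.

Lemma Nb_Q I (X : I -> I -> MX) r : Q X r -> Nb X r.
Proof.
move=> hX; split; first exact: Qb_ge0 hX.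
exists (fun=> X); split=> //.
  move=> e e0; exists 0%N => k l _ _.
  by apply: Qb_ext (Qb0 hE hF schM I (ltW e0)) => i j; rewrite subrr.
by move=> i j p q e e0; exists 0%N => k _; rewrite subrr nc0 ltW.
Qed.

Lemma Nb0 I r : 0 <= r -> Nb (fun _ _ : I => 0) r.
Proof. by move=> r0; apply: Nb_Q; exact: (Qb0 hE hF). Qed.

Lemma NbD I (X X' : I -> I -> MX) r s : Nb X r -> Nb X' s ->
  Nb (fun i j => X i j + X' i j) (r + s).
Proof.
move=> [r0 [Y [h1 h2 h3]]] [s0 [Y' [k1 k2 k3]]]; split; first exact: addr_ge0.
exists (fun k i j => Y k i j + Y' k i j); split=> [k|e e0|i j p q e e0].
- exact: (QbD hE hF sch0).
- have e2 : 0 < e / 2 by lra.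
  have [K hK] := h2 _ e2; have [L hL] := k2 _ e2; exists (maxn K L) => k l.
  rewrite !geq_max => /andP[a1 a2] /andP[b1 b2]; rewrite [e]splitr.
  apply: Qb_ext (QbD hE hF sch0 (hK k l a1 b1) (hL k l a2 b2)) => i j.
  by rewrite opprD addrACA.
- have e2 : 0 < e / 2 by lra.
  have [K hK] := h3 i j p q _ e2; have [L hL] := k3 i j p q _ e2; exists (maxn K L) => k.
  rewrite geq_max => /andP[a1 a2]; rewrite !MXD opprD addrACA [e]splitr.
  by apply: le_trans (ncD _ _) _; rewrite lerD ?hK ?hL.
Qed.

Lemma NbZ I (X : I -> I -> MX) r (a : C) : Nb X r -> Nb (fun i j => a *: X i j) (nc a * r).
Proof.
move=> [r0 [Y [h1 h2 h3]]]; split; first by rewrite mulr_ge0 ?nc_ge0.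
have a1 : 0 < nc a + 1 by rewrite ltr_wpDl ?nc_ge0.
have ae e : 0 < e -> nc a * (e / (nc a + 1)) <= e.
  by move=> e0; rewrite mulrCA ler_piMr ?ltW// ltr_pdivrMr// mul1r ltrDl.
exists (fun k i j => a *: Y k i j); split=> [k|e e0|i j p q e e0].
- exact: QbZ.
- have [K hK] := h2 _ (divr_gt0 e0 a1); exists K => k l Kk Kl.
  apply: Qb_ext (Qb_le (ae _ e0) (QbZ a (hK k l Kk Kl))) => i j.
  by rewrite scalerBr.
- have [K hK] := h3 i j p q _ (divr_gt0 e0 a1); exists K => k Kk.
  rewrite !MXZ -mulrBr ncM; apply: le_trans (ae _ e0); rewrite ler_wpM2l ?nc_ge0//.
  exact: hK.
Qed.

Lemma NbN I (X : I -> I -> MX) r : Nb X r -> Nb (fun i j => - X i j) r.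
Proof.
move=> /(NbZ (-1)); rewrite ncN nc1 mul1r; apply: Nb_ext => i j.
by rewrite scaleN1r.
Qed.

Lemma NbB I (X X' : I -> I -> MX) r s : Nb X r -> Nb X' s ->
  Nb (fun i j => X i j - X' i j) (r + s).
Proof. by move=> hX /NbN; apply: NbD. Qed.

Lemma Nb_mlr1 I J (X : J -> J -> MX) (u : I -> J -> C) (v : J -> I -> C) r :
  opb u 1 -> opb v 1 -> Nb X r -> Nb (mlr u X v) r.
Proof.
move=> hu hv [r0 [Y [h1 h2 h3]]]; split=> //.
exists (fun k => mlr u (Y k) v); split=> [k|e e0|i j p q e e0].
- exact: Qb_mlr1.
- have [K hK] := h2 _ e0; exists K => k l Kk Kl.
  apply: Qb_ext (Qb_mlr1 hu hv (hK k l Kk Kl)) => i j.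
  rewrite /mlr -sumrB; apply: eq_bigr => a _; rewrite -sumrB; apply: eq_bigr => b _.
  exact: scalerBr.
- pose c := \sum_a \sum_b nc (u i a * v b j).
  have c0 : 0 <= c by do 2!(apply: sumr_ge0 => ? _); exact: nc_ge0.
  have c1 : 0 < c + 1 by lra.
  have [K hK] := ecvg_unif h3 (maxn p q).+1 (divr_gt0 e0 c1); exists K => k Kk.
  rewrite !mlrME -sumrB; under eq_bigr do rewrite -sumrB.
  apply: le_trans (nc_sum _ _ _) _; apply: (@le_trans _ _ (c * (e / (c + 1)))).
    rewrite mulr_suml; apply: ler_sum => a _; apply: le_trans (nc_sum _ _ _) _.
    rewrite mulr_suml; apply: ler_sum => b _.
    rewrite -mulrBr ncM ler_wpM2l ?nc_ge0//.
    by apply: hK => //; rewrite ltnS ?leq_maxl ?leq_maxr.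
  by rewrite mulrCA ler_piMr ?ltW// ltr_pdivrMr// mul1r; lra.
Qed.

Lemma Nb_sub I J (f g : I -> J) (X : J -> J -> MX) r : injective f -> injective g ->
  Nb X r -> Nb (fun i j => X (f i) (g j)) r.
Proof.
move=> fI gI [r0 [Y [h1 h2 h3]]]; split=> //.
exists (fun k i j => Y k (f i) (g j)); split=> [k|e e0|i j p q e e0].
- exact: Qb_sub.
- have [K hK] := h2 _ e0; exists K => k l Kk Kl.
  exact: (Qb_sub fI gI (hK k l Kk Kl)).
- exact: h3.
Qed.

Lemma Nb_dsum I J (X : I -> I -> MX) (X' : J -> J -> MX) r : Nb X r -> Nb X' r ->
  Nb (dsum X X') r.
Proof.
move=> [r0 [Y [h1 h2 h3]]] [_ [Y' [k1 k2 k3]]]; split=> //.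
exists (fun k => dsum (Y k) (Y' k)); split=> [k|e e0|i j p q e e0].
- exact: (Qb_dsum hE hF sch0).
- have [K hK] := h2 _ e0; have [L hL] := k2 _ e0; exists (maxn K L) => k l.
  rewrite !geq_max => /andP[a1 a2] /andP[b1 b2].
  apply: Qb_ext (Qb_dsum hE hF sch0 (hK k l a1 b1) (hL k l a2 b2)) => i j.
  by case: i j => [i|i] [j|j] //=; rewrite subr0.
- case: i j => [i|i] [j|j] /=.
  + exact: h3.
  + by exists 0%N => k _; rewrite subrr expr0n addr0 sqrtr0 ltW.
  + by exists 0%N => k _; rewrite subrr expr0n addr0 sqrtr0 ltW.
  + exact: k3.
Qed.

(** In the subsequence [phi], the sum of all moduli up to m makes phi k exceed K m whenever m <= k,
    and the summand m ensures m <= phi m. *)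
Lemma Nb_rate I (X : I -> I -> MX) r (dl : nat -> R) : (forall m, 0 < dl m) -> Nb X r ->
  exists Y : nat -> I -> I -> MX, [/\ forall k, Q (Y k) r,
    forall m k, (m <= k)%N -> Q (fun i j => Y k i j - Y m i j) (dl m) & ecvg Y X].
Proof.
move=> dl0 [r0 [Y [h1 h2 h3]]].
have [K hK] := choice (fun m => h2 _ (dl0 m)).
pose phi m := (m + \sum_(i < m.+1) K i)%N.
have pK m k : (m <= k)%N -> (K m <= phi k)%N.
  move=> mk; rewrite /phi (bigD1 (Ordinal (mk : (m < k.+1)%N)))//=.
  by rewrite addnCA leq_addr.
exists (fun m => Y (phi m)); split=> [k|m k mk|]; first exact: h1.
  by apply: hK; apply: pK.
by apply: ecvg_shift h3 => k; rewrite leq_addr.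
Qed.

Lemma Q_lim_entry I (Y : nat -> I -> I -> MX) X (V : I -> I -> MX) e i j p q N0 : 0 <= e ->
  (forall k, (N0 <= k)%N -> Q (fun i j => Y k i j - V i j) e) -> ecvg Y X ->
  nc (X i j p q - V i j p q) <= e.
Proof.
move=> e0 hQ hY.
have : SO (fun i j => X i j - V i j) e.
  apply: (SO_ecvg (N0 := N0) e0) (ecvgB_cst V hY) => k hk; exact: Q_SO (hQ k hk).
by move=> /(SO_entry i j p q); rewrite MXD MXN.
Qed.

(** This carries the completeness of the space. The terms are themselves limits, so the
    approximating sequence is diagonal: the m-th one adds the m-th approximants of the first m
    terms. *)
Lemma Nb_series I (D : nat -> I -> I -> MX) (rr : nat -> R) r X :
  (forall k, Nb (D k) (rr k)) -> (forall n, \sum_(0 <= k < n) rr k <= r) ->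
  ecvg (fun n i j => \sum_(0 <= k < n) D k i j) X -> Nb X r.
Proof.
move=> hD hr hX.
have rr0 k : 0 <= rr k by exact: Nb_ge0 (hD k).
have r0 : 0 <= r by have := hr 0%N; rewrite big_geq.
(* At stage m there are m errors of size 1 / (m + 1) ^ 2, which add up to at most 1 / (m + 1). *)
pose dl (m : nat) : R := m.+1%:R^-1 ^+ 2.
have dl0 m : 0 < dl m by rewrite exprn_gt0// invr_gt0 ltr0n.
have [Y hY] := choice (fun k => Nb_rate dl0 (hD k)).
have dsum_le m : \sum_(0 <= k < m) dl m <= m.+1%:R^-1.
  rewrite sumr_const_nat subn0 -[leLHS]mulr_natl /dl expr2 mulrA ler_piMl ?invr_ge0 ?ler0n//.
  by rewrite ler_pdivrMr ?ltr0n// mul1r ler_nat.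
split=> //; exists (fun m i j => \sum_(0 <= k < m) Y k m i j); split=> [m|e e0|i j p q e e0].
- by apply: Qb_le (hr m) _; apply: (Qb_sum hE hF sch0) => k _; have [+ _ _] := hY k; apply.
- have e2 : 0 < e / 4 by lra.
  have ui n : \sum_(0 <= k < n) rr k <= \sum_(0 <= k < n.+1) rr k.
    by rewrite big_nat_recr//= lerDl.
  have [N1 hN1] := nondec_cauchy ui hr e2; have [N2 hN2] := inv_small e2.
  have key l m : (maxn N1 N2 <= l)%N -> (l <= m)%N ->
      Q (fun i j => \sum_(0 <= k < m) Y k m i j - \sum_(0 <= k < l) Y k l i j) e.
    rewrite geq_max => /andP[n1 n2] lm.
    have q1 : Q (fun i j => \sum_(0 <= k < l) (Y k m i j - Y k l i j)) (\sum_(0 <= k < l) dl l).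
      apply: (Qb_sum hE hF sch0 (X := fun k i j => Y k m i j - Y k l i j) (r := fun=> dl l)).
      by move=> k _; have [_ + _] := hY k; apply.
    have q2 : Q (fun i j => \sum_(l <= k < m) Y k m i j) (\sum_(l <= k < m) rr k).
      apply: (Qb_sum hE hF sch0 (X := fun k i j => Y k m i j)) => k _.
      by have [+ _ _] := hY k; apply.
    apply: Qb_ext (Qb_le _ (QbD hE hF sch0 q1 q2)) => [i j|].
      by rewrite [in RHS](big_cat_nat (leq0n l) lm) sumrB/= addrAC.
    have l1 : l.+1%:R^-1 <= N2.+1%:R^-1 :> R by rewrite lef_pV2 ?posrE ?ltr0n// ler_nat ltnS.
    have s1 : \sum_(l <= k < m) rr k <= e / 4 + e / 4.
      have := hN1 m (leq_trans n1 lm); rewrite (big_cat_nat (leq0n l) lm)/=.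
      have : \sum_(0 <= k < N1) rr k <= \sum_(0 <= k < l) rr k.
        by rewrite (big_cat_nat (leq0n N1) n1)/= lerDl sumr_ge0.
      lra.
    apply: le_trans (lerD (dsum_le l) s1) _.
    by move: (le_lt_trans l1 hN2); move: (l.+1%:R^-1) => w hw; lra.
  exists (maxn N1 N2) => k l hk hl; have [kl|/ltnW lk] := leqP l k; first exact: key.
  by apply: Qb_ext (QbN (key k l hk lk)) => i j; rewrite opprB.
- have e2 : 0 < e / 2 by lra.
  have [K hK] := hX i j p q _ e2; have [N2 hN2] := inv_small e2.
  exists (maxn K N2) => m; rewrite geq_max => /andP[m1 m2].
  pose S : C := (\sum_(0 <= k < m) D k i j : MX) p q.
  rewrite (_ : _ - _ = ((\sum_(0 <= k < m) Y k m i j : MX) p q - S) + (S - X i j p q));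
    last by rewrite addrA subrK.
  apply: le_trans (ncD _ _) _; rewrite [e]splitr; apply: lerD; last exact: hK.
  rewrite /S !MX_sum -sumrB; apply: le_trans (nc_sum _ _ _) _.
  have m3 : m.+1%:R^-1 <= N2.+1%:R^-1 :> R by rewrite lef_pV2 ?posrE ?ltr0n// ler_nat ltnS.
  apply: le_trans (ltW (le_lt_trans m3 hN2)); apply: le_trans (dsum_le m).
  rewrite !big_mkord; apply: ler_sum => k _; have [_ h2 h3] := hY k.
  rewrite nc_distC; apply: (@Q_lim_entry _ _ _ _ _ i j p q m) h3 => [|l ml]; first exact: ltW.
  exact: h2.
Qed.

Lemma Nb_sch I J (X : I -> I -> MX) (X' : J -> J -> MX) r s : Nb X r -> Nb X' s ->
  Nb (amp schM X X') (r * s).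
Proof.
move=> [r0 [Y [h1 h2 h3]]] [s0 [Y' [k1 k2 k3]]]; split; first exact: mulr_ge0.
have rs : 0 < r + s + 1 by lra.
exists (fun k => amp schM (Y k) (Y' k)); split=> [k|e e0|i j p q e e0].
- exact: Q_amp_sch.
- have e1 := divr_gt0 e0 rs; set e' := e / _ in e1.
  have [K hK] := h2 _ e1; have [L hL] := k2 _ e1; exists (maxn K L) => k l.
  rewrite !geq_max => /andP[a1 a2] /andP[b1 b2].
  have := QbD hE hF sch0 (Q_amp_sch (hK k l a1 b1) (k1 k)) (Q_amp_sch (h1 l) (hL k l a2 b2)).
  move=> h; apply: Qb_ext (Qb_le _ h) => [i j|].
    by rewrite /amp schMBl schMBr addrA subrK.
  rewrite [r * _]mulrC -mulrDr /e' mulrAC ler_pdivrMr// ler_pM2l//; lra.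
- pose M := (maxn p q).+1.
  have pM : (p < M)%N by rewrite ltnS leq_maxl.
  have qM : (q < M)%N by rewrite ltnS leq_maxr.
  have e1 := divr_gt0 e0 rs; set e' := e / _ in e1.
  have [K hK] := h3 i.1 j.1 p q _ e1; have [L hL] := k3 i.2 j.2 p q _ e1.
  exists (maxn K L) => k; rewrite geq_max => /andP[a1 a2].
  rewrite /amp /schM /sch (_ : _ - _ = (Y k i.1 j.1 p q - X i.1 j.1 p q) * Y' k i.2 j.2 p q +
    X i.1 j.1 p q * (Y' k i.2 j.2 p q - X' i.2 j.2 p q)); last by ring.
  apply: le_trans (ncD _ _) _; rewrite !ncM.
  have hX : Nb X r by split=> //; exists Y.
  have b1 : nc (Y' k i.2 j.2 p q) <= s by exact: SO_entry (Q_SO (k1 k)).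
  have b2 : nc (X i.1 j.1 p q) <= r by exact: SO_entry (Nb_SO hX).
  apply: (@le_trans _ _ (e' * s + r * e')).
    by rewrite lerD// ler_pM ?nc_ge0 ?hK ?hL.
  rewrite [r * _]mulrC -mulrDr /e' mulrAC ler_pdivrMr// ler_pM2l//; lra.
Qed.

End CompletedProjectiveNorm.

(** * Infinite matrix products and the completed norm *)

Section MatrixProducts.
Variable R : realType.
Local Notation nc := (@ComplexField.Normc.normc R).
Local Notation C := (R[i]).
Local Notation MX := (MX R).
Local Notation prodM := (@prodM R).
Local Notation tailM := (@tailM R).
Implicit Types (a b z : MX) (c d e r s : R).

Definition pcvg a b z := forall p q e, 0 < e -> exists K0, forall K, (K0 <= K)%N ->
  nc (prodM K a b p q - z p q) <= e.

Lemma nc1_le1 (k : nat) : nc ((fun=> 1) k : C) <= 1.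
Proof. by rewrite nc1. Qed.

Lemma bop_entry (a : MX) c p q : bop a c -> nc (a p q) <= c.
Proof.
move=> /(bopP (maxn p q).+1 (maxn p q).+1) h.
have pM : (p < (maxn p q).+1)%N by rewrite ltnS leq_maxl.
have qM : (q < (maxn p q).+1)%N by rewrite ltnS leq_maxr.
exact: opb_entry (Ordinal pM) (Ordinal qM) h.
Qed.

Lemma prodM_diff K L a b : (K <= L)%N ->
  prodM L a b - prodM K a b = prodM L (tailM K a) b.
Proof.
move=> KL; apply: MXP => p q; rewrite MXD MXN /prodM /prodK.
rewrite (big_ord_widen L (fun k => a p k * 1 * b k q) KL) [X in _ - X]big_mkcond/=.
rewrite -sumrB; apply: eq_bigr => k _; rewrite /tailM /cscM /csc.
by case: ltnP => kK; rewrite ?mulr1 ?mulr0 ?mul0r ?subrr ?subr0.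
Qed.

Lemma bop_tail a c : cpt a -> bop a c -> forall e, 0 < e -> exists N0, forall N,
  (N0 <= N)%N -> bop (tailM N a) e.
Proof.
move=> ha hb e e0.
have hSI : SI (fun _ _ : unit => a : nat -> nat -> C) c by split.
have [N0 h] := SI_tail hSI e0; exists N0 => N /h [_]; exact.
Qed.

Lemma bop_prodM K a b c d : bop a c -> bop b d -> bop (prodM K a b) (c * d).
Proof. exact/bop_prod/nc1_le1. Qed.

Lemma prodM_cauchy a b c d : cpt a -> bop a c -> bop b d -> forall e, 0 < e ->
  exists K0, forall K L, (K0 <= K)%N -> (K <= L)%N -> bop (prodM L a b - prodM K a b) e.
Proof.
move=> ca ha hb e e0; have d0 := bnd_ge0 hb; have d1 : 0 < d + 1 by lra.
have [K0 hK] := bop_tail ca ha (divr_gt0 e0 d1); exists K0 => K L K0K KL.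
rewrite prodM_diff//; apply: bnd_le (bop_prodM L (hK K K0K) hb).
by rewrite -mulrA ler_piMr ?ltW// mulrC ltr_pdivrMr// mul1r ltrDl.
Qed.

(** Compactness of a makes its column tails small, so the truncated products are Cauchy in operator
    norm and their entrywise limit is a limit in norm. *)
Lemma pcvg_bop a b z c d : cpt a -> bop a c -> bop b d -> pcvg a b z ->
  forall e, 0 < e -> exists K0, forall K, (K0 <= K)%N -> bop (z - prodM K a b) e.
Proof.
move=> ca ha hb hz e e0; have [K0 hK] := prodM_cauchy ca ha hb e0.
exists K0 => K K0K; apply: bnd_lim => [|M t t0]; first exact: ltW.
have [L hL] := choice (fun r : 'I_M * 'I_M => hz r.1 r.2 t t0).
pose N := maxn K (\max_r L r).
exists (fun _ _ => prodM N a b - prodM K a b); first by apply: hK => //; rewrite leq_maxl.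
move=> _ _ p q pM qM; rewrite -[X in nc X]/(z p q - prodM K a b p q - (prodM N a b p q - prodM K a b p q)).
rewrite opprB addrA subrK nc_distC; apply: (hL (Ordinal pM, Ordinal qM)).
by rewrite leq_max (leq_bigmax (Ordinal pM, Ordinal qM)) orbT.
Qed.

Lemma pcvg_uniq a b z z' : pcvg a b z -> pcvg a b z' -> z = z'.
Proof.
move=> h h'; apply: MXP => p q; apply/eqP; rewrite -subr_eq0 -nc_eq0 eq_le nc_ge0 andbT.
apply/ler_addgt0Pr => e e0; rewrite add0r; have e2 : 0 < e / 2 by lra.
have [K hK] := h p q _ e2; have [L hL] := h' p q _ e2.
have {hK}k1 := hK (maxn K L) (leq_maxl _ _); have {hL}k2 := hL (maxn K L) (leq_maxr _ _).
rewrite (_ : z p q - z' p q = (z p q - prodM (maxn K L) a b p q) +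
  (prodM (maxn K L) a b p q - z' p q)); last by rewrite addrA subrK.
by rewrite nc_distC in k1; apply: le_trans (ncD _ _) _; rewrite [e]splitr lerD.
Qed.

Lemma prodMA K a b z : prodM K a (prodM K b z) = prodM K (prodM K a b) z.
Proof.
apply: MXP => p q; rewrite /prodM /prodK.
under eq_bigr do rewrite mulr_sumr.
rewrite exchange_big/=; apply: eq_bigr => l _; rewrite !mulr_suml.
by apply: eq_bigr => k _; rewrite !mulr1 mulrA.
Qed.

Lemma pcvg_bnd a b z c d : bop a c -> bop b d -> pcvg a b z -> bop z (c * d).
Proof.
move=> ha hb hz; have c0 := bnd_ge0 ha; have d0 := bnd_ge0 hb.
apply: bnd_lim => [|M t t0]; first exact: mulr_ge0.
have [L hL] := choice (fun r : 'I_M * 'I_M => hz r.1 r.2 t t0).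
exists (fun _ _ => prodM (\max_r L r)%N a b); first exact: bop_prodM.
move=> _ _ p q pM qM; rewrite nc_distC; apply: (hL (Ordinal pM, Ordinal qM)).
exact: (leq_bigmax (Ordinal pM, Ordinal qM)).
Qed.

(** Products truncated at the same K associate exactly, by [prodMA]. Replacing the inner products b1
    and b2 by their truncations costs a small operator norm, since a2 and a1 are compact. *)
Lemma pcvg_assoc a1 a2 a3 b1 b2 z z' c1 c2 c3 :
  cpt a1 -> bop a1 c1 -> cpt a2 -> bop a2 c2 -> bop a3 c3 ->
  pcvg a2 a3 b1 -> pcvg a1 a2 b2 -> pcvg a1 b1 z -> pcvg b2 a3 z' -> z = z'.
Proof.
move=> k1 h1 k2 h2 h3 hb1 hb2 hz hz'.
have c10 := bnd_ge0 h1; have c30 := bnd_ge0 h3.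
apply: MXP => p q; apply/eqP; rewrite -subr_eq0 -nc_eq0 eq_le nc_ge0 andbT.
apply/ler_addgt0Pr => e e0; rewrite add0r.
have e4 : 0 < e / 4 by lra.
have w1 : 0 < c1 + 1 by lra.
have w3 : 0 < c3 + 1 by lra.
have [K1 hK1] := hz p q _ e4; have [K2 hK2] := hz' p q _ e4.
have [K3 hK3] := pcvg_bop k2 h2 h3 hb1 (divr_gt0 e4 w1).
have [K4 hK4] := pcvg_bop k1 h1 h2 hb2 (divr_gt0 e4 w3).
pose K := maxn (maxn K1 K2) (maxn K3 K4).
have {hK1}q1 := hK1 K (leq_trans (leq_maxl _ _) (leq_maxl _ _)).
have {hK2}q2 := hK2 K (leq_trans (leq_maxr _ _) (leq_maxl _ _)).
have {hK3}q3 := bop_entry p q (bop_prodM K h1 (hK3 K (leq_trans (leq_maxl _ _) (leq_maxr _ _)))).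
have {hK4}q4 := bop_entry p q (bop_prodM K (hK4 K (leq_trans (leq_maxr _ _) (leq_maxr _ _))) h3).
rewrite prodMBr MXD MXN in q3; rewrite prodMBl MXD MXN -prodMA in q4.
have q3' : c1 * (e / 4 / (c1 + 1)) <= e / 4.
  by rewrite mulrCA ler_piMr ?(ltW e4)// ler_pdivrMr// mul1r; lra.
have q4' : e / 4 / (c3 + 1) * c3 <= e / 4.
  by rewrite -mulrA ler_piMr ?(ltW e4)// mulrC ler_pdivrMr// mul1r; lra.
move: q1 q2 q3 q4; set A := prodM K a1 b1 p q; set B := prodM K b2 a3 p q.
set D := prodM K a1 (prodM K a2 a3) p q => q1 q2 q3 q4.
rewrite (_ : z p q - z' p q = (z p q - A) + ((A - D) - (B - D)) + (B - z' p q)); last by ring.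
rewrite nc_distC in q1.
have t1 := ncD (z p q - A + ((A - D) - (B - D))) (B - z' p q).
have t2 := ncD (z p q - A) ((A - D) - (B - D)).
have t3 := ncB (A - D) (B - D).
lra.
Qed.

Lemma pcvgl (w : C) a a' b z z' : pcvg a b z -> pcvg a' b z' ->
  pcvg (w *: a + a') b (w *: z + z').
Proof.
move=> h h' p q e e0; have w1 : 0 < nc w + 1 by rewrite ltr_wpDl ?nc_ge0.
have e2 : 0 < e / 2 by lra.
have [K hK] := h p q _ (divr_gt0 e2 w1); have [L hL] := h' p q _ e2.
exists (maxn K L) => M; rewrite geq_max => /andP[m1 m2].
rewrite prodMDl prodMZl !MXD !MXZ opprD addrACA -mulrBr.
apply: le_trans (ncD _ _) _; rewrite [e]splitr lerD ?hL// ncM.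
apply: le_trans (ler_wpM2l (nc_ge0 _) (hK M m1)) _.
by rewrite mulrCA ler_piMr ?(ltW e2)// ler_pdivrMr// mul1r lerDl.
Qed.

Lemma pcvgr (w : C) a b b' z z' : pcvg a b z -> pcvg a b' z' ->
  pcvg a (w *: b + b') (w *: z + z').
Proof.
move=> h h' p q e e0; have w1 : 0 < nc w + 1 by rewrite ltr_wpDl ?nc_ge0.
have e2 : 0 < e / 2 by lra.
have [K hK] := h p q _ (divr_gt0 e2 w1); have [L hL] := h' p q _ e2.
exists (maxn K L) => M; rewrite geq_max => /andP[m1 m2].
rewrite prodMDr prodMZr !MXD !MXZ opprD addrACA -mulrBr.
apply: le_trans (ncD _ _) _; rewrite [e]splitr lerD ?hL// ncM.
apply: le_trans (ler_wpM2l (nc_ge0 _) (hK M m1)) _.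
by rewrite mulrCA ler_piMr ?(ltW e2)// ler_pdivrMr// mul1r lerDl.
Qed.

Variables (E F : forall I : finType, (I -> I -> nat -> nat -> C) -> R -> Prop).
Hypothesis hEF : schpair E F.
Let hE := sp_E hEF.
Let hF := sp_F hEF.
Local Notation Q := (@Qb R E F MX (@schM R)).

(** Truncation and approximation run along the same index. For l <= k the difference of two
    approximants splits into (Y k - Y l) Y' k, the part of Y l Y' k with inner index from l to k,
    and Y l (Y' k - Y' l). *)
Lemma Nb_prod (I J : finType) (X : I -> I -> MX) (X' : J -> J -> MX)
    (P : I * J -> I * J -> MX) r s : Nb E F X r -> Nb E F X' s ->
  (forall i j, pcvg (X i.1 j.1) (X' i.2 j.2) (P i j)) -> Nb E F P (r * s).
Proof.
move=> hX hX' hP; move: (hX) (hX') => [r0 [Y [h1 h2 h3]]] [s0 [Y' [k1 k2 k3]]].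
split; first exact: mulr_ge0.
exists (fun k => amp (prodM k) (Y k) (Y' k)); split=> [k|e e0|i j p q e e0].
- exact: Q_amp_prod.
- have rs : 0 < 4 * (r + s + 1) by lra.
  have e1 := divr_gt0 e0 rs; set e' := e / _ in e1.
  have [K hK] := h2 _ e1; have [L hL] := k2 _ e1.
  (* The tail of Y l has to be small uniformly in l: it is the tail of Y l - Y K, small for l >= K,
     plus the tail of the fixed Y K, small from N0 on. *)
  have [N0 hN0] := Q_tail hEF (h1 K) e1.
  have key k l : (maxn (maxn K L) N0 <= l)%N -> (l <= k)%N ->
      Q (fun i j => amp (prodM k) (Y k) (Y' k) i j - amp (prodM l) (Y l) (Y' l) i j) e.
    rewrite !geq_max => /andP[/andP[n1 n2] n3] lk.
    have nK : (K <= k)%N := leq_trans n1 lk; have nL : (L <= k)%N := leq_trans n2 lk.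
    have q1 := Q_amp_prod hEF k (hK k l nK n1) (k1 k).
    have p1 : Q (fun i j => tailM l (Y l i j - Y K i j)) e'.
      by apply: (Q_csc hEF) (hK l K n1 (leqnn K)) => m; apply: nc_ind.
    have q2 := Q_amp_prod hEF k (QbD hE hF (sch0 R) p1 (hN0 l n3)) (k1 k).
    have q3 := Q_amp_prod hEF l (h1 l) (hL k l nL n2).
    have q := QbD hE hF (sch0 R) (QbD hE hF (sch0 R) q1 q2) q3.
    apply: Qb_ext (Qb_le _ q) => [i j|].
      rewrite /amp.
      have -> : tailM l (Y l i.1 j.1 - Y K i.1 j.1) + tailM l (Y K i.1 j.1) =
          tailM l (Y l i.1 j.1).
        by apply: MXP => u v; rewrite MXD /tailM /cscM /csc MXD MXN mulrBl subrK.
      by rewrite -prodM_diff// prodMBl prodMBr !subrKA.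
    have -> : e' * s + (e' + e') * s + r * e' = e * ((3 * s + r) / (4 * (r + s + 1))).
      have rs1 : r + s + 1 != 0 by rewrite gt_eqF // -(pmulr_rgt0 _ (ltr0n _ 4)).
      by rewrite /e'; move: rs1; move: (r) (s) (e) => u v w rs1; field.
    by apply: ler_piMr; [exact: ltW|rewrite ler_pdivrMr// mul1r; lra].
  exists (maxn (maxn K L) N0) => k l hk hl; have [lk|/ltnW kl] := leqP l k; first exact: key.
  by apply: Qb_ext (QbN (key l k hk kl)) => i j; rewrite opprB.
(* Passing from [SO] to operator bounds costs the cardinalities of I and J, which t absorbs. *)
- pose m : R := #|I|%:R + #|J|%:R + 1; have m0 : 0 < m.
    by apply: ltr_wpDl ltr01; apply: addr_ge0.
  pose t := m * m * (r + s + 1) * 2; have rs : 0 < r + s + 1 by lra.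
  have t0 : 0 < t by rewrite !mulr_gt0.
  have e1 := divr_gt0 e0 t0; set e' := e / t in e1.
  have d1 : exists K, forall k, (K <= k)%N -> SO (fun i j => Y k i j - X i j) e'.
    have [K hK] := h2 _ e1; exists K => k Kk.
    have : SO (fun i j => X i j - Y k i j) e'.
      apply: (SO_ecvg (N0 := K)) (ecvgB_cst (Y k) h3) => [|l Kl]; first exact: ltW.
      exact (Q_SO hEF (hK l k Kl Kk)).
    move=> /(SOZ (-1)); rewrite ncN nc1 mul1r; apply: SO_ext => i' j' u v.
    by rewrite -[LHS]/(-1 * (X i' j' u v - Y k i' j' u v)) mulN1r opprB.
  have d2 : exists K, forall k, (K <= k)%N -> SO (fun i j => Y' k i j - X' i j) e'.
    have [K hK] := k2 _ e1; exists K => k Kk.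
    have : SO (fun i j => X' i j - Y' k i j) e'.
      apply: (SO_ecvg (N0 := K)) (ecvgB_cst (Y' k) k3) => [|l Kl]; first exact: ltW.
      exact (Q_SO hEF (hK l k Kl Kk)).
    move=> /(SOZ (-1)); rewrite ncN nc1 mul1r; apply: SO_ext => i' j' u v.
    by rewrite -[LHS]/(-1 * (X' i' j' u v - Y' k i' j' u v)) mulN1r opprB.
  have [K hK] := d1; have [L hL] := d2; have e2 : 0 < e / 2 by lra.
  have [N hN] := hP i j p q _ e2.
  exists (maxn (maxn K L) N) => k; rewrite !geq_max => /andP[/andP[n1 n2] n3].
  rewrite (_ : _ - _ = prodM k (Y k i.1 j.1 - X i.1 j.1) (Y' k i.2 j.2) p q +
     prodM k (X i.1 j.1) (Y' k i.2 j.2 - X' i.2 j.2) p q +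
     (prodM k (X i.1 j.1) (X' i.2 j.2) p q - P i j p q)); last first.
    rewrite prodMBl prodMBr !MXD !MXN /amp; ring.
  have b1 := bnd_bop i.1 j.1 (SO_bnd (hK k n1)).
  have b2 := bnd_bop i.2 j.2 (SO_bnd (Q_SO hEF (k1 k))).
  have b3 := bnd_bop i.1 j.1 (SO_bnd (Nb_SO hEF hX)).
  have b4 := bnd_bop i.2 j.2 (SO_bnd (hL k n2)).
  have q1 := bop_entry p q (bop_prodM k b1 b2).
  have q2 := bop_entry p q (bop_prodM k b3 b4).
  apply: le_trans (ncD _ _) _; apply: le_trans (lerD (ncD _ _) (hN k n3)) _.
  apply: le_trans (lerD (lerD q1 q2) (lexx _)) _.
  have cI : (#|I|%:R : R) <= m by have : 0 <= (#|J|%:R : R) by []; rewrite /m; lra.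
  have cJ : (#|J|%:R : R) <= m by have : 0 <= (#|I|%:R : R) by []; rewrite /m; lra.
  have v1 : #|I|%:R * e' * (#|J|%:R * s) <= m * e' * (m * s).
    apply: ler_pM; [by rewrite mulr_ge0// ltW|exact: mulr_ge0| |exact: ler_wpM2r].
    by apply: (ler_wpM2r (ltW e1)).
  have v2 : #|I|%:R * r * (#|J|%:R * e') <= m * r * (m * e').
    apply: ler_pM; [exact: mulr_ge0|by rewrite mulr_ge0// ltW|exact: ler_wpM2r|].
    by apply: (ler_wpM2r (ltW e1)).
  apply: le_trans (lerD (lerD v1 v2) (lexx _)) _.
  have -> : m * e' * (m * s) + m * r * (m * e') = e / 2 * ((r + s) / (r + s + 1)).
    by rewrite /e' /t; field; rewrite !gt_eqF//; lra.
  rewrite [leRHS]splitr lerD2r ler_piMr ?(ltW e2)// ler_pdivrMr ?mul1r; lra.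
Qed.

End MatrixProducts.

Local Open Scope classical_set_scope.

(** * Identification with the norms of operators *)

Section OperatorNorm.
Variable R : realType.
Local Notation nc := (@ComplexField.Normc.normc R).
Implicit Types (I J : choiceType) (A B G H : finType) (c d e : R).

Lemma fsbig_range (V : nmodType) A I (f : A -> I) (F : I -> V) : injective f ->
  (forall i, ~ range f i -> F i = 0) -> \sum_(i \in [set: I]) F i = \sum_a F (f a).
Proof.
move=> fi h; rewrite -(@fsbig_widen _ _ _ _ (range f)) //; last first.
  by move=> i [_ ni]; exact: h.
rewrite (@fsbig_fwiden _ _ _ _ (map f (index_enum A))); first by rewrite big_map.
- by move=> _ [a _ <-]/=; apply: map_f; rewrite mem_index_enum.
- by rewrite map_inj_uniq// index_enum_uniq.
- by move=> i [/= /mapP[a _ ->]] []; exists a.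
Qed.

Lemma poweR_half_le (x : \bar R) c : (0 <= x)%E -> 0 <= c ->
  (poweR x 2^-1 <= c%:E)%E = (x <= (c ^+ 2)%:E)%E.
Proof.
move=> x0 c0; rewrite poweR12_sqrt//; case: x x0 => [r| |]//= r0.
rewrite !lee_fin -[c in LHS]ger0_norm// -sqrtr_sqr ler_sqrt// exprn_ge0//.
Qed.

Lemma l2norm_ge0 I (x : I -> R[i]) : (0 <= l2norm x)%E.
Proof. exact: poweR_ge0. Qed.

Lemma l2norm_leP I (x : I -> R[i]) c : 0 <= c ->
  (l2norm x <= c%:E)%E <->
  forall A (f : A -> I), injective f -> nrm (fun a => x (f a)) <= c.
Proof.
move=> c0; have sq0 i : (0 <= (nc (x i) ^+ 2)%:E)%E by rewrite lee_fin exprn_ge0// nc_ge0.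
have nrmE A (y : A -> R[i]) : (nrm y <= c) = (nrm2 y <= c ^+ 2).
  by rewrite -(ler_pXn2r (n := 2))// ?nnegrE ?nrm_ge0// nrm_sqr.
rewrite /l2norm poweR_half_le//; last exact: esum_ge0.
split=> [h A f fi|h].
  rewrite nrmE -lee_fin; apply: le_trans h.
  rewrite esum_ge//; exists (range f); first by split=> //; apply: finite_image; exact: finite_finset.
  rewrite (@fsbig_fwiden _ _ _ _ (map f (index_enum A))).
  - by rewrite big_map -sumEFin.
  - by move=> _ [a _ <-]/=; apply: map_f; rewrite mem_index_enum.
  - by rewrite map_inj_uniq// index_enum_uniq.
  - by move=> i [/= /mapP[a _ ->]] []; exists a.
apply: ge_ereal_sup => _ [X [fX _] <-].
rewrite fsbig_finite// sumEFin lee_fin.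
rewrite finmap.big_seq_fsetE/=.
have := h _ (@finmap.fsval I (fset_set X)) val_inj.
by rewrite nrmE.
Qed.

Lemma l2norm_supp A I (f : A -> I) (x : I -> R[i]) : injective f ->
  (forall i, ~ range f i -> x i = 0) -> l2norm x = (nrm (fun a => x (f a)))%:E.
Proof.
move=> fi h; rewrite /l2norm.
have -> : \esum_(i in [set: I]) (nc (x i) ^+ 2)%:E = \esum_(i in range f) (nc (x i) ^+ 2)%:E.
  rewrite [RHS]esum_mkcond; apply: eq_esum => i _; case: ifPn => // /negP ni.
  by rewrite h ?nc0 ?expr0n//= => ri; apply: ni; rewrite inE.
rewrite esum_image; last by move=> a b _ _ /fi.
rewrite esum_fset; last by move=> a _; rewrite lee_fin exprn_ge0// nc_ge0.
  rewrite (@fsbig_range _ _ _ id)//.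
  rewrite sumEFin poweR12_sqrt// lee_fin sumr_ge0// => a _.
  by rewrite exprn_ge0// nc_ge0.
exact: finite_finset.
Qed.

Lemma fin_support I (x : I -> R[i]) : finite_set [set j | x j != 0] ->
  exists A (f : A -> I), injective f /\ forall i, ~ range f i -> x i = 0.
Proof.
move=> fx; exists (finmap.fset_sub_type (fset_set [set j | x j != 0])), (@finmap.fsval _ _); split; first exact: val_inj.
move=> i ni; apply/eqP/negPn/negP => xi; apply: ni.
have hi : i \in fset_set [set j | x j != 0] by rewrite in_fset_set// inE.
by exists (finmap.FSetSub hi).
Qed.

Lemma mxact_supp A I J (g : A -> J) (a : I -> J -> R[i]) (x : J -> R[i]) i : injective g ->
  (forall j, ~ range g j -> x j = 0) -> mxact a x i = \sum_b a i (g b) * x (g b).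
Proof. by move=> gi h; apply: fsbig_range => // j /h ->; rewrite mulr0. Qed.

Lemma opnorm_ge0 I J (a : I -> J -> R[i]) : (0 <= opnorm a)%E.
Proof.
apply: le_trans (l2norm_ge0 (mxact a (fun=> 0))) _; apply: ereal_sup_ubound.
exists (fun=> 0) => //; split.
  by rewrite (_ : [set j | _] = set0)// -subset0 => j /=; rewrite eqxx.
apply/l2norm_leP => // A f fi; rewrite (eq_nrm (y := fun a => 0 * 0)) ?nrmZ ?nc0 ?mul0r//.
Qed.

(** A finitely supported vector and finitely many coordinates of its image see only a finite
    submatrix; conversely, a vector on a finite submatrix is normalised and extended by zero so as
    to lie in [fin_ball]. *)
Lemma opnorm_leP I J (a : I -> J -> R[i]) c : 0 <= c -> (opnorm a <= c%:E)%E <->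
  forall A B (f : A -> I) (g : B -> J), injective f -> injective g ->
    opb (fun i j => a (f i) (g j)) c.
Proof.
move=> c0; split=> [h A B f g fi gi|h].
  split=> // v; have [v0|v0] := eqVneq (nrm v) 0.
    have vE : v =1 fun=> 0.
      move=> b; apply/eqP; rewrite -nc_eq0 eq_le nc_ge0 andbT -v0; exact: nc_le_nrm.
    rewrite (eq_nrm (y := fun=> 0 * 0)) ?nrmZ ?nc0 ?mul0r ?mulr_ge0 ?nrm_ge0//.
    by move=> i; rewrite /mxv big1// => j _; rewrite vE mulr0.
  have {v0}vp : 0 < nrm v by rewrite lt_def v0 nrm_ge0.
  pose w (b : B) := ((nrm v)^-1)%:C%C * v b.
  have nw : nrm w = 1 by rewrite nrmZ nc_real ger0_norm ?invr_ge0 ?nrm_ge0// mulVf// gt_eqF.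
  pose x j := \sum_(b | g b == j) w b.
  have xg b : x (g b) = w b.
    by rewrite /x (bigD1 b)//= big1 ?addr0// => b' /andP[/eqP/gi -> /eqP].
  have xs j : ~ range g j -> x j = 0.
    by move=> nj; rewrite /x big1// => b /eqP e; case: nj; exists b.
  have xb : fin_ball x.
    split.
      apply: (@sub_finite_set _ _ (range g)); last by apply: finite_image; exact: finite_finset.
      by move=> j /= /eqP xj; apply: contrapT => /xs.
    by rewrite (l2norm_supp gi xs) (eq_nrm xg) nw.
  have : (l2norm (mxact a x) <= c%:E)%E.
    by apply: le_trans h; apply: ereal_sup_ubound; exists x.
  move=> /(l2norm_leP _ c0)/(_ _ f fi).
  rewrite (eq_nrm (y := fun i => ((nrm v)^-1)%:C%C * mxv (fun i j => a (f i) (g j)) v i)).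
    rewrite nrmZ nc_real ger0_norm ?invr_ge0 ?nrm_ge0// mulrC ler_pdivrMr//; exact.
  move=> i; rewrite (mxact_supp _ _ gi xs) /mxv mulr_sumr.
  by apply: eq_bigr => b _; rewrite xg /w mulrCA.
apply: ge_ereal_sup => _ [x [fx nx] <-].
have [B [g [gi xs]]] := fin_support fx.
apply/l2norm_leP => // A f fi.
have [_ /(_ (x \o g))] := h _ _ f g fi gi; rewrite (eq_nrm (y := fun i => mxact a x (f i))).
  move=> /le_trans; apply; rewrite ler_piMr//.
  by move: nx; rewrite (l2norm_supp gi xs) lee_fin.
by move=> i; rewrite (mxact_supp _ _ gi xs).
Qed.

Lemma opnorm_finP A B (a : A -> B -> R[i]) c : (opnorm a <= c%:E)%E <-> opb a c.
Proof.
split=> [h|h].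
  have c0 : 0 <= c by rewrite -lee_fin; exact: le_trans (opnorm_ge0 _) h.
  exact: ((opnorm_leP a c0).1 h _ _ id id).
by apply/opnorm_leP => [|G H f g fi gi]; [exact: opb_ge0 h|exact: opb_sub].
Qed.

Lemma opnorm_fin A B (a : A -> B -> R[i]) : exists2 c, opnorm a = c%:E & opb a c.
Proof.
have [d d0 /opnorm_finP hd] := opb_ex a.
have f : opnorm a \is a fin_num.
  by rewrite ge0_fin_numE ?opnorm_ge0//; apply: le_lt_trans hd _; rewrite ltry.
exists (fine (opnorm a)); first by rewrite fineK.
by apply/opnorm_finP; rewrite fineK.
Qed.

Lemma opnorm_bndP A (x : A -> A -> infmx R) c :
  (opnorm (fun i j : A * nat => x i.1 j.1 i.2 j.2) <= c%:E)%E <-> bnd x c.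
Proof.
split=> [h K|h].
  have c0 : 0 <= c by rewrite -lee_fin; exact: le_trans (opnorm_ge0 _) h.
  have fi : injective (fun r : A * 'I_K => (r.1, r.2 : nat)).
    by move=> [a k] [b l] [-> /ord_inj ->].
  exact: ((opnorm_leP _ c0).1 h _ _ _ _ fi fi).
apply/opnorm_leP => [|G H f g fi gi]; first exact: bnd_ge0 h.
pose K := (maxn (\max_r (f r).2) (\max_r (g r).2)).+1.
have fK r : ((f r).2 < K)%N by rewrite ltnS leq_max (leq_bigmax (F := fun r => (f r).2)).
have gK r : ((g r).2 < K)%N by rewrite ltnS leq_max (leq_bigmax (F := fun r => (g r).2)) orbT.
apply: (opb_sub (f := fun r => ((f r).1, Ordinal (fK r)))
  (g := fun r => ((g r).1, Ordinal (gK r))) _ _ (h K)).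
- by move=> r s [e1 e2]; apply: fi; rewrite [f r]surjective_pairing [f s]surjective_pairing e1 e2.
- by move=> r s [e1 e2]; apply: gi; rewrite [g r]surjective_pairing [g s]surjective_pairing e1 e2.
Qed.

Lemma l2norm_natP (x : nat -> R[i]) c : 0 <= c ->
  (l2norm x <= c%:E)%E <-> forall K, nrm (fun k : 'I_K => x k) <= c.
Proof.
move=> c0; split=> [/(l2norm_leP _ c0) h K|h]; first exact: h _ _ (@ord_inj K).
apply/l2norm_leP => // A f fi; apply: le_trans (h (\max_a f a).+1).
have fK a : (f a < (\max_a f a).+1)%N by rewrite ltnS leq_bigmax.
rewrite -(ler_pXn2r (n := 2))// ?nnegrE ?nrm_ge0// !nrm_sqr.
apply: (@nrm_inj _ _ _ (fun a => Ordinal (fK a)) (fun k : 'I__ => x k)).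
by move=> a b [/fi].
Qed.

End OperatorNorm.

(** * Compact operators as norm limits of their corners *)

Section CompactOperators.
Variable R : realType.
Local Notation nc := (@ComplexField.Normc.normc R).
Implicit Types (c d e : R) (a b : infmx R) (K L M : nat).

Lemma finite_uniform (T : Type) (F : set T) (P : T -> nat -> Prop) : finite_set F ->
  (forall y m n, (m <= n)%N -> P y m -> P y n) ->
  (forall y, F y -> exists n, P y n) -> exists n, forall y, F y -> P y n.
Proof.
move=> fF mP hP.
have ex y : exists n, F y -> P y n.
  by have [/hP[n Pn]|nF] := pselect (F y); [exists n|exists 0%N].
have [k hk] := choice ex.
exists (\max_(n <- fset_set (k @` F)) n) => y Fy; apply: (mP _ _ _ _ (hk y Fy)).
have kF : k y \in fset_set (k @` F) by rewrite in_fset_set ?inE; [exists y|exact: finite_image].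
exact: (@leq_bigmax_seq _ (finmap.enum_fset (fset_set (k @` F))) xpredT (fun n => n) (k y) kF isT).
Qed.

Lemma l2_tail (y : nat -> R[i]) c : (forall K, nrm (fun k : 'I_K => y k) <= c) ->
  forall e, 0 < e -> exists K, forall M, nrm (fun k : 'I_M => y k *+ (K <= k)%N) <= e.
Proof.
move=> hc e e0; pose u n := \sum_(k < n) nc (y k) ^+ 2.
have u1 n : u n <= u n.+1 by rewrite /u big_ord_recr/= lerDl exprn_ge0// nc_ge0.
have um n m : u n <= u (n + m)%N.
  by elim: m => [|m ih]; [rewrite addn0|rewrite addnS (le_trans ih)].
have uc n : u n <= c ^+ 2.
  have c0 : 0 <= c := le_trans (nrm_ge0 _) (hc 0%N).
  by have := hc n; rewrite -(ler_pXn2r (n := 2))// ?nnegrE ?nrm_ge0// nrm_sqr.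
have [K hK] := nondec_cauchy u1 uc (exprn_gt0 2 e0).
exists K => M; rewrite -(ler_pXn2r (n := 2))// ?nnegrE ?nrm_ge0 ?(ltW e0)// nrm_sqr.
have := hK _ (leq_addr M K); rewrite -lerBlDl; apply: le_trans.
rewrite /u big_split_ord/= addrAC subrr add0r /nrm2.
have -> : \sum_(i < M) nc (y i *+ (K <= i)%N) ^+ 2 =
    \sum_(0 <= i < M | (K <= i)%N) nc (y i) ^+ 2.
  rewrite [RHS]big_mkcond big_mkord; apply: eq_bigr => i _.
  by case: ifP; rewrite ?nc0 ?expr0n.
rewrite -(big_mkord predT (fun i => nc (y (K + i)%N) ^+ 2)).
have [MK|KM] := leqP M K.
  rewrite [leLHS]big_nat_cond big1; last first.
    by move=> i /andP[/andP[_ iM]]; rewrite leqNgt (leq_trans iM MK).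
  by apply: sumr_ge0 => i _; rewrite exprn_ge0// nc_ge0.
rewrite (big_cat_nat (n := K))//=; last exact: ltnW.
rewrite [X in X + _]big_nat_cond big1 ?add0r; last by move=> i /andP[/andP[_ iK]]; rewrite leqNgt iK.
rewrite -{1}[K]add0n big_addn [leRHS](big_cat_nat (n := (M - K)%N))//= ?leq_subr//.
apply: ler_wpDr; first by apply: sumr_ge0 => i _; rewrite exprn_ge0// nc_ge0.
by rewrite big_mkcond; apply: ler_sum => i _; rewrite leq_addl addnC.
Qed.

Lemma fin_support_nat (x : nat -> R[i]) : finite_set [set j | x j != 0] ->
  exists K, forall L, (K <= L)%N -> forall i, ~ range (@nat_of_ord L) i -> x i = 0.
Proof.
move=> fx; have [A [f [_ h]]] := fin_support fx.
exists (\max_a f a).+1 => L KL i ni; apply: h => -[t _ ti]; apply: ni.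
have iL : (i < L)%N by apply: leq_trans KL; rewrite ltnS -ti leq_bigmax.
by exists (Ordinal iL).
Qed.

Lemma ex_nat_ge c : exists n : nat, c <= n%:R.
Proof. by exists (Num.bound `|c|); apply: le_trans (ler_norm _) (ltW (archi_boundP (normr_ge0 c))). Qed.

Lemma l2norm_lty (y : nat -> R[i]) : (l2norm y < +oo)%E ->
  exists c, forall K, nrm (fun k : 'I_K => y k) <= c.
Proof.
move=> hy; have f : l2norm y \is a fin_num by rewrite ge0_fin_numE// l2norm_ge0.
have c0 : 0 <= fine (l2norm y) by rewrite fine_ge0// l2norm_ge0.
by exists (fine (l2norm y)); apply/l2norm_natP; rewrite // fineK.
Qed.

Lemma compact_net a e : compact_op a -> 0 < e -> exists F : set (nat -> R[i]),
  [/\ finite_set F,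
    forall y, F y -> exists c, forall K, nrm (fun k : 'I_K => y k) <= c &
    forall x, fin_ball x -> exists2 y, F y &
      forall K, nrm (fun k : 'I_K => mxact a x k - y k) <= e].
Proof.
move=> ha e0; have [F [h1 h2 h3]] := ha e e0; exists F; split=> // [y /h2/l2norm_lty//|x hx].
have [y Fy hy] := h3 x hx; exists y => //.
exact: (l2norm_natP _ (ltW e0)).1 (ltW hy).
Qed.

Lemma compact_bop a : compact_op a -> exists c, bop a c.
Proof.
move=> ha; have [F [h1 h2 h3]] := compact_net ha ltr01.
have [n hn] : exists n : nat, forall y, F y -> forall K, nrm (fun k : 'I_K => y k) <= n%:R.
  apply: finite_uniform => // [y m n mn h K|y /h2[c hc]].
    by apply: le_trans (h K) _; rewrite ler_nat.
  by have [n cn] := ex_nat_ge c; exists n => K; apply: le_trans (hc K) _.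
exists (1 + n%:R); apply: bopI => K.
have [] // := (opnorm_leP a (c := 1 + n%:R) _).1 _ _ _ (@nat_of_ord K) (@nat_of_ord K) (@ord_inj K) (@ord_inj K).
apply: ge_ereal_sup => _ [x /h3[y Fy hy] <-]; apply/l2norm_natP => [|L]; first by rewrite addr_ge0.
  rewrite (eq_nrm (y := fun k : 'I_L => (mxact a x k - y k) + y k)); last by move=> k; rewrite subrK.
  by apply: le_trans (nrmD _ _) _; apply: lerD; [exact: hy|exact: hn].
Qed.

(** The tail of an image vector is at most its distance to the net, e / 2, plus the tail of the net
    point; the net being finite, one index makes all the latter tails at most e / 2. *)
Lemma compact_rows a e : compact_op a -> 0 < e -> exists K,
  bop (fun i j => a i j *+ (K <= i)%N) e.
Proof.
move=> ha e0; have e2 : 0 < e / 2 by lra.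
have [F [h1 h2 h3]] := compact_net ha e2.
have [n hn] : exists n : nat, forall y, F y -> forall K,
    nrm (fun k : 'I_K => y k *+ (n <= k)%N) <= e / 2.
  apply: finite_uniform => // [y m n mn h K|y /h2[c hc]]; last exact: l2_tail hc _ e2.
  apply: le_trans (h K); rewrite -(ler_pXn2r (n := 2))// ?nnegrE ?nrm_ge0// !nrm_sqr.
  apply: ler_sum => i _; case: leqP => ni; last by rewrite nc0 expr0n/= exprn_ge0// nc_ge0.
  by rewrite (leq_trans mn ni).
exists n; apply: bopI => K.
apply: ((opnorm_leP (fun i j : nat => a i j *+ (n <= i)%N) (ltW e0)).1 _ _ _
  (@nat_of_ord K) (@nat_of_ord K) (@ord_inj K) (@ord_inj K)).
apply: ge_ereal_sup => _ [x hx <-]; have [y Fy hy] := h3 x hx.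
apply/l2norm_natP => [|L]; first exact: ltW.
have [B hB] := fin_support_nat hx.1; have {}hB := hB _ (leqnn B).
rewrite (eq_nrm (y := fun k : 'I_L => (mxact a x k - y k) *+ (n <= k)%N + y k *+ (n <= k)%N)); last first.
  move=> k; rewrite -mulrnDl subrK !(mxact_supp _ _ (@ord_inj B) hB) -sumrMnl.
  by apply: eq_bigr => j _; rewrite mulrnAl.
apply: le_trans (nrmD _ _) _; rewrite [e]splitr; apply: lerD; last exact: hn.
apply: le_trans (hy L); rewrite -(ler_pXn2r (n := 2))// ?nnegrE ?nrm_ge0// !nrm_sqr.
by apply: ler_sum => i _; case: leqP => ni //; rewrite nc0 expr0n/= exprn_ge0// nc_ge0.
Qed.

Lemma cpt_row a c m : bop a c -> cpt (fun i j => a i j *+ (i == m)).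
Proof.
move=> ha e e0.
have hr L : nrm (fun j : 'I_L => a m j) <= c.
  exact: (opb_rownorm (@ord_max m) (bopP m.+1 L ha)).
have [K hK] := l2_tail hr e0; exists (maxn K m.+1); apply: bopI => M.
apply: opb_hs; first exact: ltW.
rewrite (bigID (fun i : 'I_M => i == m :> nat))/= [X in _ + X]big1 ?addr0 => [|i im]; last first.
  by rewrite big1// => j _; rewrite /tl (negPf im) mulr0n mul0rn nc0 expr0n.
rewrite (big_ord1_eq _ (fun i => \sum_(j < M) nc (tl (maxn K m.+1) (fun i j => a i j *+ (i == m)) i j) ^+ 2)).
case: ifP => _; last by rewrite exprn_ge0// ltW.
have := hK M; rewrite -(ler_pXn2r (n := 2))// ?nnegrE ?nrm_ge0 ?(ltW e0)// nrm_sqr.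
apply: le_trans; apply: ler_sum => j _; rewrite /tl eqxx mulr1n leq_max ltnSn orbT/=.
case: ltnP => kj; first by rewrite mulr0n nc0 expr0n exprn_ge0// nc_ge0.
by rewrite (leq_trans (leq_maxl _ _) kj).
Qed.

(** The net controls the tails in the rows only. The finitely many rows that remain are approximated
    one at a time, each being a vector of l^2. *)
Lemma compact_cpt a : compact_op a -> cpt a.
Proof.
move=> ha; have [c hc] := compact_bop ha.
apply: cpt_approx => e e0; have [K hK] := compact_rows ha e0.
exists (fun i j => a i j *+ (i < K)%N).
  elim: K {hK} => [|K ih]; first by apply: (cpt_ext _ (@cpt0 R)).
  apply: (cpt_ext _ (cptD ih (cpt_row K hc))) => i j.
  rewrite -[LHS]/(a i j *+ (i < K)%N + a i j *+ (i == K)) -mulrnDr; congr (_ *+ _).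
  by rewrite [in RHS]ltnS; case: (ltngtP i K).
apply: bop_ext hK => i j; rewrite -[RHS]/(a i j - a i j *+ (i < K)%N).
by case: ltnP; rewrite ?subrr ?subr0.
Qed.

Lemma real_grid c e : 0 < e -> exists n : nat, forall x, `|x| <= c ->
  exists t : 'I_n, `|x - (t%:R * e - c)| <= e.
Proof.
move=> e0; exists (Num.truncn ((c + c) / e)).+1 => x; rewrite ler_norml => /andP[x1 x2].
have y0 : 0 <= (x + c) / e by apply: divr_ge0 (ltW e0); lra.
have tl : (Num.truncn ((x + c) / e) < (Num.truncn ((c + c) / e)).+1)%N.
  by rewrite ltnS; apply: le_truncn; rewrite ler_pM2r ?invr_gt0//; lra.
exists (Ordinal tl) => /=; have /andP[] := truncn_itv y0.
rewrite ler_pdivlMr// ltr_pdivrMr// => h1; rewrite -[X in X%:R]addn1 natrD mulrDl mul1r => h2.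
by rewrite ler_norml; apply/andP; split; lra.
Qed.

Lemma complex_grid c e : 0 < e -> exists (T : finType) (g : T -> R[i]), forall z,
  nc z <= c -> exists t, nc (z - g t) <= e.
Proof.
move=> e0; have e2 : 0 < e / 2 by lra.
have [n hn] := real_grid c e2.
exists ('I_n * 'I_n)%type, (fun t : 'I_n * 'I_n => Complex ((t.1 : nat)%:R * (e / 2) - c) ((t.2 : nat)%:R * (e / 2) - c)) => -[x y] hz.
have [p hp] := hn x (le_trans (Re_nc (Complex x y)) hz).
have [q hq] := hn y (le_trans (Im_nc (Complex x y)) hz).
by exists (p, q); apply: le_trans (nc_ReIm _) _; rewrite [leRHS]splitr; apply: lerD; [exact: hp|exact: hq].
Qed.

Lemma nrm_small (K : nat) (x : 'I_K -> R[i]) e : 0 <= e -> (forall k, nc (x k) <= e) ->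
  nrm x <= K%:R * e.
Proof.
move=> e0 h; rewrite -(ler_pXn2r (n := 2))// ?nnegrE ?nrm_ge0 ?mulr_ge0// nrm_sqr exprMn.
apply: (@le_trans _ _ (\sum_(k < K) e ^+ 2)).
  by apply: ler_sum => k _; rewrite ler_pXn2r// nnegrE nc_ge0.
rewrite sumr_const card_ord -[leLHS]mulr_natl ler_wpM2r ?exprn_ge0// expr2 -natrM ler_nat.
by case: (K) => // m; rewrite leq_pmulr.
Qed.

(** Up to e / 4 the operator is its K by K corner, which maps the unit ball into a bounded subset of
    a finite-dimensional space; a grid of that space is the net. *)
Lemma cpt_compact a c : cpt a -> bop a c -> compact_op a.
Proof.
move=> ha hc e e0; have c0 := bnd_ge0 hc; have e4 : 0 < e / 4 by lra.
have [K hK] := ha _ e4.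
(* K coordinates, each within this mesh, are together within e / 4; the successor avoids dividing by
   K = 0. *)
have dl0 : 0 < e / 4 / K.+1%:R by rewrite divr_gt0.
have [T [g hg]] := complex_grid c dl0.
pose G (t : {ffun 'I_K -> T}) (i : nat) : R[i] :=
  if insub i is Some k then g (t k) else 0.
have Gi t (k : 'I_K) : G t k = g (t k) by rewrite /G valK.
have Gr t i : ~ range (@nat_of_ord K) i -> G t i = 0.
  by move=> ni; rewrite /G; case: insubP => // k _ ki; case: ni; exists k.
exists (range G); split=> [|_ [t _ <-]|x [fx nx]].
- by apply: finite_image; exact: finite_finset.
- by rewrite (l2norm_supp (@ord_inj K) (Gr t)) ltry.
have [B0 hB] := fin_support_nat fx; pose B := maxn B0 K.
have {}hB := hB B (leq_maxl _ _); have KB : (K <= B)%N := leq_maxr _ _.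
have nB : nrm (fun k : 'I_B => x k) <= 1.
  by move: nx; rewrite (l2norm_supp (@ord_inj B) hB) lee_fin.
have nK : nrm (fun k : 'I_K => x k) <= 1.
  apply: le_trans nB; rewrite -(ler_pXn2r (n := 2))// ?nnegrE ?nrm_ge0// !nrm_sqr.
  apply: (@nrm_inj _ _ _ (widen_ord KB) (fun k : 'I_B => x k)).
  by move=> k l /(congr1 val)/= /ord_inj.
pose w (i : nat) := \sum_(j < K) a i j * x j.
have hw (i : 'I_K) : nc (w i) <= c.
  apply: le_trans (nc_le_nrm (fun i : 'I_K => w i) i) _.
  have [_ h] := bopP K K hc; apply: le_trans (h (fun j => x j)) _.
  by rewrite ler_piMr.
have [t ht] := choice (fun i => hg _ (hw i)).
exists (G [ffun i => t i]); first by exists [ffun i => t i].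
apply: (@le_lt_trans _ _ (e / 2)%:E); last by rewrite lte_fin; lra.
have e2 : 0 <= e / 2 by lra.
apply/l2norm_natP => // M.
pose s (i : nat) := if (i < K)%N then w i - G [ffun i => t i] i else 0.
rewrite (eq_nrm (y := fun i : 'I_M => mxv (fun (i : 'I_M) (j : 'I_B) => tl K a i j) (fun j => x j) i + s i)); last first.
  move=> i; rewrite -[LHS]/(mxact a x i - G [ffun i => t i] i) (mxact_supp _ _ (@ord_inj B) hB) /s /mxv /tl.
  case: ltnP => iK /=.
    rewrite /w addrA; congr (_ - _).
    rewrite (big_ord_widen B (fun j => a i j * x j) KB) [X in _ = _ + X]big_mkcond/=.
    rewrite -big_split/=; apply: eq_bigr => j _; rewrite -[_ j]/(nat_of_ord j).
    by case: ifP; rewrite ?mulr0n ?mul0r ?add0r ?mulr1n ?addr0.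
  rewrite Gr ?subr0 ?addr0; first by apply: eq_bigr => j _; rewrite mulr1n.
  by move=> -[k _ ki]; move: iK; rewrite -ki leqNgt ltn_ord.
apply: le_trans (nrmD _ _) _.
have -> : e / 2 = e / 4 + e / 4 by lra.
apply: lerD.
  have [_ h] := bopP M B hK; apply: le_trans (h (fun j => x j)) _.
  by rewrite ler_piMr// ltW.
have sK i : ~ range (@nat_of_ord K) i -> s i = 0.
  by move=> ni; rewrite /s; case: ltnP => // iK; case: ni; exists (Ordinal iK).
have : (l2norm s <= (e / 4)%:E)%E.
  rewrite (l2norm_supp (@ord_inj K) sK) lee_fin.
  apply: le_trans (nrm_small (ltW dl0) _) _ => [k|].
    by rewrite /s ltn_ord Gi ffunE.
  by rewrite mulrCA ler_piMr ?(ltW e4)// ler_pdivrMr// mul1r ler_nat.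
by move=> /(l2norm_natP _ (ltW e4)); exact.
Qed.

Lemma SinftyP n (x : mat n (infmx R)) c : (Sinfty x <= c%:E)%E <-> SI x c.
Proof.
rewrite /Sinfty; case: asboolP => [h|h]; last first.
  split=> [|[h1 h2]]; first by rewrite leye_eq.
  by case: h => k l; exact: cpt_compact (h1 k l) (bnd_bop k l h2).
split=> [/opnorm_bndP hx|[_ hx]]; last exact/opnorm_bndP.
by split=> // k l; exact: compact_cpt.
Qed.

End CompactOperators.

(** * Convergence of complex sequences *)

Section ComplexSequences.
Variable R : realType.
Local Notation nc := (@ComplexField.Normc.normc R).
Implicit Types (c d e : R) (u v : nat -> R[i]) (l : R[i]).

Definition scvg u l := forall e, 0 < e -> exists N, forall n, (N <= n)%N -> nc (u n - l) <= e.

Lemma normC_nc (z : R[i]) : `|z : R[i]^o| = ((nc z)%:C)%C :> R[i].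
Proof. reflexivity. Qed.

Lemma gt0C_real (e : R[i]) : 0 < e -> exists2 d : R, 0 < d & e = (d%:C)%C.
Proof.
case: e => a b; rewrite ltcE/= => /andP[/eqP -> a0]; by exists a.
Qed.

Lemma scvgP u l : ((u : nat -> R[i]^o) @ \oo --> (l : R[i]^o)) <-> scvg u l.
Proof.
split=> [h e e0|h].
  have ec : 0 < (e%:C)%C :> R[i] by rewrite ltcR.
  move: h => /cvgrPdist_le/(_ _ ec)[N _ hN].
  exists N => n Nn; have := hN n Nn.
  by rewrite /= normC_nc lecR nc_distC.
apply/cvgrPdist_le => e /gt0C_real[d d0 ->].
have [N hN] := h d d0; exists N => // n /= Nn.
by rewrite normC_nc lecR nc_distC; exact: hN.
Qed.

Lemma scvg_is_cvg u l : scvg u l -> cvgn (u : nat -> R[i]^o).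
Proof. by move=> /scvgP h; apply/cvg_ex; exists l. Qed.

Lemma cvg_scvg u : cvgn (u : nat -> R[i]^o) -> scvg u (limn (u : nat -> R[i]^o)).
Proof. by move=> h; apply/scvgP. Qed.

Lemma real_cauchy (u : nat -> R) : (forall e, 0 < e -> exists N, forall m n,
    (N <= m)%N -> (N <= n)%N -> `|u m - u n| <= e) ->
  exists l : R, forall e, 0 < e -> exists N, forall n, (N <= n)%N -> `|u n - l| <= e.
Proof.
move=> h; have cu : cvgn u.
  apply/cauchy_cvgP/cauchy_exP => e e0; have [N hN] := h _ (divr_gt0 e0 (ltr0n R 2)).
  exists (u N); exists N => // n /= Nn; rewrite /ball/= (le_lt_trans (hN _ _ (leqnn N) Nn))//.
  by rewrite ltr_pdivrMr// ltr_pMr// ltr1n.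
exists (limn u) => e e0; move: cu => /cvgrPdist_le/(_ _ e0)[N _ hN].
by exists N => n Nn; rewrite distrC; exact: hN.
Qed.

Lemma scvg_cauchy u : (forall e, 0 < e -> exists N, forall m n,
    (N <= m)%N -> (m <= n)%N -> nc (u n - u m) <= e) -> exists l, scvg u l.
Proof.
move=> h0.
have h e : 0 < e -> exists N, forall m n, (N <= m)%N -> (N <= n)%N -> nc (u m - u n) <= e.
  move=> /h0[N hN]; exists N => m n Nm Nn; have [mn|/ltnW nm] := leqP m n; last exact: hN.
  by rewrite nc_distC; exact: hN.
have [e e0|a ha] := @real_cauchy (fun n => complex.Re (u n)).
  have [N hN] := h e e0; exists N => m n Nm Nn.
  by rewrite -raddfB; apply: le_trans (Re_nc _) (hN _ _ Nm Nn).
have [e e0|b hb] := @real_cauchy (fun n => complex.Im (u n)).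
  have [N hN] := h e e0; exists N => m n Nm Nn.
  by rewrite -raddfB; apply: le_trans (Im_nc _) (hN _ _ Nm Nn).
exists (Complex a b) => e e0; have e2 : 0 < e / 2 by lra.
have [N1 h1] := ha _ e2; have [N2 h2] := hb _ e2; exists (maxn N1 N2) => n.
rewrite geq_max => /andP[n1 n2]; apply: le_trans (nc_ReIm _) _.
rewrite [leRHS]splitr; apply: lerD; rewrite raddfB/=; [exact: h1|exact: h2].
Qed.

Lemma scvg_ext u v l : u =1 v -> scvg u l -> scvg v l.
Proof. by move=> uv h e /h[N hN]; exists N => n; rewrite -uv; exact: hN. Qed.

Lemma scvgD u v l l' : scvg u l -> scvg v l' -> scvg (fun n => u n + v n) (l + l').
Proof.
move=> h h' e e0; have e2 : 0 < e / 2 by lra.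
have [N hN] := h _ e2; have [N' hN'] := h' _ e2; exists (maxn N N') => n.
rewrite geq_max => /andP[n1 n2]; rewrite opprD addrACA.
by apply: le_trans (ncD _ _) _; rewrite [e]splitr; apply: lerD; [exact: hN|exact: hN'].
Qed.

Lemma scvgM (z : R[i]) u l : scvg u l -> scvg (fun n => z * u n) (z * l).
Proof.
move=> h e e0; have z1 : 0 < nc z + 1 by rewrite ltr_wpDl ?nc_ge0.
have [N hN] := h _ (divr_gt0 e0 z1); exists N => n /hN hn.
rewrite -mulrBr ncM; apply: le_trans (ler_wpM2l (nc_ge0 z) hn) _.
by rewrite mulrCA ler_piMr ?(ltW e0)// ler_pdivrMr// mul1r lerDl.
Qed.

Lemma scvg_sum (I : Type) (s : seq I) (P : pred I) (u : I -> nat -> R[i]) (l : I -> R[i]) :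
  (forall i, scvg (u i) (l i)) ->
  scvg (fun n => \sum_(i <- s | P i) u i n) (\sum_(i <- s | P i) l i).
Proof.
move=> h; elim: s => [|i s ih].
  by move=> e e0; exists 0%N => n _; rewrite !big_nil subrr nc0 ltW.
rewrite big_cons; apply: (scvg_ext (u := fun n => (if P i then u i n else 0) +
    \sum_(j <- s | P j) u j n)).
  by move=> n; rewrite big_cons; case: ifP; rewrite ?add0r.
case: ifP => _; first exact: scvgD.
by apply: scvg_ext ih => n; rewrite add0r.
Qed.

Lemma scvg_bound u l c N : scvg u l -> (forall n, (N <= n)%N -> nc (u n) <= c) -> nc l <= c.
Proof.
move=> h hc; apply/ler_addgt0Pr => e e0; have [M hM] := h e e0.
have := hM _ (leq_maxl M N); have := hc _ (leq_maxr M N).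
set w := u _ => h1 h2; rewrite -[l](subKr w) addrC [_ + w]addrC.
by apply: le_trans (ncB _ _) (lerD h1 h2).
Qed.

End ComplexSequences.

(** * The trace pairing and the norm of S_1 *)

Section TracePairing.
Variable R : realType.
Local Notation nc := (@ComplexField.Normc.normc R).
Implicit Types (c d e : R) (a b : infmx R) (K L M N : nat).

Definition psum a b N L : R[i] := \sum_(i < N) \sum_(k < L) a i k * b i k.

Lemma series_ord (u : nat -> R[i]) n : series (u : nat -> R[i]^o) n = \sum_(k < n) u k.
Proof. by rewrite /series/= big_mkord. Qed.

Lemma mxprod_scvg a b : mxprod_cvg a b -> forall i j,
  scvg (fun n => \sum_(k < n) a i k * b k j) (mxprod a b i j).
Proof. by move=> h i j; apply: scvg_ext (cvg_scvg (h i j)) => n; rewrite series_ord. Qed.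

Lemma scvg_mxprod a b : (forall i j, exists l, scvg (fun n => \sum_(k < n) a i k * b k j) l) ->
  mxprod_cvg a b.
Proof.
move=> h i j; have [l hl] := h i j; apply: (@scvg_is_cvg _ _ l).
by apply: scvg_ext hl => n; rewrite series_ord.
Qed.

Lemma psum_scvg a b N : mxprod_cvg a (transpose b) ->
  scvg (psum a b N) (\sum_(i < N) mxprod a (transpose b) i i).
Proof. by move=> h; apply: scvg_sum => i; exact: (mxprod_scvg h). Qed.

(** The pairing is an iterated limit, in the inner index L before the outer index N, hence L0
    depends on N. *)
Lemma pairing_psum a b : pairing_cvg a b -> forall e, 0 < e -> exists N0, forall N, (N0 <= N)%N ->
  exists L0, forall L, (L0 <= L)%N -> nc (psum a b N L - pairing a b) <= e.
Proof.
move=> [h1 h2] e e0; have e2 : 0 < e / 2 by lra.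
have [N0 hN] := cvg_scvg h2 e2; exists N0 => N /hN {}hN.
have [L0 hL] := psum_scvg N h1 e2; exists L0 => L /hL {}hL.
rewrite series_ord -/(trace _) -/(pairing a b) in hN.
have := lerD hL hN; rewrite -splitr; apply: le_trans; apply: le_trans (ncD _ _).
by rewrite addrA subrK.
Qed.

Lemma pairing_fin a b K L : pairing_cvg a b ->
  (forall k l, ~~ ((k < K) && (l < L))%N -> b k l = 0) -> pairing a b = psum a b K L.
Proof.
move=> h hb; apply/eqP; rewrite eq_sym -subr_eq0 -nc_eq0 eq_le nc_ge0 andbT.
apply/ler_addgt0Pr => e e0; rewrite add0r.
have [N0 hN] := pairing_psum h e0; have [L0 hL] := hN (maxn N0 K) (leq_maxl _ _).
have := hL (maxn L0 L) (leq_maxl _ _).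
suff -> : psum a b (maxn N0 K) (maxn L0 L) = psum a b K L by [].
rewrite /psum (big_ord_widen (maxn N0 K) (fun i => \sum_(k < L) a i k * b i k)) ?leq_maxr//.
rewrite [RHS]big_mkcond/=; apply: eq_bigr => i _; case: ifP => iK.
  rewrite [RHS](big_ord_widen (maxn L0 L) (fun k => a i k * b i k)) ?leq_maxr//.
  rewrite [RHS]big_mkcond/=; apply: eq_bigr => k _; case: ifP => // kL.
  by rewrite hb ?mulr0// kL andbF.
by rewrite big1// => k _; rewrite hb ?mulr0// iK.
Qed.

Lemma nrm_mask (I : finType) (x : I -> R[i]) (p : pred I) : nrm (fun i => x i *+ p i) <= nrm x.
Proof.
rewrite -(ler_pXn2r (n := 2))// ?nnegrE ?nrm_ge0// !nrm_sqr; apply: ler_sum => i _.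
by case: (p i) => //; rewrite mulr0n nc0 expr0n exprn_ge0// nc_ge0.
Qed.

Lemma nrm_l2 a c i K : bop a c -> nrm (fun k : 'I_K => a i k) <= c.
Proof. by move=> ha; apply: (opb_rownorm (@ord_max i) (bopP i.+1 K ha)). Qed.

Lemma row_mxprod_cvg a b c d : bop a c -> bop b d -> mxprod_cvg a (transpose b).
Proof.
move=> ha hb; apply: scvg_mxprod => i j; apply: scvg_cauchy => e e0.
have d0 := bnd_ge0 hb; have d1 : 0 < d + 1 by lra.
have [K hK] := l2_tail (fun K => nrm_l2 i K ha) (divr_gt0 e0 d1).
exists K => m n Km mn.
have -> : \sum_(k < n) a i k * transpose b k j - \sum_(k < m) a i k * transpose b k j =
    \sum_(k < n) (a i k *+ (K <= k)%N) * (b j k *+ (m <= k)%N).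
  rewrite (big_ord_widen n (fun k => a i k * transpose b k j) mn) [X in _ - X]big_mkcond/= -sumrB.
  apply: eq_bigr => k _; rewrite /transpose; case: ltnP => km.
    by rewrite subrr mulr0n mulr0.
  by rewrite subr0 (leq_trans Km km).
apply: le_trans (nc_CS _ _) _.
apply: le_trans (ler_pM (nrm_ge0 _) (nrm_ge0 _) (hK n) (le_trans (nrm_mask _ _) (nrm_l2 j n hb))) _.
by rewrite -mulrA ler_piMr ?(ltW e0)// mulrC ler_pdivrMr// mul1r lerDl.
Qed.

Lemma SO_psum a b c e N L : SO (fun _ _ : unit => a) c -> bop b e -> nc (psum a b N L) <= c * e.
Proof.
move=> ha hb; have h := SO_scaled ha (bnd_rect N L hb).
exact: opb_entry (tt, tt) (tt, tt) h.
Qed.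

(** The rows converge by Cauchy-Schwarz. For the trace, a block of the series from m to n pairs a
    with the rows of b from m on; once m >= K these avoid the corner K, so their norm is small
    because b is compact. *)
Lemma SO_pairing_cvg a b c d : SO (fun _ _ : unit => a) c -> cpt b -> bop b d -> pairing_cvg a b.
Proof.
move=> ha cb hb; have h1 := row_mxprod_cvg (SO_bnd ha) hb; split=> //.
have c0 := SO_ge0 ha; have c1 : 0 < c + 1 by lra.
have [e e0|l hl] := @scvg_cauchy _ (fun n => \sum_(i < n) mxprod a (transpose b) i i).
  have [K hK] := cb _ (divr_gt0 e0 c1); exists K => m n Km mn.
  pose y : infmx R := fun i k => b i k *+ (m <= i)%N.
  have hy : bop y (e / (c + 1)).
    apply: bop_ext (bop_mask (fun i => m <= i)%N predT hK) => i k.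
    rewrite /y /tl andbT; case: (leqP m i) => mi; last by rewrite mulr0n.
    by rewrite [(i < K)%N]ltnNge (leq_trans Km mi).
  have -> : \sum_(i < n) mxprod a (transpose b) i i - \sum_(i < m) mxprod a (transpose b) i i =
      \sum_(i < n) mxprod a (transpose b) i i *+ (m <= i)%N.
    rewrite (big_ord_widen n (fun i => mxprod a (transpose b) i i) mn) [X in _ - X]big_mkcond/= -sumrB.
    by apply: eq_bigr => i _; case: ltnP; rewrite ?subrr ?subr0.
  apply: (@scvg_bound _ (psum a y n) _ _ 0).
    apply: scvg_sum => i; case: leqP => mi.
      apply: scvg_ext (mxprod_scvg h1 i i) => k; rewrite /y.
      by apply: eq_bigr => j _; rewrite mi.
    move=> t t0; exists 0%N => k _; rewrite big1 ?subrr ?nc0 ?ltW// => j _.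
    by rewrite /y leqNgt mi mulr0.
  move=> k _; apply: le_trans (SO_psum _ _ ha hy) _.
  by rewrite mulrCA ler_piMr ?(ltW e0)// ler_pdivrMr// mul1r lerDl.
by apply: (@scvg_is_cvg _ _ l); apply: scvg_ext hl => n; rewrite series_ord.
Qed.

Lemma SO_pairing (I J : finType) (x : I -> I -> infmx R) (y : J -> J -> infmx R) c :
  SO x c -> SI y 1 -> opb (fun i j : I * J => pairing (x i.1 j.1) (y i.2 j.2)) c.
Proof.
move=> hx [cy hy]; apply: opb_lim => [|e e0]; first exact: SO_ge0 hx.
have hp (r : (I * J) * (I * J)) : pairing_cvg (x r.1.1 r.2.1) (y r.1.2 r.2.2).
  apply: SO_pairing_cvg (cy _ _) (bnd_bop _ _ hy).
  exact: (SO_sub (f := fun=> r.1.1) (g := fun=> r.2.1) (@unit_inj _ _) (@unit_inj _ _) hx).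
have [N0 hN] := choice (fun r => pairing_psum (hp r) e0).
pose N := \max_r N0 r.
have [L0 hL] := choice (fun r => hN r N (leq_bigmax r)).
pose L := \max_r L0 r.
exists (pairm N L x y); first by rewrite -[c]mulr1; apply: SO_scaled hx _; exact: bnd_rect.
move=> i j; rewrite nc_distC; exact: (hL (i, j) L (leq_bigmax (i, j))).
Qed.

(** [SO] tests on rectangular arrays and rectangular corners, whereas M_m(S_oo) consists of square
    arrays: y is placed as an off-diagonal block over G + H, which preserves its bound. *)
Definition square_of (G H : finType) K L (y : G -> H -> infmx R) :
    'I_#|{: G + H}| -> 'I_#|{: G + H}| -> infmx R := fun p q k l =>
  match enum_val p, enum_val q with
  | inl g, inr h => y g h k l *+ ((k < K) && (l < L))%N
  | _, _ => 0
  end.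

Lemma SI_square_of (G H : finType) K L (y : G -> H -> infmx R) c :
  opb (trm (K := K) (L := L) y) c -> SI (square_of K L y) c.
Proof.
move=> hy; split=> [p q|M].
  apply: (@cpt_fin _ _ (maxn K L)) => k l; rewrite /square_of.
  case: (enum_val p) => // g; case: (enum_val q) => // h.
  rewrite negb_and -!leqNgt !geq_max => /orP[]/andP[kK lL]; first by rewrite ltnNge kK.
  by rewrite andbC ltnNge lL.
pose B := maxn M (maxn K L).
have KB : (K <= B)%N by rewrite /B maxnCA leq_maxl.
have LB : (L <= B)%N by rewrite /B [maxn K L]maxnC maxnCA leq_maxl.
have MB : (M <= B)%N by rewrite leq_maxl.
have wi (n : nat) (nB : (n <= B)%N) : injective (widen_ord nB).
  by move=> i j /(congr1 val)/= /ord_inj.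
suff h : opb (trm (K := B) (L := B) (square_of K L y)) c.
  apply: (opb_sub (f := fun r : _ * 'I_M => (r.1, widen_ord MB r.2))
    (g := fun r : _ * 'I_M => (r.1, widen_ord MB r.2)) _ _ h) => -[? ?] [? ?] [-> ?];
    by congr pair; apply: ord_inj.
apply: (opb_extend (f := fun r : G * 'I_K => (enum_rank (inl r.1 : G + H), widen_ord KB r.2))
  (g := fun r : H * 'I_L => (enum_rank (inr r.1 : G + H), widen_ord LB r.2)) _ _ _ _ _ hy).
- by move=> [g k] [g' k'] [/enum_rank_inj[->] /ord_inj ->].
- by move=> [g k] [g' k'] [/enum_rank_inj[->] /ord_inj ->].
- by move=> [g k] [h l]; rewrite /trm /square_of !enum_rankK/= !ltn_ord.
- move=> [p k] [q l] np; rewrite /trm /square_of/=.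
  case eP : (enum_val p) => [g|//]; case: (enum_val q) => // h.
  case: (ltnP k K) => //= kK; case/codomP: np; exists (g, Ordinal kK).
  by congr pair; [rewrite /= -eP enum_valK|apply: ord_inj].
- move=> [p k] [q l] np; rewrite /trm /square_of/=.
  case: (enum_val p) => // g; case eP : (enum_val q) => [//|h].
  case: (ltnP l L) => lL; last by rewrite andbF.
  case/codomP: np; exists (h, Ordinal lL).
  by congr pair; [rewrite /= -eP enum_valK|apply: ord_inj].
Qed.

Lemma SoneP n (x : mat n (infmx R)) c : (Sone x <= c%:E)%E <-> SO x c.
Proof.
rewrite /Sone; split=> [|hx].
  case: asboolP => [h|_]; last by rewrite leye_eq.
  move=> hs; have ub m (y : mat m (infmx R)) : SI y 1 ->
      opb (fun i j : 'I_n * 'I_m => pairing (x i.1 j.1) (y i.2 j.2)) c.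
    move=> /SinftyP hy; apply/opnorm_finP; apply: le_trans hs; apply: ereal_sup_ubound.
    by exists m, y.
  split=> [|G H K L y /SI_square_of hy].
    exact: opb_ge0 (ub 0 0 (SI0 _ ler01)).
  have := ub _ _ hy; move: (hy) => /SinftyP hy'.
  have gi : injective (fun r : 'I_n * G => (r.1, enum_rank (inl r.2 : G + H))).
    by move=> [i g] [i' g'] [-> /enum_rank_inj[->]].
  have hi : injective (fun r : 'I_n * H => (r.1, enum_rank (inr r.2 : G + H))).
    by move=> [i g] [i' g'] [-> /enum_rank_inj[->]].
  move=> /(opb_sub gi hi); apply: opb_ext => -[i g] [j h']/=.
  have cy p q : compact_op (square_of K L y p q).
    exact: cpt_compact (hy.1 p q) (bnd_bop p q hy.2).
  rewrite (@pairing_fin _ _ K L); first last.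
  - move=> k l nkl; rewrite /square_of; case: (enum_val _) => // u; case: (enum_val _) => // v.
    by rewrite (negPf nkl).
  - exact: h.
  rewrite /psum /pairm; apply: eq_bigr => k _; apply: eq_bigr => l _.
  by rewrite /square_of !enum_rankK !ltn_ord.
case: asboolP => [_|[]]; last first.
  move=> k l b cb; have [d hd] := compact_bop cb.
  apply: SO_pairing_cvg (compact_cpt cb) hd.
  exact: (SO_sub (f := fun=> k) (g := fun=> l) (@unit_inj _ _) (@unit_inj _ _) hx).
apply: ge_ereal_sup => _ [m [y [/SinftyP hy ->]]]; apply/opnorm_finP.
exact: SO_pairing.
Qed.

End TracePairing.

(** * Identification of the interpolated and projective norms *)

Section Interpolation.
Variable R : realType.
Local Notation nc := (@ComplexField.Normc.normc R).
Local Notation C := (R[i]).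
Local Notation imx := (nat -> nat -> C).
Implicit Types (c d e M th : R).

Lemma nbhsCP (z : R[i]^o) (A : set R[i]^o) : nbhs z A <->
  exists2 d : R, 0 < d & forall w : C, nc (w - z) < d -> A w.
Proof.
split=> [/nbhs_ballP[e /gt0C_real[d d0 ->] h]|[d d0 h]].
  by exists d => // w wd; apply: h; rewrite -ball_normE/= normC_nc ltcR nc_distC.
apply/nbhs_ballP; exists (d%:C)%C; first by rewrite /= ltcR.
by move=> w; rewrite -ball_normE/= normC_nc ltcR nc_distC => /h.
Qed.

Lemma nbhsRP (t : R) (A : set R) : nbhs t A <->
  exists2 d : R, 0 < d & forall s, `|s - t| < d -> A s.
Proof.
split=> [/nbhs_ballP[d d0 h]|[d d0 h]].
  by exists d => // w wd; apply: h; rewrite -ball_normE/= distrC.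
by apply/nbhs_ballP; exists d => // w; rewrite -ball_normE/= distrC => /h.
Qed.

Lemma norm_ge0 (N : \bar R) (G : R -> Prop) : (forall c, (N < c%:E)%E -> G c) ->
  (forall c, G c -> 0 <= c) -> (0 <= N)%E.
Proof.
move=> h h0; rewrite leNgt; apply/negP => N0; case: N h N0 => [r| |]// h r0.
  have {}r0 : r < 0 by rewrite -lte_fin.
  have : 0 <= r / 2 by apply/h0/h; rewrite lte_fin; lra.
  lra.
by have := h0 _ (h (-1) (ltNyr _)); rewrite ler0N1.
Qed.

Lemma norm_fin (N : \bar R) (G : R -> Prop) : (forall c, (N < c%:E)%E -> G c) ->
  (forall c, G c -> 0 <= c) -> (N < +oo)%E ->
  exists c, [/\ 0 <= c, N = c%:E & forall e, 0 < e -> G (c + e)].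
Proof.
move=> h h0 f; have n0 := norm_ge0 h h0.
have ff : N \is a fin_num by rewrite ge0_fin_numE.
exists (fine N); split; [exact: fine_ge0|by rewrite fineK|move=> e e0].
by apply: h; rewrite -{1}(fineK ff) lte_fin ltrDl.
Qed.

Lemma Sinfty_ge0 n (x : mat n (infmx R)) : (0 <= Sinfty x)%E.
Proof. by apply: (norm_ge0 (G := SI x)) => c; [move=> /ltW/SinftyP|exact: SI_ge0]. Qed.

Lemma Sone_ge0 n (x : mat n (infmx R)) : (0 <= Sone x)%E.
Proof. by apply: (norm_ge0 (G := SO x)) => c; [move=> /ltW/SoneP|exact: SO_ge0]. Qed.

(** On M_n the inclusion of S_1 in S_oo has constant at most n, by [SO_SI]; adding the S_oo part of
    the decomposition gives n + 1. *)
Lemma sum_norm_SI n (x : mat n (infmx R)) e :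
  (sum_norm (@Sinfty R n) (@Sone R n) x < e%:E)%E -> SI x (n.+1%:R * e).
Proof.
move=> /ereal_inf_lt[_ [y /= -> <-] h].
have /SinftyP h1 : (Sinfty y.1 <= e%:E)%E.
  by apply: le_trans (ltW h); rewrite leeDl// Sone_ge0.
have /SoneP/SO_SI h2 : (Sone y.2 <= e%:E)%E.
  by apply: le_trans (ltW h); rewrite leeDr// Sinfty_ge0.
have -> : n.+1%:R * e = e + #|'I_n|%:R * e by rewrite card_ord -nat1r mulrDl mul1r.
exact: SID h1 h2.
Qed.

Lemma SI_sum_norm n (x : mat n (infmx R)) e : SI x e ->
  (sum_norm (@Sinfty R n) (@Sone R n) x <= e%:E)%E.
Proof.
move=> /SinftyP hx; apply: (@le_trans _ _ (Sinfty x + Sone (0%R : mat n (infmx R)))%E).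
  by apply: ereal_inf_lbound; exists (x, 0) => //=; rewrite addr0.
by rewrite -[leRHS]adde0; apply: leeD => //; apply/SoneP; exact: SO0.
Qed.

Lemma SI_lt_sum_norm n (x : mat n (infmx R)) e d : SI x d -> d < e ->
  (sum_norm (@Sinfty R n) (@Sone R n) x < e%:E)%E.
Proof. by move=> /SI_sum_norm hx de; apply: le_lt_trans hx _; rewrite lte_fin. Qed.

Local Notation calN n := (calderon (@Sinfty R n) (@Sone R n)).
Local Notation calM I := (cal (@SIm R I) (@SOm R I)).

Lemma calderon_cal n (f : C -> MM R 'I_n) M : calN n f M -> calM 'I_n f M.
Proof.
move=> [[K hK] hc ha hl hr _ hrc].
have n0 : 0 < n.+1%:R :> R by rewrite ltr0n.
have n1 : 0 <= n.+1%:R :> R by [].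
split; [split| | |].
- exists (n.+1%:R * (K + 1)) => z zS; apply: sum_norm_SI.
  by apply: le_lt_trans (hK z zS) _; rewrite lte_fin ltrDl.
- move=> z zS e e0; have /nbhsCP[d d0 h] := hc z zS _ (divr_gt0 e0 n0).
  exists d => // w wS wz; have /sum_norm_SI := h w wz wS.
  by rewrite mulrC divfK ?gt_eqF.
- move=> z zO; have [l hl'] := ha z zO; exists l => e e0.
  have /nbhsCP[d d0 h] := hl' _ (divr_gt0 e0 n0).
  exists d => // w w0 wd; rewrite -[w]subr0 in wd; have /sum_norm_SI := h w wd w0.
  by rewrite mulrC divfK ?gt_eqF.
- by move=> t; apply/SinftyP; exact: hl.
- by move=> t; apply/SoneP; exact: hr.
- move=> t e e0; have /nbhsRP[d d0 h] := hrc t e e0.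
  by exists d => // s /h/ltW/SoneP.
Qed.

Lemma cal_calderon n (f : C -> MM R 'I_n) M : calM 'I_n f M -> calN n f M.
Proof.
move=> [[[K hK] hc ha] hl hr hrc].
split.
- by exists K => z /hK/SI_sum_norm.
- move=> z zS e e0; have e2 : 0 < e / 2 by lra.
  have [d d0 h] := hc z zS _ e2; apply/nbhsCP; exists d => // w wz wS.
  by apply: SI_lt_sum_norm (h w wS wz) _; lra.
- move=> z zO; have [l hl'] := ha z zO; exists l => e e0; have e2 : 0 < e / 2 by lra.
  have [d d0 h] := hl' _ e2; apply/nbhsCP; exists d => // w; rewrite subr0 => wd w0.
  by apply: SI_lt_sum_norm (h w w0 wd) _; lra.
- by move=> t; apply/SinftyP; exact: hl.
- by move=> t; apply/SoneP; exact: hr.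
- move=> t e e0; have e2 : 0 < e / 2 by lra.
  have t0 : inS (Complex 0 t : C) by rewrite /inS/= lexx ler01.
  have [d d0 h] := hc _ t0 _ e2; apply/nbhsRP; exists d => // s sd.
  have s0 : inS (Complex 0 s : C) by rewrite /inS/= lexx ler01.
  have sd' : nc (Complex 0 s - Complex 0 t) < d.
    by apply: le_lt_trans sd; apply: le_trans (nc_ReIm _) _; rewrite /= subrr normr0 add0r.
  have /SinftyP hh := h _ s0 sd'; apply: le_lt_trans hh _; rewrite lte_fin; lra.
- move=> t e e0; have e2 : 0 < e / 2 by lra.
  have [d d0 h] := hrc t _ e2; apply/nbhsRP; exists d => // s /h/SoneP hh.
  by apply: le_lt_trans hh _; rewrite lte_fin; lra.
Qed.

(** The norm is an infimum that may fail to be attained, so the second half starts from a strict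
    inequality. *)
Definition rep (N : mxnorm (infmx R)) (E : forall I : finType, (I -> I -> imx) -> R -> Prop) :=
  (forall n (x : mat n (infmx R)) c, E 'I_n x c -> (N n x <= c%:E)%E) /\
  (forall n (x : mat n (infmx R)) c, (N n x < c%:E)%E -> E 'I_n x c).

Lemma rep_Sinfty : rep (@Sinfty R) (@SI R).
Proof. by split=> n x c => [/SinftyP|/ltW/SinftyP]. Qed.

Lemma rep_Sone : rep (@Sone R) (@SO R).
Proof. by split=> n x c => [/SoneP|/ltW/SoneP]. Qed.

Lemma rep_interp th : rep (interp_opspace (@Sinfty R) (@Sone R) th) (@SP R th).
Proof.
split=> n x c.
  move=> [f hf fx]; apply: ereal_inf_lbound; exists c => //; exists f => //.
  exact: cal_calderon.
move=> /ereal_inf_lt[_ [M [f hf fx] <-]]; rewrite lte_fin => /ltW Mc.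
apply: SP_le Mc _; exists f => //; exact: calderon_cal.
Qed.

Lemma opsp_SI : opsp (@SI R).
Proof.
split=> [I x c|I x c d|I x c a|I c|I J x y c].
- exact: SI_ge0.
- exact: SI_le.
- exact: SIZ.
- exact: SI0.
- exact: SI_dsum.
Qed.

Lemma opsp_SO : opsp (@SO R).
Proof.
split=> [I x c|I x c d|I x c a|I c|I J x y c].
- exact: SO_ge0.
- exact: SO_le.
- exact: SOZ.
- exact: SO0.
- exact: SO_dsum.
Qed.

Lemma SP0 th (I : finType) c : 0 <= c -> SP th (0 : MM R I) c.
Proof.
move=> c0; exists (fun=> 0) => //; have h0 := np0 (normpred_SI R I); have h1 := np0 (normpred_SO R I).
split; [split| | |].
- by exists 0 => z _; exact: h0.
- by move=> z _ e e0; exists 1 => // w _ _; rewrite subrr; apply: h0; exact: ltW.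
- move=> z _; exists 0 => e e0; exists 1 => // h _ _; rewrite subrr scaler0 subrr.
  by apply: h0; exact: ltW.
- by move=> t; exact: h0.
- by move=> t; exact: h1.
- by move=> t e e0; exists 1 => // s _; rewrite subrr; apply: h1; exact: ltW.
Qed.

Lemma opsp_SP th : opsp (@SP R th).
Proof.
split=> [I x c|I x c d|I x c a|I c|I J x y c].
- exact: SP_ge0.
- exact: SP_le.
- exact: SPZ.
- exact: SP0.
- exact: SP_dsum.
Qed.

Lemma schpair_SOSI : schpair (@SO R) (@SI R).
Proof.
split; [exact: opsp_SO|exact: opsp_SI| | | | | | |right].
- by move=> I J x y hx hy; rewrite -[1]mulr1; exact: SO_sch.
- by move=> I J x y hx hy; rewrite -[1]mulr1; exact: SI_sch.
- by move=> I J x y p N hp hx hy; rewrite -[1]mulr1; exact: SO_prod.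
- by move=> I J x y p N hp hx hy; rewrite -[1]mulr1; exact: SI_prod.
- by move=> I J x y hx [_ hy]; rewrite -[1]mulr1; exact: SO_sch_bnd.
- by move=> I x p hp; exact: SO_csc.
- by move=> I x; exact: SI_tail.
Qed.

Lemma schpair_SP th : 0 < th < 1 -> schpair (@SP R th) (@SP R (1 - th)).
Proof.
move=> h; split; [exact: opsp_SP|exact: opsp_SP| | | | | | |left].
- by move=> I J x y hx hy; rewrite -[1]mulr1; exact: SP_sch.
- by move=> I J x y hx hy; rewrite -[X in SP _ _ X]mulr1; exact: SP_sch.
- by move=> I J x y p N hp hx hy; rewrite -[1]mulr1; exact: SP_prod.
- by move=> I J x y p N hp hx hy; rewrite -[X in SP _ _ X]mulr1; exact: SP_prod.
- by move=> I J x y hx hy; rewrite -[1]mulr1; exact: SP_dual h hx hy.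
- by move=> I x p hp; exact: SP_csc.
- by move=> I x hx e e0; exact: SP_tail h hx e e0.
Qed.

(** Invariance under relabelling, used to pass from an arbitrary finite index type to ordinals by
    enumeration. *)
Definition subclosed (E : forall I : finType, (I -> I -> imx) -> R -> Prop) :=
  forall (I J : finType) (f : J -> I) (x : I -> I -> imx) c, injective f ->
    E I x c -> E J (fun i j => x (f i) (f j)) c.

Lemma sub_SI : subclosed (@SI R).
Proof. by move=> I J f x c fi [h1 h2]; split=> [i j|]; [exact: h1|exact: bnd_sub]. Qed.

Lemma sub_SO : subclosed (@SO R).
Proof. by move=> I J f x c fi; exact: SO_sub. Qed.

Lemma sub_SP th : subclosed (@SP R th).
Proof.
move=> I J f x c fi hx; rewrite -[c]mul1r.
apply: (@SP_lin _ th I J (fun x i j => x (f i) (f j)) 1 _ _ _ _ ler01 x c hx) => //.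
- by move=> y d hy; rewrite mul1r; exact: (sub_SI fi hy).
- by move=> y d hy; rewrite mul1r; exact: (sub_SO fi hy).
Qed.

(** For p > 1 the parameters are th = 1 / p and 1 - th, the inverse of the conjugate exponent; p = 1
    lies outside 0 < th < 1 and is the pair (S_1, S_oo). *)
Lemma schatten_pair (p : R) : 1 <= p ->
  exists E F : forall I : finType, (I -> I -> imx) -> R -> Prop,
  [/\ schpair E F, subclosed E, subclosed F,
      rep (schatten p%:E) E & rep (schatten (hoelder_conjugate p%:E)) F].
Proof.
rewrite le_eqVlt => /predU1P[<-|p1].
  exists (@SO R), (@SI R); rewrite /schatten hoelder_conjugate1 !eqxx.
  split; [exact: schpair_SOSI|exact: sub_SO|exact: sub_SI|exact: rep_Sone|exact: rep_Sinfty].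
have p0 : 0 < p by apply: lt_trans p1.
exists (@SP R p^-1), (@SP R (1 - p^-1)).
have q : hoelder_conjugate p%:E = (p / (p - 1))%:E.
  by rewrite /hoelder_conjugate/= eqe gt_eqF// -EFinB inver gt_eqF ?subr_gt0//.
split.
- by apply: schpair_SP; rewrite invr_gt0 p0 invf_lt1.
- exact: sub_SP.
- exact: sub_SP.
- rewrite /schatten/= eqe gt_eqF//; exact: rep_interp.
- rewrite q /schatten/= eqe (_ : (p / (p - 1) == 1) = false).
    have -> : 1 - p^-1 = (p / (p - 1))^-1.
      by field; rewrite subr_eq0 !gt_eqF.
    exact: rep_interp.
  apply/negbTE; rewrite -subr_eq0; apply/eqP => e.
  have : p / (p - 1) - 1 = (p - 1)^-1 by field; rewrite subr_eq0 gt_eqF.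
  by rewrite e => /esym/eqP; rewrite invr_eq0 subr_eq0 gt_eqF.
Qed.

End Interpolation.

(** * The projective tensor norm and the quotient norm *)

Section ProjectiveTensorProduct.
Variable R : realType.
Local Notation C := (R[i]).
Local Notation imx := (nat -> nat -> C).
Local Notation V := (infmx R).
Implicit Types (I J A B : finType) (c d e r s : R).

Definition TZ : lmodType C := {bilinear V -> V -> C^o} -> C^o.

Lemma TZZ (a : C) (x : TZ) f : (a *: x) f = a * x f. Proof. by []. Qed.
Lemma TZP (x y : TZ) : (forall f, x f = y f) -> x = y. Proof. by move=> h; apply/funext. Qed.

Definition tensT (x y : imx) : TZ := @tens R V V x y.

Lemma tensT0 : tensT 0 0 = 0.
Proof. by apply: TZP => f; rewrite /tensT /tens linear0r. Qed.

Lemma tensTZl (a : C) (x y : imx) : tensT (fun k l => a * x k l) y = a *: tensT x y.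
Proof. by apply: TZP => f; rewrite TZZ /tensT /tens -[LHS]/(f (a *: (x : V)) y) linearZl. Qed.

Lemma tensTZr (a : C) (x y : imx) : tensT x (fun k l => a * y k l) = a *: tensT x y.
Proof. by apply: TZP => f; rewrite TZZ /tensT /tens -[LHS]/(f x (a *: (y : V))) linearZr. Qed.

Definition psiT (u : TZ) : MX R := @psi R u.

Lemma psiTD (u v : TZ) : psiT (u + v) = psiT u + psiT v. Proof. by []. Qed.
Lemma psiTZ (a : C) (u : TZ) : psiT (a *: u) = a *: psiT u. Proof. by []. Qed.

Lemma psiT_sum (T : Type) (s : seq T) (P : pred T) (F : T -> TZ) :
  psiT (\sum_(t <- s | P t) F t) = \sum_(t <- s | P t) psiT (F t).
Proof. by apply: (big_morph psiT psiTD). Qed.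

Lemma psiT_mlr I A B (u : I -> A * B -> C) (x : A -> A -> imx) (y : B -> B -> imx) v i j :
  psiT (mlr u (amp tensT x y) v i j) = mlr u (amp (@schM R) x y) v i j.
Proof.
rewrite /mlr psiT_sum; apply: eq_bigr => k _; rewrite psiT_sum.
by apply: eq_bigr => l _; rewrite psiTZ.
Qed.

Lemma mlr_reindex (Z : lmodType C) I A B (g : A -> B) (u : I -> B -> C) (X : B -> B -> Z) v i j :
  bijective g ->
  mlr (fun i k => u i (g k)) (fun k l => X (g k) (g l)) (fun k j => v (g k) j) i j = mlr u X v i j.
Proof.
move=> gb; rewrite /mlr [RHS](reindex g); last exact: onW_bij.
by apply: eq_bigr => k _; rewrite [RHS](reindex g)//; exact: onW_bij.
Qed.

Lemma mul_lt_perturb a b r : 0 <= a -> 0 <= b -> a * b < r ->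
  exists2 e : R, 0 < e & (a + e) * (b + e) < r.
Proof.
move=> a0 b0 h; pose t := a + b + 1; have t0 : 0 < t by rewrite /t; lra.
exists (Num.min 1 ((r - a * b) / (2 * t))).
  by rewrite lt_min ltr01 divr_gt0 ?subr_gt0// mulr_gt0.
set e := Num.min _ _; have e1 : e <= 1 by rewrite ge_min lexx.
have e0 : 0 < e by rewrite lt_min ltr01 divr_gt0 ?subr_gt0// mulr_gt0.
have e2 : e * t <= (r - a * b) / 2.
  have : e <= (r - a * b) / (2 * t) by rewrite ge_min lexx orbT.
  by rewrite ler_pdivlMr ?mulr_gt0// mulrCA mulrC -ler_pdivlMr.
have : (a + e) * (b + e) <= a * b + e * t.
  rewrite (_ : (a + e) * (b + e) = a * b + e * (a + b + e)); last by ring.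
  by rewrite lerD2l ler_pM2l// /t lerD2l.
by move=> /le_lt_trans; apply; lra.
Qed.

Variables (NE NF : mxnorm V) (E F : forall I : finType, (I -> I -> imx) -> R -> Prop).
Hypotheses (hEF : schpair E F) (sE : subclosed E) (sF : subclosed F).
Hypotheses (rE : rep NE E) (rF : rep NF F).
Let hE := sp_E hEF.
Let hF := sp_F hEF.
Local Notation Q := (@Qb R E F (MX R) (@schM R)).
Local Notation QT := (@Qb R E F TZ tensT).
Local Notation P n := (@proj_norm R V V NE NF n).

Lemma rep_ge0 (N : mxnorm V) (G : forall I : finType, (I -> I -> imx) -> R -> Prop) n (x : mat n V) :
  opsp G -> rep N G -> (0 <= N n x)%E.
Proof. by move=> hG rG; apply: norm_ge0 (rG.2 n x) _ => c; exact: os_ge0. Qed.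

Lemma proj_norm_QT n (u : mat n TZ) r : (P n u < r%:E)%E -> QT u r.
Proof.
move=> /ereal_inf_lt[_ [p [q [a [x [y [b [hx hy -> ->]]]]]]]].
have [al -> oa] := opnorm_fin a; have [be -> ob] := opnorm_fin b.
have [xi [xi0 -> hxi]] := norm_fin (rE.2 p x) (fun c => os_ge0 hE (c := c)) hx; have [et [et0 -> het]] := norm_fin (rF.2 q y) (fun c => os_ge0 hF (c := c)) hy.
have al0 := opb_ge0 oa; have be0 := opb_ge0 ob.
rewrite -!EFinM lte_fin => /mul_lt_perturb[]//; first by rewrite !mulr_ge0.
move=> e1 e10 h1.
(* The norms of x and y are infima and [Qb_intro] takes positive bounds, so all four factors are
   enlarged, one product at a time from the outside in. *)
have lt1 : al * xi * et < al * xi * et + e1 by rewrite ltrDl.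
have [e2 e20 h2] := mul_lt_perturb (mulr_ge0 al0 xi0) et0 lt1.
have lt2 : al * xi < al * xi + e2 by rewrite ltrDl.
have [e3 e30 h3] := mul_lt_perturb al0 xi0 lt2.
have gb : bijective (@mxtens_index p q).
  by exists (@mxtens_unindex p q); [exact: mxtens_indexK|exact: mxtens_unindexK].
have ua : opb (fun i k => a i (mxtens_index k)) (al + e3).
  by apply: (opb_sub (f := id) _ (bij_inj gb) (opb_le _ oa)) => //; rewrite lerDl ltW.
have ub : opb (fun k j => b (mxtens_index k) j) (be + e1).
  by apply: (opb_sub (g := id) (bij_inj gb) _ (opb_le _ ob)) => //; rewrite lerDl ltW.
have h := Qb_intro hE hF tensTZl tensTZr (ltr_wpDl al0 e30) (ltr_wpDl xi0 e30)
  (ltr_wpDl et0 e20) (ltr_wpDl be0 e10) ua (hxi _ e30) (het _ e20) ub.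
apply: Qb_ext (Qb_le _ h).
  move=> i j; rewrite -[RHS]/(mlr (Z := TZ) a (mxamp tensT x y) b i j).
  rewrite -(mlr_reindex a (mxamp tensT x y) b i j gb).
  apply: eq_bigr => k _; apply: eq_bigr => l _; rewrite /mxamp !mxtens_indexK.
  reflexivity.
apply: ltW; apply: le_lt_trans h1.
rewrite ler_pM2r ?(ltr_wpDl be0)//; apply: ltW; apply: le_lt_trans h2.
by rewrite ler_pM2r ?(ltr_wpDl et0)// ltW.
Qed.

Lemma QT_proj_norm n (u : mat n TZ) r : QT u r -> (P n u <= r%:E)%E.
Proof.
move=> [r0 [A [B [x [y [a [b [oa ob hx hy hu]]]]]]]].
pose g (k : 'I_(#|A| * #|B|)) : A * B :=
  (enum_val (mxtens_unindex k).1, enum_val (mxtens_unindex k).2).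
have gi : injective g.
  move=> k l e; apply: (can_inj (@mxtens_unindexK _ _)).
  have e1 := enum_val_inj (congr1 fst e); have e2 := enum_val_inj (congr1 snd e).
  exact: injective_projections e1 e2.
have gb : bijective g.
  exists (fun s : A * B => mxtens_index (enum_rank s.1, enum_rank s.2)).
    by move=> k; rewrite /g !enum_valK -surjective_pairing mxtens_unindexK.
  by move=> [s t]; rewrite /g mxtens_indexK !enum_rankK.
pose a' : 'M[C]_(n, #|A| * #|B|) := \matrix_(i, k) a i (g k).
pose b' : 'M[C]_(#|A| * #|B|, n) := \matrix_(k, j) b (g k) j.
have ha : (opnorm a' <= (Num.sqrt r)%:E)%E.
  apply/opnorm_finP; apply: opb_ext (opb_sub (f := id) (@inj_id _) gi oa) => i j.
  by rewrite mxE.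
have hb : (opnorm b' <= (Num.sqrt r)%:E)%E.
  apply/opnorm_finP; apply: opb_ext (opb_sub (g := id) gi (@inj_id _) ob) => i j.
  by rewrite mxE.
pose x' : mat #|A| V := fun i j => x (enum_val i) (enum_val j).
pose y' : mat #|B| V := fun i j => y (enum_val i) (enum_val j).
have hx' : (NE x' <= 1%:E)%E by apply: rE.1; exact: sE enum_val_inj hx.
have hy' : (NF y' <= 1%:E)%E by apply: rF.1; exact: sF enum_val_inj hy.
apply: (@le_trans _ _ (opnorm a' * NE x' * NF y' * opnorm b')%E).
  apply: ereal_inf_lbound; exists #|A|, #|B|, a', x', y', b'; split=> //.
  - by apply: le_lt_trans hx' _; rewrite ltry.
  - by apply: le_lt_trans hy' _; rewrite ltry.
  apply/funext => i; apply/funext => j; rewrite hu -(mlr_reindex _ _ _ _ _ gb).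
  by apply: eq_bigr => k _; apply: eq_bigr => l _; rewrite !mxE.
have x0 := rep_ge0 x' hE rE; have y0 := rep_ge0 y' hF rF.
have -> : r%:E = ((Num.sqrt r)%:E * 1%:E * 1%:E * (Num.sqrt r)%:E)%E.
  by rewrite -!EFinM !mulr1 -expr2 sqr_sqrtr.
by do 3?[apply: lee_pmul => //; rewrite ?mule_ge0 ?opnorm_ge0//].
Qed.

Lemma QT_psi n (u : mat n TZ) r : QT u r -> Q (fun i j => psiT (u i j)) r.
Proof.
move=> [r0 [A [B [x [y [a [b [oa ob hx hy hu]]]]]]]]; split=> //.
by exists A, B, x, y, a, b; split=> // i j; rewrite hu psiT_mlr.
Qed.

Lemma Q_lift n (X : 'I_n -> 'I_n -> MX R) r : Q X r ->
  exists u : mat n TZ, QT u r /\ forall i j, psiT (u i j) = X i j.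
Proof.
move=> [r0 [A [B [x [y [a [b [oa ob hx hy hu]]]]]]]].
exists (mlr a (amp tensT x y) b); split; last by move=> i j; rewrite hu psiT_mlr.
by split=> //; exists A, B, x, y, a, b.
Qed.

Lemma proj_norm_ge0 n (u : mat n TZ) : (0 <= P n u)%E.
Proof. by apply: norm_ge0 (@proj_norm_QT n u) _ => c; exact: Qb_ge0. Qed.

(** The norms of a Cauchy sequence converge in the reals, so the [limn] of the quotient norm is a
    true limit and not a default value. *)
Lemma proj_norm_lim n (u : nat -> mat n TZ) : (forall k, (P n (u k) < +oo)%E) ->
  norm_cauchy (P n) u -> exists l : R, limn (fun k => P n (u k)) = l%:E /\
    forall e, 0 < e -> exists K, forall k, (K <= k)%N ->
      QT (u k) (l + e) /\ (l%:E <= P n (u k) + e%:E)%E.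
Proof.
move=> hfin hc; have ff k : P n (u k) \is a fin_num by rewrite ge0_fin_numE// proj_norm_ge0.
pose w k := fine (P n (u k)); have wE k : P n (u k) = (w k)%:E by rewrite fineK.
have close e : 0 < e -> exists K, forall k l, (K <= k)%N -> (K <= l)%N -> w k <= w l + e.
  move=> e0; have e2 : 0 < e / 2 by lra.
  have [K hK] := hc _ e2; exists K => k l Kk Kl.
  have q1 := proj_norm_QT (hK k l Kk Kl).
  have q2 : QT (u l) (w l + e / 2) by apply: proj_norm_QT; rewrite wE lte_fin ltrDl.
  have := QT_proj_norm (Qb_ext _ (QbD hE hF tensT0 q1 q2)).
  move=> /(_ (u k)); rewrite wE lee_fin => h.
  have -> : w l + e = e / 2 + (w l + e / 2) by field.
  by apply: h => i j; rewrite -[u k i j](subrK (u l i j)).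
have [e e0|l hl] := @real_cauchy R w.
  have [K hK] := close e e0; exists K => k m Kk Km.
  by rewrite ler_distl lerBlDr !hK.
exists l; split.
  have -> : (fun k => P n (u k)) = EFin \o w by apply/funext => k; rewrite wE.
  apply: cvg_lim => //; apply: cvg_EFin; first by near=> k.
  apply/cvgrPdist_le => e e0; have [K hK] := hl e e0.
  by exists K => // k /= /hK; rewrite distrC.
move=> e e0; have e2 : 0 < e / 2 by lra.
have [K hK] := hl _ e2; exists K => k /hK; rewrite ler_distl => /andP[h1 h2]; split.
  apply: proj_norm_QT; rewrite wE lte_fin; lra.
by rewrite wE -EFinD lee_fin; lra.
Unshelve. all: by end_near.
Qed.

(** The formula of [Rpcb] with [NE] and [NF] in place of the two Schatten norms; [Rpcb] is an
    instance by conversion. *)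
Definition Nquot : mxnorm V := fun n x =>
  ereal_inf [set limn (fun k => P n (u k)) | u in
    [set u | [/\ forall k, (P n (u k) < +oo)%E,
                 norm_cauchy (P n) u &
                 norm_cvg (@Sone R n) \oo (fun k i j => psi (u k i j)) x]]].

Lemma Nquot_Nb n (x : mat n V) r : (Nquot x < r%:E)%E -> Nb E F (x : 'I_n -> 'I_n -> MX R) r.
Proof.
move=> /ereal_inf_lt[_ [u [h1 h2 h3] <-]].
have [l [-> hl]] := proj_norm_lim h1 h2; rewrite lte_fin => lr.
have e0 : 0 < r - l by rewrite subr_gt0.
have [K hK] := hl _ e0.
have qK k : QT (u (K + k)%N) r.
  by have [q _] := hK (K + k)%N (leq_addr _ _); rewrite addrC subrK in q.
split; first exact: Qb_ge0 (qK 0%N).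
exists (fun k i j => psiT (u (K + k)%N i j)); split=> [k|e e1|i j p q e e1].
- exact: QT_psi.
- have [L hL] := h2 e e1; exists L => k m Lk Lm.
  by apply: (QT_psi (proj_norm_QT (hL _ _ _ _))); exact: leq_trans (leq_addl _ _).
- have [L _ hL] := h3 e e1; exists L => k Lk.
  have /ltW/SoneP h := hL (K + k)%N (leq_trans Lk (leq_addl _ _)).
  exact: (SO_entry i j p q h).
Qed.

Lemma geom_sum e m k : (m <= k)%N ->
  \sum_(m <= j < k) e * 2^-1 ^+ j.+1 = e * (2^-1 ^+ m - 2^-1 ^+ k).
Proof.
move=> /subnK <-; elim: (k - m)%N => [|t ih]; first by rewrite add0n big_geq// subrr mulr0.
rewrite addSn big_nat_recr ?leq_addl//= ih -mulrDr; congr (e * _).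
by rewrite exprS; field.
Qed.

(** Each approximant lifts to the algebraic tensor product, but independent lifts need not form a
    Cauchy sequence. Lifting the successive differences, of norm at most [dl], and summing them
    gives one; the rates add up to at most e. *)
Lemma Nb_Nquot n (x : mat n V) r : Nb E F (x : 'I_n -> 'I_n -> MX R) r -> (Nquot x <= r%:E)%E.
Proof.
move=> hx; apply/lee_addgt0Pr => e e0; rewrite -EFinD.
pose dl m := e * 2^-1 ^+ m.+1.
have dl0 m : 0 < dl m by rewrite mulr_gt0// exprn_gt0// invr_gt0.
have [Y [hY hYc hYx]] := Nb_rate dl0 hx.
pose rr k := if k is m.+1 then dl m else r.
pose DY k i j := if k is m.+1 then Y m.+1 i j - Y m i j else Y 0%N i j.
have hD k : Q (DY k) (rr k) by case: k => [|k]; [exact: hY|exact: hYc].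
have [D hDu] := choice (fun k => Q_lift (hD k)).
pose u k : mat n TZ := fun i j => \sum_(0 <= m < k.+1) D m i j.
have psiu k i j : psiT (u k i j) = Y k i j.
  elim: k => [|k ih]; first by rewrite /u big_nat1 (hDu 0%N).2.
  by rewrite /u big_nat_recr//= psiTD ih (hDu k.+1).2 addrC subrK.
have srr k l : (k <= l)%N -> \sum_(k.+1 <= m < l.+1) rr m <= e * 2^-1 ^+ k.
  move=> kl; rewrite big_add1/= (geom_sum e kl) mulrBr gerBl.
  by rewrite mulr_ge0 ?(ltW e0)// exprn_ge0// invr_ge0.
have qu k : QT (u k) (r + e).
  apply: Qb_le (Qb_sum hE hF tensT0 (fun m _ => (hDu m).1)).
  rewrite big_ltn//= lerD2l; apply: le_trans (srr 0%N k _) _ => //.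
  by rewrite expr0 mulr1.
have qd k l : (k <= l)%N -> QT (fun i j => u l i j - u k i j) (e * 2^-1 ^+ k).
  move=> kl; apply: Qb_ext (Qb_le (srr k l kl) (Qb_sum hE hF tensT0 (fun m _ => (hDu m).1))) => i j.
  by rewrite /u [in RHS](big_cat_nat (n := k.+1))//= [RHS]addrC addKr.
have pfin k : (P n (u k) < +oo)%E by apply: le_lt_trans (QT_proj_norm (qu k)) _; rewrite ltry.
have pc : norm_cauchy (P n) u.
  move=> t t0; have t2 : 0 < t / 2 by lra.
  have [|K hK] := @expr_small R 2^-1 e (t / 2) _ t2; first by rewrite invr_gt0 ltr0n invf_lt1 ?ltr1n.
  have small k : (K <= k)%N -> e * 2^-1 ^+ k <= t / 2.
    move=> Kk; apply: le_trans hK; rewrite mulrC ler_pM2r//.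
    by apply: ler_wiXn2l => //; rewrite ?invr_ge0// invf_le1// ler1n.
  exists K => k l Kk Kl; apply: (@le_lt_trans _ _ (t / 2)%:E); last by rewrite lte_fin; lra.
  apply: QT_proj_norm; have [lk|/ltnW kl] := leqP l k.
    exact: Qb_le (small l Kl) (qd l k lk).
  apply: Qb_ext (QbN (Qb_le (small k Kk) (qd k l kl))) => i j.
  by rewrite opprB.
have [l [lE hl]] := proj_norm_lim pfin pc.
have lr : l <= r + e.
  apply/ler_addgt0Pr => t t0; have [K hK] := hl t t0; have [_ h] := hK K (leqnn K).
  rewrite -lee_fin; apply: le_trans h _; rewrite EFinD leeD2r//; exact: QT_proj_norm.
apply: (@le_trans _ _ l%:E); last by rewrite lee_fin.
apply: ereal_inf_lbound; exists u => //; split=> // t t0.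
have t2 : 0 < t / 2 by lra.
have [|K hK] := @expr_small R 2^-1 e (t / 2) _ t2; first by rewrite invr_gt0 ltr0n invf_lt1 ?ltr1n.
exists K => // k /= Kk; apply: (@le_lt_trans _ _ (t / 2)%:E); last by rewrite lte_fin; lra.
apply/SoneP.
have h : SO (fun i j => x i j - Y k i j) (t / 2).
  apply: (SO_ecvg (N0 := k)) (ecvgB_cst (Y k) hYx) => [|m km]; first exact: ltW.
  apply: SO_le (Q_SO hEF (hYc k m km)).
  rewrite /dl; apply: le_trans hK; rewrite mulrC ler_pM2r//.
  by apply: ler_wiXn2l (leqW Kk) => //; rewrite ?invr_ge0// invf_le1// ler1n.
move: h => /(SOZ (-1)); rewrite ncN nc1 mul1r; apply: SO_ext => i j p q.
rewrite -[RHS]/(psiT (u k i j) p q - x i j p q) psiu.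
by rewrite -[LHS]/(-1 * (x i j p q - Y k i j p q)) mulN1r opprB.
Qed.

End ProjectiveTensorProduct.

(** * The predual of the multiplier space *)

Section Predual.
Variable R : realType.
Local Notation nc := (@ComplexField.Normc.normc R).
Local Notation C := (R[i]).
Local Notation imx := (nat -> nat -> C).
Local Notation V := (infmx R).
Implicit Types (I J A B : finType) (c d e r s : R).

Variables (NE NF : mxnorm V) (E F : forall I : finType, (I -> I -> imx) -> R -> Prop).
Hypotheses (hEF : schpair E F) (sE : subclosed E) (sF : subclosed F).
Hypotheses (rE : rep NE E) (rF : rep NF F).
Local Notation N n := (@Nquot R NE NF n).
Local Notation Nb := (Nb E F).
Local Notation MX := (MX R).

Lemma N_Nb n (x : mat n V) c : (N n x < c%:E)%E -> Nb (x : 'I_n -> 'I_n -> MX) c.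
Proof. exact: (Nquot_Nb hEF sE sF rE rF). Qed.

Lemma Nb_N n (x : mat n V) c : Nb (x : 'I_n -> 'I_n -> MX) c -> (N n x <= c%:E)%E.
Proof. exact: (Nb_Nquot hEF sE sF rE rF). Qed.

Lemma N_ge0 n (x : mat n V) : (0 <= N n x)%E.
Proof. by apply: norm_ge0 (@N_Nb n x) _ => c; exact: Nb_ge0. Qed.

Lemma N_fin n (x : mat n V) : (N n x < +oo)%E -> exists c,
  [/\ 0 <= c, N n x = c%:E & forall e, 0 < e -> Nb (x : 'I_n -> 'I_n -> MX) (c + e)].
Proof. by apply: norm_fin (@N_Nb n x) _ => c; exact: Nb_ge0. Qed.

Lemma N_le n (x : mat n V) c : (forall e, 0 < e -> Nb (x : 'I_n -> 'I_n -> MX) (c + e)) ->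
  (N n x <= c%:E)%E.
Proof. by move=> h; apply/lee_addgt0Pr => e e0; rewrite -EFinD; apply/Nb_N/h. Qed.

Lemma N_fin_Nb n (x : mat n V) : (N n x < +oo)%E -> exists c, Nb (x : 'I_n -> 'I_n -> MX) c.
Proof. by move=> /N_fin[c [_ _ h]]; exists (c + 1); exact: h. Qed.

Lemma N0 n : N n 0 = 0%E.
Proof.
apply/eqP; rewrite eq_le N_ge0 andbT; apply: Nb_N; exact: Nb0.
Qed.

Lemma N_lty n (x : mat n V) c : Nb (x : 'I_n -> 'I_n -> MX) c -> (N n x < +oo)%E.
Proof. by move=> /Nb_N h; apply: le_lt_trans h _; rewrite ltry. Qed.

Lemma Nb_entry I (x : I -> I -> MX) c i j p q : Nb x c -> nc (x i j p q) <= c.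
Proof. by move=> h; exact: (SO_entry i j p q (Nb_SO hEF h)). Qed.

Lemma lty_or (x : \bar R) : x = +oo%E \/ (x < +oo)%E.
Proof. by have [->|xy] := eqVneq x +oo%E; [left|right; rewrite lt_neqAle xy leey]. Qed.

Lemma N_def n (x : mat n V) : N n x = 0%E -> x = 0.
Proof.
move=> h; apply/funext => i; apply/funext => j; apply/funext => p; apply/funext => q.
apply/eqP; rewrite -nc_eq0 eq_le nc_ge0 andbT; apply/ler_addgt0Pr => e e0; rewrite add0r.
by apply: (@Nb_entry _ (x : 'I_n -> 'I_n -> MX)); apply: N_Nb; rewrite h lte_fin.
Qed.

Lemma N_scale_le n (a : C) (x : mat n V) : a != 0 -> (N n (a *: x) <= (nc a)%:E * N n x)%E.
Proof.
move=> a0; have na : 0 < nc a by rewrite nc_gt0.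
have [->|/N_fin[c [c0 -> h]]] := lty_or (N n x); first by rewrite gt0_muley ?lte_fin// leey.
rewrite -EFinM; apply: N_le => e e0.
have := NbZ a (h _ (divr_gt0 e0 na)).
by rewrite mulrDr mulrCA divff ?gt_eqF// mulr1.
Qed.

Lemma N_scale n (a : C) (x : mat n V) : N n (a *: x) = ((nc a)%:E * N n x)%E.
Proof.
have [->|a0] := eqVneq a 0; first by rewrite scale0r N0 nc0 mul0e.
apply/eqP; rewrite eq_le N_scale_le//=.
have na : 0 < nc a by rewrite nc_gt0.
rewrite -[X in N n X](scalerK a0).
apply: (@le_trans _ _ ((nc a)%:E * ((nc a^-1)%:E * N n (a *: x)))%E).
  by rewrite lee_pmul2l ?lte_fin//; apply: N_scale_le; rewrite invr_eq0.
by rewrite muleA -EFinM -ncM divff// nc1 mul1e.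
Qed.

Lemma N_triangle n (x y : mat n V) : (N n (x + y)%R <= N n x + N n y)%E.
Proof.
have [->|/N_fin[c [c0 -> h]]] := lty_or (N n x).
  by rewrite addye ?leey// -ltNye (lt_le_trans _ (N_ge0 y)).
have [->|/N_fin[d [d0 -> h']]] := lty_or (N n y); first by rewrite addey ?leey.
rewrite -EFinD; apply: N_le => e e0; have e2 : 0 < e / 2 by lra.
have := NbD hEF (h _ e2) (h' _ e2).
by have -> : c + e / 2 + (d + e / 2) = c + d + e by field.
Qed.

Lemma N_dsum m n (x : mat m V) (y : mat n V) :
  N (m + n)%N (mxdsum x y) = maxe (N m x) (N n y).
Proof.
have si : injective (@fintype.split m n) by exact: (can_inj (@splitK m n)).
apply/eqP; rewrite eq_le; apply/andP; split.
  have [->|/N_fin[c [c0 -> h]]] := lty_or (N m x); first by rewrite maxye leey.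
  have [->|/N_fin[d [d0 -> h']]] := lty_or (N n y); first by rewrite maxey leey.
  rewrite -EFin_max; apply: N_le => e e0.
  have h1 : Nb (x : 'I_m -> 'I_m -> MX) (Num.max c d + e).
    by apply: Nb_le (h _ e0); rewrite lerD2r le_max lexx.
  have h2 : Nb (y : 'I_n -> 'I_n -> MX) (Num.max c d + e).
    by apply: Nb_le (h' _ e0); rewrite lerD2r le_max lexx orbT.
  apply: Nb_ext (Nb_sub si si (Nb_dsum hEF h1 h2)) => i j.
  by rewrite /mxdsum /dsum; case: (fintype.split i); case: (fintype.split j).
have [->|/N_fin[c [c0 -> h]]] := lty_or (N (m + n)%N (mxdsum x y)); first by rewrite leey.
rewrite ge_max; apply/andP; split; apply: N_le => e e0.
  apply: Nb_ext (Nb_sub (@lshift_inj m n) (@lshift_inj m n) (h _ e0)) => i j.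
  by rewrite /mxdsum !(unsplitK (inl _)).
apply: Nb_ext (Nb_sub (@rshift_inj m n) (@rshift_inj m n) (h _ e0)) => i j.
by rewrite /mxdsum !(unsplitK (inr _)).
Qed.

Lemma Nb_mlr I J (X : J -> J -> MX) (u : I -> J -> C) (v : J -> I -> C) a b r : 0 < a -> 0 < b ->
  opb u a -> opb v b -> Nb X r -> Nb (mlr u X v) (a * r * b).
Proof.
move=> a0 b0 hu hv hX.
have ca : nc (a%:C)%C = a by rewrite nc_real ger0_norm// ltW.
have cb : nc (b%:C)%C = b by rewrite nc_real ger0_norm// ltW.
have hu' : opb (fun i j => (a%:C)%C^-1 * u i j) 1.
  by have := opbZ ((a%:C)%C^-1) hu; rewrite ncV ca mulVf// gt_eqF.
have hv' : opb (fun i j => (b%:C)%C^-1 * v i j) 1.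
  by have := opbZ ((b%:C)%C^-1) hv; rewrite ncV cb mulVf// gt_eqF.
have := Nb_mlr1 hu' hv' (NbZ ((a%:C)%C * (b%:C)%C) hX).
rewrite ncM ca cb mulrAC; apply: Nb_ext => i j; apply: mlr_scale.
have na : (a%:C)%C != 0 :> C by rewrite -nc_eq0 ca gt_eqF.
have nb : (b%:C)%C != 0 :> C by rewrite -nc_eq0 cb gt_eqF.
by field; rewrite na nb.
Qed.

Lemma N_mxlr n m (a : 'M[C]_(n, m)) (x : mat m V) (b : 'M[C]_(m, n)) :
  (N n (mxlr a x b) <= opnorm a * N m x * opnorm b)%E.
Proof.
have [al -> oa] := opnorm_fin a; have [be -> ob] := opnorm_fin b.
have x0 := N_ge0 x.
have z0 (k : nat) (l : nat) (w : 'M[C]_(k, l)) (t : R) i j : opb (fun i j => w i j) t -> t = 0 -> w i j = 0.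
  move=> hw t0; apply/eqP; rewrite -nc_eq0 eq_le nc_ge0 andbT -t0; exact: (opb_entry i j hw).
(* A vanishing scalar factor is treated apart: the right side is then 0 even when the norm of x is
   infinite, so the left side has to vanish. *)
have [al0|al0] := eqVneq al 0.
  rewrite (_ : mxlr a x b = 0) ?N0 ?al0 ?mul0e//.
  apply/funext => i; apply/funext => j; rewrite /mxlr big1// => k _; rewrite big1// => l _.
  by rewrite (z0 _ _ _ _ _ _ oa al0) mul0r scale0r.
have [be0|be0] := eqVneq be 0.
  rewrite (_ : mxlr a x b = 0) ?N0 ?be0 ?mule0//.
  apply/funext => i; apply/funext => j; rewrite /mxlr big1// => k _; rewrite big1// => l _.
  by rewrite (z0 _ _ _ _ _ _ ob be0) mulr0 scale0r.
have alp : 0 < al by rewrite lt_def al0 (opb_ge0 oa).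
have bep : 0 < be by rewrite lt_def be0 (opb_ge0 ob).
have [->|/N_fin[c [c0 -> h]]] := lty_or (N m x).
  by rewrite gt0_muley ?lte_fin// gt0_mulye ?lte_fin// leey.
rewrite -!EFinM; apply: N_le => e e0.
have ab : 0 < al * be by rewrite mulr_gt0.
have := Nb_mlr alp bep oa ob (h _ (divr_gt0 e0 ab)).
have -> : al * (c + e / (al * be)) * be = al * c * be + e by field; rewrite al0 be0.
by apply: Nb_ext => i j.
Qed.

Lemma half_pow_gt0 j : 0 < 2^-1 ^+ j :> R.
Proof. by rewrite exprn_gt0// invr_gt0. Qed.

(** The limit l exists entrywise, since the norm dominates the entries. Along a subsequence with
    steps 2^-j the difference l - u (phi m) is the sum of a telescoping series, to which [Nb_series]
    applies. *)
Lemma N_complete (u : nat -> V) : (forall k, carrier (@Nquot R NE NF) (u k)) ->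
  norm_cauchy (fun v => N 1 (mat1 v)) u ->
  exists2 l, carrier (@Nquot R NE NF) l & norm_cvg (fun v => N 1 (mat1 v)) \oo u l.
Proof.
move=> hu hc.
have [f hf] := choice (fun j => hc _ (half_pow_gt0 j)).
pose phi j := \sum_(i < j.+1) f i.
have phiS j : (phi j <= phi j.+1)%N by rewrite /phi [leqRHS]big_ord_recr/= leq_addr.
have phif j : (f j <= phi j)%N by rewrite /phi big_ord_recr/= leq_addl.
have hphi j k l : (phi j <= k)%N -> (phi j <= l)%N ->
    Nb (fun _ _ : 'I_1 => (u k - u l : MX)) (2^-1 ^+ j).
  by move=> jk jl; apply: (@N_Nb 1 (mat1 (u k - u l))); apply: hf; exact: leq_trans (phif j) _.
have entry j k l p q : (phi j <= k)%N -> (phi j <= l)%N -> nc (u k p q - u l p q) <= 2^-1 ^+ j.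
  by move=> jk jl; exact: (Nb_entry ord0 ord0 p q (hphi j k l jk jl)).
have small e : 0 < e -> exists j, 2^-1 ^+ j <= e.
  move=> e0; have [|j] := @expr_small R 2^-1 1 e _ e0; first by rewrite invr_gt0 ltr0n invf_lt1 ?ltr1n.
  by rewrite mulr1 => h; exists j.
have cu p q : exists l, scvg (fun k => u k p q) l.
  apply: scvg_cauchy => e /small[j hj]; exists (phi j) => k l jk kl.
  exact: le_trans (entry j l k p q (leq_trans jk kl) jk) hj.
have [l hl] : exists l : nat -> nat -> C, forall p q, scvg (fun k => u k p q) (l p q).
  have [g hg] := choice (fun r : nat * nat => cu r.1 r.2).
  by exists (fun p q => g (p, q)) => p q; exact: hg (p, q).
have lphi j m p q : (j <= m)%N -> nc (u (phi m) p q - l p q) <= 2^-1 ^+ j.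
  move=> jm; have pm : (phi j <= phi m)%N.
    by move: jm => /subnK <-; elim: (m - j)%N => // t ih; exact: leq_trans ih (phiS _).
  apply: (@scvg_bound _ (fun k => u (phi m) p q - u k p q) _ _ (phi j)); last by move=> k jk; exact: entry.
  apply: (scvg_ext (u := fun k => -1 * u k p q + u (phi m) p q)).
    by move=> k; rewrite mulN1r addrC.
  have -> : u (phi m) p q - l p q = -1 * l p q + u (phi m) p q by rewrite mulN1r addrC.
  apply: scvgD; first exact: scvgM.
  by move=> e e0; exists 0%N => k _; rewrite subrr nc0 ltW.
(* The bound is the sum of the geometric series of all steps from m on. *)
have key m : Nb (fun _ _ : 'I_1 => (l - u (phi m) : MX)) (2^-1 ^+ m *+ 2).
  apply: (@Nb_series _ _ _ hEF _ (fun j _ _ => (u (phi (m + j.+1)%N) - u (phi (m + j)%N) : MX))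
    (fun j => 2^-1 ^+ (m + j))).
  - by move=> j; apply: hphi => //; rewrite addnS.
  - move=> k; have := geom_sum (2^-1 ^+ m *+ 2 : R) (leq0n k).
    rewrite expr0 => hs; apply: (@le_trans _ _ (2^-1 ^+ m *+ 2 * (1 - 2^-1 ^+ k))); last first.
      by rewrite ler_piMr ?mulrn_wge0 ?(ltW (half_pow_gt0 _))// gerBl ltW// half_pow_gt0.
    rewrite -hs; apply: ler_sum => j _.
    rewrite (_ : _ *+ 2 * _ = 2^-1 ^+ (m + j)) // exprD exprS -mulr_natr.
    by move: (2^-1 ^+ m : R) (2^-1 ^+ j : R) => v w; field.
  - move=> _ _ p q e e0; have [t ht] := small e e0; exists t => k tk.
    rewrite (@telescope_sumr _ 0 k (fun j => u (phi (m + j)%N) : MX))// addn0.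
    rewrite -[X in nc X]/(u (phi (m + k)%N) p q - u (phi m) p q - (l p q - u (phi m) p q)).
    rewrite opprB addrA subrK; apply: le_trans ht; apply: lphi.
    exact: leq_trans tk (leq_addl _ _).
have near m k : (phi m <= k)%N -> Nb (fun _ _ : 'I_1 => (u k - l : MX)) (2^-1 ^+ m *+ 3).
  move=> mk; have := NbB hEF (hphi m k (phi m) mk (leqnn _)) (key m).
  rewrite -mulrS; apply: Nb_ext => _ _.
  by apply: MXP => p q; rewrite !MXD !MXN !MXD !MXN; ring.
exists (l : V).
  have [c [c0 _ h]] := N_fin (hu (phi 0)).
  apply: (@N_lty 1 _ (c + 1 + 2^-1 ^+ 0 *+ 2)); apply: Nb_ext (NbD hEF (h 1 ltr01) (key 0%N)) => i j.
  by rewrite /mat1 addrC subrK.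
move=> e e0; have [j hj] := small (e / 4) ltac:(lra).
exists (phi j) => // k /= jk.
apply: (@le_lt_trans _ _ (2^-1 ^+ j *+ 3)%:E); first by apply: (@Nb_N 1); exact: near.
by rewrite lte_fin -mulr_natr; lra.
Qed.

Lemma N_opspace : complete_opspace (@Nquot R NE NF).
Proof.
split; [exact: N_ge0|exact: N_def|exact: N_scale|exact: N_triangle|exact: N_dsum|
  exact: N_mxlr|exact: N_complete].
Qed.

(** The algebraic laws are asked for on S_1, which contains the carrier by [Nb_SO]. Joint
    contractivity is asked for on products of arbitrary finite index types and pulled back along
    [mxtens_unindex]. *)
Lemma N_ccba (mul : V -> V -> V) :
  (forall I J (X : I -> I -> MX) (Y : J -> J -> MX) r s, Nb X r -> Nb Y s ->
    Nb (amp (mul : MX -> MX -> MX) X Y) (r * s)) ->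
  (forall (w : C) (a a' b : MX) r r' s, SO (fun _ _ : unit => a) r -> SO (fun _ _ : unit => a') r' ->
    SO (fun _ _ : unit => b) s -> mul (w *: a + a') b = w *: mul a b + mul a' b) ->
  (forall (w : C) (a b b' : MX) r s s', SO (fun _ _ : unit => a) r -> SO (fun _ _ : unit => b) s ->
    SO (fun _ _ : unit => b') s' -> mul a (w *: b + b') = w *: mul a b + mul a b') ->
  (forall (a b c : MX) r s t, SO (fun _ _ : unit => a) r -> SO (fun _ _ : unit => b) s ->
    SO (fun _ _ : unit => c) t -> mul a (mul b c) = mul (mul a b) c) ->
  completely_contractive_Banach_algebra (@Nquot R NE NF) mul.
Proof.
move=> hmul hl hr ha.
have jcc m n (x : mat m V) (y : mat n V) : (N m x < +oo)%E -> (N n y < +oo)%E ->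
    (N (m * n)%N (mxamp mul x y) <= N m x * N n y)%E.
  move=> /N_fin[c [c0 -> hx]] /N_fin[d [d0 -> hy]]; rewrite -EFinM.
  apply: N_le => e e0; have [|t t0 ht] := @mul_lt_perturb R c d (c * d + e) c0 d0; first by rewrite ltrDl.
  apply: Nb_le (ltW ht) _.
  have ui := can_inj (@mxtens_unindexK m n).
  by apply: Nb_ext (Nb_sub ui ui (hmul _ _ _ _ _ _ (hx t t0) (hy t t0))).
have so a : carrier (@Nquot R NE NF) a -> exists r, SO (fun _ _ : unit => a) r.
  move=> /N_fin_Nb[r hr']; exists r.
  exact: (SO_sub (f := fun=> ord0) (g := fun=> ord0) (@unit_inj _ _) (@unit_inj _ _) (Nb_SO hEF hr')).
split; first exact: N_opspace.
- move=> a b /N_fin_Nb[r hr'] /N_fin_Nb[s hs].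
  have i1 : injective (fun _ : 'I_1 => (ord0, ord0) : 'I_1 * 'I_1) by move=> i j _; rewrite !ord1.
  have := Nb_sub i1 i1 (hmul _ _ _ _ _ _ hr' hs); exact: (@N_lty 1).
- by move=> w a a' b /so[r h1] /so[r' h2] /so[s h3]; exact: hl h1 h2 h3.
- by move=> w a b b' /so[r h1] /so[r' h2] /so[s h3]; exact: hr h1 h2 h3.
- by move=> a b c /so[r h1] /so[r' h2] /so[s h3]; exact: ha h1 h2 h3.
- exact: jcc.
Qed.

Lemma N_schur : completely_contractive_Banach_algebra (@Nquot R NE NF) (@schur R).
Proof.
apply: N_ccba.
- by move=> I J X Y r s hX hY; exact: (Nb_sch hEF hX hY).
- move=> w a a' b r r' s _ _ _; exact: (etrans (schMDl _ _ _) (congr1 (fun z => z + _) (schMZl _ _ _))).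
- move=> w a b b' r s s' _ _ _; exact: (etrans (schMDr _ _ _) (congr1 (fun z => z + _) (schMZr _ _ _))).
- by move=> a b c r s t _ _ _; apply/funext => i; apply/funext => j; exact: mulrA.
Qed.

Lemma mxprod_pcvg (a b : MX) c d : bop a c -> bop b d -> pcvg a b (mxprod a b).
Proof.
move=> ha hb p q e e0.
have hb' : bop (transpose b) d by apply: bopI => K; exact: opb_tr (bopP K K hb).
have [K hK] := mxprod_scvg (row_mxprod_cvg ha hb') p q e0.
exists K => L /hK; congr (nc (_ - _) <= _).
by apply: eq_bigr => k _; rewrite mulr1.
Qed.

Lemma N_mxprod : completely_contractive_Banach_algebra (@Nquot R NE NF) (@mxprod R).
Proof.
have bo (a : MX) r : SO (fun _ _ : unit => a) r -> exists c, bop a c.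
  by move=> /SO_bnd h; exists (#|{: unit}|%:R * r); exact: (bnd_bop tt tt h).
have ct (a : MX) r : SO (fun _ _ : unit => a) r -> cpt a by exact: (SO_cpt tt tt).
apply: N_ccba.
- move=> I J X Y r s hX hY; apply: (Nb_prod hEF hX hY) => i j.
  apply: mxprod_pcvg (bnd_bop _ _ (SO_bnd (Nb_SO hEF hX))) (bnd_bop _ _ (SO_bnd (Nb_SO hEF hY))).
- move=> w a a' b r r' s /bo[c1 h1] /bo[c2 h2] /bo[c3 h3].
  have h12 : bop (w *: a + a' : MX) (nc w * c1 + c2) by exact: bndD (bndZ w h1) h2.
  apply: pcvg_uniq (mxprod_pcvg h12 h3) _.
  by apply: pcvgl; [exact: mxprod_pcvg h1 h3|exact: mxprod_pcvg h2 h3].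
- move=> w a b b' r s s' /bo[c1 h1] /bo[c2 h2] /bo[c3 h3].
  have h23 : bop (w *: b + b' : MX) (nc w * c2 + c3) by exact: bndD (bndZ w h2) h3.
  apply: pcvg_uniq (mxprod_pcvg h1 h23) _.
  by apply: pcvgr; [exact: mxprod_pcvg h1 h2|exact: mxprod_pcvg h1 h3].
- move=> a b c r s t ha hb hc.
  have [c1 h1] := bo _ _ ha; have [c2 h2] := bo _ _ hb; have [c3 h3] := bo _ _ hc.
  have p23 := mxprod_pcvg h2 h3; have p12 := mxprod_pcvg h1 h2.
  apply: (pcvg_assoc (ct _ _ ha) h1 (ct _ _ hb) h2 h3 p23 p12).
    exact: mxprod_pcvg h1 (pcvg_bnd h2 h3 p23).
  exact: mxprod_pcvg (pcvg_bnd h1 h2 p12) h3.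
Qed.

End Predual.

Theorem theorem1p1 (R : realType) (p : R) (hp : (1 <= p)%R) :
  completely_contractive_Banach_algebra (Rpcb p%:E) (@mxprod R) /\
  completely_contractive_Banach_algebra (Rpcb p%:E) (@schur R).
Proof.
have [E [F [hEF sE sF rE rF]]] := schatten_pair hp.
by split; [exact: N_mxprod hEF sE sF rE rF|exact: N_schur hEF sE sF rE rF].
Qed.
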